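(* Let $K$ be a field of characteristic $0$ and let $\alpha<\omega_1$ be an ordinal of the form $\alpha=\omega^{\beta_1}+\omega^{\beta_2}+k$ where $\beta_1\ge\beta_2$ are ordinals and $k\in\mathbb{N}$ (possibly $k=0$). Then $\operatorname{Span}_K(R_\alpha)$ has infinite codimension in $\operatorname{Span}_K(P_\alpha)$ as a $K$-vector space, i.e. the quotient $\operatorname{Span}_K(P_\alpha)/\operatorname{Span}_K(R_\alpha)$ is infinite dimensional over $K$.
   Context: $K((\mathbb{R}^{\le 0}))$ is the ring of generalized power series $b=\sum_{\gamma\in\mathbb{R}^{\le 0}}b_\gamma t^\gamma$ with $b_\gamma\in K$ whose support $\{\gamma: b_\gamma\ne 0\}$ is well-ordered, with the usual sum and product. For an ordinal $\alpha$, $P_\alpha$ is the set of $b\in K((\mathbb{R}^{\le 0}))$ whose support has order type $\omega^\alpha$ and supremum $0$, and $R_\alpha=\{b\in P_\alpha: b\text{ is reducible}\}$, where reducible means being a product of two non-units of $K((\mathbb{R}^{\le 0}))$. $\operatorname{Span}_K$ denotes the $K$-linear span inside $K((\mathbb{R}^{\le 0}))$. *)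

(* Defs.v *)
From HB Require Import structures.
From mathcomp Require Import all_boot all_order all_algebra.
From mathcomp Require Import finmap.
From mathcomp Require Import all_classical all_reals.

Set Implicit Arguments.
Unset Strict Implicit.
Unset Printing Implicit Defensive.

Import Order.TTheory GRing.Theory Num.Theory.

Local Open Scope classical_set_scope.
Local Open Scope ring_scope.

(** Ordinals are represented by well-ordered types; equality of ordinals is
    order isomorphism. *)

Record ordnum := OrdNum {
  ocar :> Type;
  olt : ocar -> ocar -> Prop;
  olt_wf : well_founded olt;
  olt_trans : forall x y z, olt x y -> olt y z -> olt x z;
  olt_total : forall x y, [\/ olt x y, x = y | olt y x] }.

Definition oiso (A B : ordnum) : Prop :=
  exists2 f : A -> B,
    bijective f & forall x y, olt (f x) (f y) <-> olt x y.

(** [A] is isomorphic to an initial segment of [B]. *)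
Definition ole (A B : ordnum) : Prop :=
  exists2 f : A -> B,
    (forall x y, olt (f x) (f y) <-> olt x y) &
    (forall x y, olt y (f x) -> exists z, f z = y).

(** [A < omega_1]. *)
Definition ocountable (A : ordnum) : Prop := countable [set: A].

Lemma olt_irr (A : ordnum) (x : A) : ~ olt x x.
Proof. by elim: (olt_wf x) => {}x _ IH xx; exact: (IH x). Qed.

Section FiniteOrdinal.
Variable k : nat.

Lemma onat_lt_wf : well_founded (fun i j : 'I_k => (i < j)%N).
Proof.
suff acc n (i : 'I_k) : (i < n)%N -> Acc (fun i j : 'I_k => (i < j)%N) i.
  by move=> i; exact: (acc k i (ltn_ord i)).
elim: n i => [//|n IH] i lein.
by constructor => j ltji; exact: (IH j (leq_trans ltji lein)).
Qed.

Lemma onat_lt_trans (i j l : 'I_k) : (i < j)%N -> (j < l)%N -> (i < l)%N.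
Proof. exact: ltn_trans. Qed.

Lemma onat_lt_total (i j : 'I_k) : [\/ (i < j)%N, i = j | (j < i)%N].
Proof.
case: (ltngtP i j) => [||/val_inj]; by [constructor 1|constructor 3|constructor 2].
Qed.

Definition onat := OrdNum onat_lt_wf onat_lt_trans onat_lt_total.
End FiniteOrdinal.

Section Sum.
Variables A B : ordnum.

Definition oadd_lt (u v : A + B) : Prop :=
  match u, v with
  | inl x, inl y => olt x y
  | inl _, inr _ => True
  | inr _, inl _ => False
  | inr x, inr y => olt x y
  end.

Lemma oadd_lt_wf : well_founded oadd_lt.
Proof.
have accl x : Acc oadd_lt (inl x).
  by elim: (olt_wf x) => {}x _ IH; constructor => -[y|//] /IH.
move=> [//|x]; elim: (olt_wf x) => {}x _ IH.
by constructor => -[y _|y /IH].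
Qed.

Lemma oadd_lt_trans u v w : oadd_lt u v -> oadd_lt v w -> oadd_lt u w.
Proof. by move: u v w => [x|x] [y|y] [z|z] //=; exact: olt_trans. Qed.

Lemma oadd_lt_total u v : [\/ oadd_lt u v, u = v | oadd_lt v u].
Proof.
move: u v => [x|x] [y|y] /=; try by [constructor 1|constructor 3].
all: by case: (olt_total x y) => [|->|];
  [constructor 1|constructor 2|constructor 3].
Qed.

Definition oadd := OrdNum oadd_lt_wf oadd_lt_trans oadd_lt_total.
End Sum.

(** [omega ^ A] is the set of finitely supported functions [A -> nat], compared
    at the largest argument where they differ: [f] stands for the Cantor normal
    form in which [omega ^ a] has coefficient [f a]. *)
Section OmegaPower.
Variable A : ordnum.

Definition fsupp_fun := {f : A -> nat | finite_set [set a | f a <> 0%N]}.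

Definition opow_lt (f g : fsupp_fun) : Prop :=
  exists2 a, (sval f a < sval g a)%N &
    forall b, olt a b -> sval f b = sval g b.

Lemma opow_has_max (S : set A) : finite_set S -> S !=set0 ->
  exists2 m, S m & forall x, olt m x -> ~ S x.
Proof.
suff seqmax (T : eqType) (lt : T -> T -> Prop) (s : seq T) (y : T) :
    (forall x y z, lt x y -> lt y z -> lt x z) ->
    (forall x y, [\/ lt x y, x = y | lt y x]) -> (forall x, ~ lt x x) ->
    exists2 m, m \in y :: s & forall x, lt m x -> x \notin y :: s.
  move=> /(@finite_seqP {classic A})[s ->] [y]; case: s => // y' s _.
  have [m ms mmax] := seqmax _ _ s y' (@olt_trans A) (@olt_total A) (@olt_irr A).
  by exists m => // x /mmax /negP.
move=> tr tot irr; elim: s y => [|z s IH] y.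
  by exists y; rewrite ?inE// => x yx; apply/negP; rewrite inE => /eqP xy;
    rewrite xy in yx; exact: irr yx.
have [m ms mmax] := IH z; case: (tot m y) => [my|<-|ym].
- exists y; first exact: mem_head.
  move=> x yx; rewrite inE negb_or mmax ?andbT; last exact: tr yx.
  by apply/eqP => xy; rewrite xy in yx; exact: irr yx.
- exists m; first exact: mem_head.
  move=> x mx; rewrite inE negb_or mmax ?andbT//.
  by apply/eqP => xm; rewrite xm in mx; exact: irr mx.
- exists m; first by rewrite inE ms orbT.
  move=> x mx; rewrite inE negb_or mmax ?andbT//.
  by apply/eqP => xy; rewrite xy in mx; exact: irr (tr _ _ _ mx ym).
Qed.

Lemma opow_lt_trans f g h : opow_lt f g -> opow_lt g h -> opow_lt f h.
Proof.
move=> [a fga eqfg] [b ghb eqgh]; case: (olt_total a b) => [ab|ab|ba].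
- by exists b => [|c bc]; rewrite eqfg// ?eqgh//; exact: olt_trans bc.
- rewrite -{b}ab in ghb eqgh; exists a; first exact: ltn_trans ghb.
  by move=> c ac; rewrite eqfg// eqgh.
- by exists a => [|c ac]; rewrite -?eqgh// ?eqfg//; exact: olt_trans ac.
Qed.

Lemma opow_lt_total f g : [\/ opow_lt f g, f = g | opow_lt g f].
Proof.
have [eqfg|/existsNP[a0 neq]] := pselect (forall a, sval f a = sval g a).
  constructor 2; case: f g eqfg => [f ff] [g gf] /= /funext efg.
  by subst g; congr exist; exact: Prop_irrelevance.
have [||a] := @opow_has_max [set a | sval f a <> sval g a]; last first.
- move=> /= /eqP; rewrite neq_ltn => /orP[lt|lt] mx; [constructor 1|constructor 3].
    by exists a => // b /mx /contrapT.
  by exists a => // b /mx /contrapT ->.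
- by exists a0.
have : finite_set ([set a | sval f a <> 0%N] `|` [set a | sval g a <> 0%N]).
  by rewrite finite_setU; split; [exact: (svalP f)|exact: (svalP g)].
apply: sub_finite_set => a /= fga.
have [fa|] := pselect (sval f a = 0%N); last by left.
by right => ga; apply: fga; rewrite fa ga.
Qed.

Definition opow_zeroed (f : fsupp_fun) (c : A) : fsupp_fun.
Proof.
exists (fun a => if `[< olt a c >] then sval f a else 0%N).
by apply: sub_finite_set (svalP f) => a /=; case: ifP.
Defined.

Lemma opow_lt_wf : well_founded opow_lt.
Proof.
have acc0 f : (forall a, sval f a = 0%N) -> Acc opow_lt f.
  by move=> f0; constructor => g [a]; rewrite f0.
pose below c (f : fsupp_fun) := forall a, olt c a -> sval f a = 0%N.
have top f : (forall a, sval f a = 0%N) \/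
    exists c, sval f c <> 0%N /\ below c f.
  have [f0|/existsNP[a fa]] := pselect (forall a, sval f a = 0%N); first by left.
  have [||c fc cmax] := @opow_has_max [set a | sval f a <> 0%N].
  - exact: (svalP f).
  - by exists a.
  - by right; exists c; split=> // b /cmax /contrapT.
have acc c f : below c f -> Acc opow_lt f.
  elim: (olt_wf c) f => {}c _ IHc.
  have accz g : Acc opow_lt (opow_zeroed g c).
    have [/acc0//|[d [zd dz]]] := top (opow_zeroed g c).
    apply: (IHc d) => //; apply: contrapT => ndc; apply: zd.
    by rewrite /=; case: asboolP.
  move=> f fc; have [n fcn] : exists n, (sval f c < n)%N by exists (sval f c).+1.
  elim: n f fcn fc => [//|n IHn] f fcn fc.
  have zf : Acc opow_lt (opow_zeroed f c) by exact: accz.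
  move ez : (opow_zeroed f c) zf => z zf.
  elim: zf f ez fcn fc => {}z _ IHz f ez fcn fc.
  constructor => g [a ga eqg].
  have ac : ~ olt c a by move=> ca; rewrite fc in ga.
  have gc : below c g.
    move=> b cb; rewrite eqg ?fc//; case: (olt_total a c) => [|->//|//].
    by move=> ac'; exact: olt_trans cb.
  case: (olt_total a c) => [ltac|eqac|//].
    have gfc : sval g c = sval f c by exact: eqg.
    apply: (IHz (opow_zeroed g c)) => //; last by rewrite gfc.
    exists a; first by rewrite -ez /=; case: asboolP.
    by move=> b ab; rewrite -ez /=; case: asboolP => // _; exact: eqg.
  by subst a; apply: IHn => //; apply: leq_trans ga _.
by move=> f; have [/acc0//|[c [_ /acc]]] := top f.
Qed.

Definition opow := OrdNum opow_lt_wf opow_lt_trans opow_lt_total.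
End OmegaPower.

Definition wellordered (R : realType) (S : set R) : Prop :=
  forall D, D `<=` S -> D !=set0 -> exists2 m, D m & forall x, D x -> m <= x.

Section Wellordered.
Variable R : realType.
Implicit Types (S T : set R) (u : nat -> R).

Lemma sub_wellordered S T : S `<=` T -> wellordered T -> wellordered S.
Proof. by move=> sST woT D sDS; apply: woT => x /sDS /sST. Qed.

Lemma wellordered_set1 (x : R) : wellordered [set x].
Proof.
by move=> D sD [y Dy]; exists y => // z /sD ->; rewrite (sD _ Dy) lexx.
Qed.

Lemma wellordered_setU S T :
  wellordered S -> wellordered T -> wellordered (S `|` T).
Proof.
move=> woS woT D sD [d Dd].
have woI U : wellordered U -> D `&` U !=set0 ->
    exists2 m, (D `&` U) m & forall x, (D `&` U) x -> m <= x.
  by move=> woU; apply: woU => x [].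
have [/(woI _ woS)[m [Dm Sm] mS]|S0] := pselect (D `&` S !=set0); last first.
  have [|m [Dm Tm] mT] := woI _ woT; last first.
  - exists m => // x Dx; apply: mT; split=> //.
    by case: (sD _ Dx) => // Sx; case: S0; exists x.
  - by exists d; split=> //; case: (sD _ Dd) => // Sd; case: S0; exists d.
have [/(woI _ woT)[p [Dp Tp] pT]|T0] := pselect (D `&` T !=set0); last first.
  exists m => // x Dx; apply: mS; split=> //.
  by case: (sD _ Dx) => // Tx; case: T0; exists x.
have [mp|/ltW pm] := leP m p.
  exists m => // x Dx; case: (sD _ Dx) => [Sx|Tx]; first exact: mS.
  exact: le_trans mp (pT _ _).
exists p => // x Dx; case: (sD _ Dx) => [Sx|Tx]; last exact: pT.
exact: le_trans pm (mS _ _).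
Qed.

Lemma wellordered_no_decr S u : wellordered S -> (forall n, S (u n)) ->
  ~ (forall n, u n.+1 < u n).
Proof.
move=> woS Su decr; have [||m [n _ <-] /(_ (u n.+1))] := woS (range u).
- by move=> _ [n _ <-].
- by exists (u 0%N), 0%N.
- by rewrite leNgt decr => /(_ (ex_intro2 _ _ n.+1 I erefl)).
Qed.

Lemma wellordered_nondecr_subseq S u : wellordered S -> (forall n, S (u n)) ->
  exists phi : nat -> nat, (forall n, (phi n < phi n.+1)%N) /\
    (forall n, u (phi n) <= u (phi n.+1)).
Proof.
move=> woS Su.
have /choice[m mP] N : exists i,
    (N <= i)%N /\ forall j, (N <= j)%N -> u i <= u j.
  have [||_ [i Ni <-] imin] := woS (u @` [set i | (N <= i)%N]).
  - by move=> _ [i _ <-].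
  - by exists (u N), N => /=.
  - by exists i; split=> // j Nj; apply: imin; exists j.
pose phi := fix phi n := if n is k.+1 then m (phi k).+1 else m 0%N.
have lt n : (phi n < phi n.+1)%N by case: (mP (phi n).+1).
exists phi; split=> // n.
case: n => [|n]; first by apply: (mP 0%N).2.
by apply: (mP (phi n).+1).2 => //; apply: ltn_trans (lt n.+1).
Qed.

Lemma wellordered_no_decrP S :
  (forall u, (forall n, S (u n)) -> ~ (forall n, u n.+1 < u n)) ->
  wellordered S.
Proof.
move=> nodec D sDS [d0 Dd0]; apply: contrapT => nomin.
have /choice[f fP] (x : R) : exists y, D x -> D y /\ y < x.
  have [Dx|nDx] := pselect (D x); last by exists x.
  apply: contrapT => /forallNP noy; apply: nomin; exists x => // y Dy.
  rewrite leNgt; apply/negP => yx; apply: (noy y) => _.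
  by split.
have Du n : D (iter n f d0) by elim: n => //= n /fP[].
apply: (nodec (fun n => iter n f d0)) => n; first exact: sDS.
by have [] := fP _ (Du n).
Qed.

Definition addset S T : set R := [set x + y | x in S & y in T].

Lemma wellordered_addset S T :
  wellordered S -> wellordered T -> wellordered (addset S T).
Proof.
move=> woS woT; apply: wellordered_no_decrP => w Sw decr.
have /choice[p pP] n : exists p : R * R,
    [/\ S p.1, T p.2 & w n = p.1 + p.2].
  by have [x Sx [y Ty <-]] := Sw n; exists (x, y).
have [|phi [phi_lt phi_le]] :=
  @wellordered_nondecr_subseq S (fun n => (p n).1) woS.
  by move=> n; case: (pP n).
apply: (@wellordered_no_decr T (fun n => (p (phi n)).2)) => // n.
  by case: (pP (phi n)).
have /= wlt i j : (i < j)%N -> w j < w i.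
  elim: j => // j IH; rewrite ltnS leq_eqVlt => /orP[/eqP->//|/IH].
  exact: lt_trans.
have := wlt _ _ (phi_lt n).
have [_ _ ->] := pP (phi n); have [_ _ ->] := pP (phi n.+1).
by move=> lt; rewrite -(ltrD2l (p (phi n)).1); apply: le_lt_trans lt; rewrite lerD2r.
Qed.

Lemma finite_antidiag S T (g : R) : wellordered S -> wellordered T ->
  finite_set [set x | S x /\ T (g - x)].
Proof.
move=> woS woT; apply: contrapT => /infiniteP/card_leP[h].
pose f n : R := \val (h (SigSub (mem_set I : n \in [set: nat]))).
have fP n : S (f n) /\ T (g - f n) by exact: (set_mem (valP (h _))).
have finj : injective f.
  move=> m n /val_inj hmn; have := @inj _ _ _ h _ _ _ _ hmn.
  by case/(_ (mem_set I) (mem_set I)).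
have [|phi [phi_lt phi_le]] := @wellordered_nondecr_subseq S f woS.
  by move=> n; case: (fP n).
apply: (@wellordered_no_decr T (fun n => g - f (phi n))) => // n.
  by case: (fP (phi n)).
rewrite ltrD2l ltrN2 lt_neqAle phi_le andbT.
by apply/eqP => /finj e; have := phi_lt n; rewrite -e ltnn.
Qed.

End Wellordered.

(** Generalized power series [\sum_g (b g) t^g] are represented by their
    coefficient functions. *)
Section GeneralizedPowerSeries.
Variables (R : realType) (K : fieldType).

Definition fsupport (b : R -> K) : set R := [set g | b g != 0].

Definition is_gps : {pred (R -> K)} := fun b =>
  `[< wellordered (fsupport b) /\ forall g, fsupport b g -> g <= 0 >].

Record gps := Gps { coef :> R -> K ; coefP : is_gps coef }.

HB.instance Definition _ := [isSub for coef].
HB.instance Definition _ := [Choice of gps by <:].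

Lemma is_gps_zmod : zmod_closed is_gps.
Proof.
split.
  apply/asboolP; split=> [D sD [x /sD]|x]; by rewrite /fsupport /= eqxx.
move=> b c /asboolP[wob b0] /asboolP[woc c0]; apply/asboolP.
have sub : fsupport (b - c) `<=` fsupport b `|` fsupport c.
  move=> x; rewrite /fsupport /= => abc; apply: contrapT => /not_orP[].
  move=> /negP/negPn/eqP bx /negP/negPn/eqP cx; move: abc.
  by rewrite addrfctE opprfctE /= bx cx subr0 eqxx.
split; first exact: sub_wellordered sub (wellordered_setU wob woc).
by move=> x /sub[/b0|/c0].
Qed.

HB.instance Definition _ := GRing.isZmodClosed.Build (R -> K) is_gps is_gps_zmod.
HB.instance Definition _ := [SubChoice_isSubZmodule of gps by <:].

Lemma gpsP (b c : gps) : (forall g, b g = c g) -> b = c.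
Proof. by move=> bc; apply: val_inj; apply: funext. Qed.

Lemma coefD (b c : gps) g : (b + c) g = b g + c g.
Proof. by []. Qed.

Lemma scale_is_gps a (b : gps) : is_gps (fun g => a * b g).
Proof.
have /asboolP[wob b0] := coefP b; apply/asboolP.
have sub : fsupport (fun g => a * b g) `<=` fsupport b.
  by move=> x; rewrite /fsupport /= mulf_eq0 negb_or => /andP[].
by split=> [|g /sub /b0//]; exact: sub_wellordered sub wob.
Qed.

Definition gps_scale a (b : gps) : gps := Gps (scale_is_gps a b).

Lemma gps_scaleA a a' b : gps_scale a (gps_scale a' b) = gps_scale (a * a') b.
Proof. by apply: gpsP => g; rewrite /= mulrA. Qed.

Lemma gps_scale1 : left_id 1 gps_scale.
Proof. by move=> b; apply: gpsP => g; rewrite /= mul1r. Qed.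

Lemma gps_scaleDr : right_distributive gps_scale +%R.
Proof. by move=> a b c; apply: gpsP => g; rewrite /= mulrDr. Qed.

Lemma gps_scaleDl b : {morph gps_scale^~ b : a a' / a + a'}.
Proof. by move=> a a'; apply: gpsP => g; rewrite /= mulrDl. Qed.

HB.instance Definition _ :=
  GRing.Zmodule_isLmodule.Build K gps gps_scaleA gps_scale1 gps_scaleDr gps_scaleDl.

Lemma coefZ a (b : gps) g : (a *: b) g = a * b g.
Proof. by []. Qed.

Definition supp (b : gps) : set R := fsupport b.

Lemma supp_wellordered b : wellordered (supp b).
Proof. by have /asboolP[] := coefP b. Qed.

Lemma supp_le0 b g : supp b g -> g <= 0.
Proof. by have /asboolP[_] := coefP b; apply. Qed.

Definition gps_fenum (A : set R) : seq R := enum_fset (fset_set A).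

Lemma gps_fenum_uniq A : uniq (gps_fenum A).
Proof. exact: fset_uniq. Qed.

Hint Resolve gps_fenum_uniq : core.

Lemma gps_in_fenum A : finite_set A -> gps_fenum A =i A.
Proof. by move=> finA x; rewrite -(in_fset_set finA). Qed.

(** [\sum_(p \in A) F p] is [0] when infinitely many terms are nonzero; by
    [mul_fin] this never happens for two series. *)
Definition gps_mul_fun (b c : R -> K) : R -> K := fun g =>
  \sum_(p \in [set p : R * R | p.1 + p.2 = g]) (b p.1 * c p.2).

Lemma mul_fin (b c : gps) g :
  finite_set [set x | supp b x /\ supp c (g - x)].
Proof. by apply: finite_antidiag; exact: supp_wellordered. Qed.

Lemma mul_funE (b c : gps) g (r : seq R) : uniq r ->
  (forall x, supp b x -> supp c (g - x) -> x \in r) ->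
  gps_mul_fun b c g = \sum_(x <- r) b x * c (g - x).
Proof.
move=> ur rP; rewrite /gps_mul_fun.
rewrite (@reindex_fsbig _ _ _ _ _ (fun x => (x, g - x)) [set: R]); last first.
  split=> [x _ /=|x y _ _ [] //|[x y] /= <-]; first by rewrite addrC subrK.
  by exists x => //; rewrite addrAC subrr add0r.
rewrite fsbig_supp; apply: fsbig_fwiden => //.
  move=> x /= [_ /eqP]; rewrite mulf_eq0 negb_or => /andP[bx cx]; exact: rP.
by move=> x /= [_ /not_andP[//|/contrapT]].
Qed.

Lemma mul_funEfin (b c : gps) g : gps_mul_fun b c g =
  \sum_(x <- gps_fenum [set x | supp b x /\ supp c (g - x)]) b x * c (g - x).
Proof.
apply: mul_funE => // x bx cx; rewrite gps_in_fenum; first by rewrite inE.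
exact: mul_fin.
Qed.

Lemma mul_fun_supp (b c : gps) :
  fsupport (gps_mul_fun b c) `<=` addset (supp b) (supp c).
Proof.
move=> g; rewrite /fsupport /= mul_funEfin => s0; apply: contrapT => ng.
move: s0; rewrite big1_seq ?eqxx// => x /=.
rewrite gps_in_fenum; last exact: mul_fin.
rewrite inE => -[bx cx]; case: ng; exists x => //; exists (g - x) => //.
by rewrite addrC subrK.
Qed.

Lemma mul_is_gps (b c : gps) : is_gps (gps_mul_fun b c).
Proof.
apply/asboolP; split.
  apply: sub_wellordered (@mul_fun_supp b c) _.
  by apply: wellordered_addset; exact: supp_wellordered.
by move=> g /mul_fun_supp[x /supp_le0 x0 [y /supp_le0 y0 <-]]; rewrite -(addr0 0) lerD.
Qed.

Definition gps_mul (b c : gps) : gps := Gps (mul_is_gps b c).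

Definition gps_one_fun : R -> K := fun g => if g == 0 then 1 else 0.

Lemma one_is_gps : is_gps gps_one_fun.
Proof.
have sub : fsupport gps_one_fun `<=` [set 0].
  by move=> g; rewrite /fsupport /gps_one_fun /=; case: (g =P 0) => // _; rewrite eqxx.
apply/asboolP; split; last by move=> g /sub ->.
exact: sub_wellordered sub (@wellordered_set1 _ _).
Qed.

Definition gps_one : gps := Gps one_is_gps.

Lemma gps_mulC : commutative gps_mul.
Proof.
move=> b c; apply: gpsP => g; rewrite /= /gps_mul_fun.
rewrite (@reindex_fsbig _ _ _ _ _ (fun p => (p.2, p.1))
  [set p : R * R | p.1 + p.2 = g]); last first.
  split=> [[x y] /= <-|[x y] [x' y'] _ _ /= [-> ->]//|[x y] /= <-].
    by rewrite addrC.
  by exists (y, x) => //=; rewrite addrC.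
by apply: eq_fsbigr => -[x y] _ /=; rewrite mulrC.
Qed.

Lemma gps_mulCA a b c : gps_mul a (gps_mul b c) = gps_mul b (gps_mul a c).
Proof.
pose F (u v w : gps) g := [set x | supp u x /\ addset (supp v) (supp w) (g - x)].
have finF u v w g : finite_set (F u v w g).
  apply: finite_antidiag; first exact: supp_wellordered.
  by apply: wellordered_addset; exact: supp_wellordered.
apply: gpsP => g /=; set X := gps_fenum (F a b c g); set Y := gps_fenum (F b a c g).
have step (u v w : gps) : gps_mul_fun u (gps_mul v w) g =
    \sum_(x <- gps_fenum (F u v w g)) \sum_(y <- gps_fenum (F v u w g))
      u x * (v y * w (g - x - y)).
  rewrite (@mul_funE _ _ _ (gps_fenum (F u v w g))) //; last first.
    move=> x ux /mul_fun_supp vw; rewrite gps_in_fenum ?inE//; exact: finF.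
  apply: eq_big_seq => x; rewrite gps_in_fenum; last exact: finF.
  rewrite inE => -[ux _]; rewrite -mulr_sumr; congr (_ * _).
  apply: mul_funE => // y vy wy; rewrite gps_in_fenum; last exact: finF.
  rewrite inE; split=> //; exists x => //; exists (g - x - y) => //.
  by rewrite (addrAC g) [x + _]addrC subrK.
rewrite !step exchange_big /=; apply: eq_bigr => y _; apply: eq_bigr => x _.
by rewrite mulrCA (addrAC g).
Qed.

Lemma gps_mulA : associative gps_mul.
Proof. by move=> a b c; rewrite [gps_mul b c]gps_mulC gps_mulCA gps_mulC. Qed.

Lemma gps_mul1 : left_id gps_one gps_mul.
Proof.
move=> b; apply: gpsP => g; rewrite [LHS](@mul_funE gps_one b g [:: 0])//.
  by rewrite big_seq1 /= /gps_one_fun eqxx mul1r subr0.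
by move=> x; rewrite /supp /fsupport /= /gps_one_fun inE; case: (x =P 0) => //; rewrite eqxx.
Qed.

Lemma gps_scaleAl a b c : a *: gps_mul b c = gps_mul (a *: b) c.
Proof.
apply: gpsP => g; rewrite coefZ /= mul_funEfin mulr_sumr.
rewrite (@mul_funE (a *: b) c g
  (gps_fenum [set x | supp b x /\ supp c (g - x)]))//.
  by apply: eq_bigr => x _; rewrite coefZ mulrA.
move=> x; rewrite /supp /fsupport /= mulf_eq0 negb_or => /andP[_ bx] cx.
by rewrite gps_in_fenum ?inE//; exact: mul_fin.
Qed.

Lemma gps_mulDl : left_distributive gps_mul +%R.
Proof.
move=> a b c; apply: gpsP => g; rewrite coefD /=.
pose X := gps_fenum ([set x | supp a x /\ supp c (g - x)] `|`
  [set x | supp b x /\ supp c (g - x)]).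
have XE x : (x \in X) = (x \in [set x | supp a x /\ supp c (g - x)] `|`
  [set x | supp b x /\ supp c (g - x)]).
  by rewrite gps_in_fenum// finite_setU; split; exact: mul_fin.
have uX : uniq X by exact: fset_uniq.
rewrite (@mul_funE (a + b) c g X)// => [|x abx cx].
  rewrite (@mul_funE a c g X)// => [|x ax cx]; last by rewrite XE inE; left.
  rewrite (@mul_funE b c g X)// => [|x bx cx]; last by rewrite XE inE; right.
  by rewrite -big_split; apply: eq_bigr => x _; rewrite mulrDl.
rewrite XE inE; apply: contrapT => /not_orP[].
move=> /not_andP[/negP/negPn/eqP ax|//] /not_andP[/negP/negPn/eqP bx|//].
by case/negP: abx; rewrite (_ : (a + b) x = a x + b x)// ax bx addr0.
Qed.

Lemma gps_one_neq0 : gps_one != 0.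
Proof.
apply/eqP => /(congr1 (fun b : gps => b 0)); rewrite /= /gps_one_fun eqxx => /eqP.
by rewrite oner_eq0.
Qed.

HB.instance Definition _ :=
  GRing.Zmodule_isComNzRing.Build gps gps_mulA gps_mulC gps_mul1 gps_mulDl gps_one_neq0.
HB.instance Definition _ := GRing.Lmodule_isLalgebra.Build K gps gps_scaleAl.
HB.instance Definition _ := GRing.Lalgebra_isComAlgebra.Build K gps.

Lemma coefM (b c : gps) g :
  (b * c) g = \sum_(p \in [set p : R * R | p.1 + p.2 = g]) (b p.1 * c p.2).
Proof. by []. Qed.

Definition gunit : pred gps := fun b => `[< exists c, c * b = 1 >].

Definition ginv (b : gps) : gps :=
  if pselect (exists c, c * b = 1) is left ex then projT1 (cid ex) else b.

Lemma gunit_mulVx : {in gunit, left_inverse 1 ginv *%R}.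
Proof.
move=> b /asboolP ex; rewrite /ginv; case: pselect => // ex'.
exact: projT2 (cid ex').
Qed.

Lemma gunit_unitPl (b c : gps) : c * b = 1 -> gunit b.
Proof. by move=> cb; apply/asboolP; exists c. Qed.

Lemma gunit_inv_out : {in [predC gunit], ginv =1 id}.
Proof. by move=> b /asboolPn nex; rewrite /ginv; case: pselect. Qed.

HB.instance Definition _ :=
  GRing.ComNzRing_hasMulInverse.Build gps gunit_mulVx gunit_unitPl gunit_inv_out.

(** The order type of the support. *)
Section SupportOrdinal.
Variable b : gps.

Definition supp_lt (x y : {g : R | supp b g}) : Prop := sval x < sval y.

Lemma supp_lt_wf : well_founded supp_lt.
Proof.
move=> x; apply: contrapT => nax.
pose D := [set g | exists2 y : {g : R | supp b g}, ~ Acc supp_lt y & sval y = g].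
have [||_ [y nay <-] ymin] := @supp_wellordered b D.
- by move=> _ [y _ <-]; exact: (svalP y).
- by exists (sval x), x.
- apply: nay; constructor => z zy; apply: contrapT => naz.
  by move: zy; rewrite /supp_lt ltNge ymin//; exists z.
Qed.

Lemma supp_lt_trans (x y z : {g : R | supp b g}) : supp_lt x y -> supp_lt y z -> supp_lt x z.
Proof. exact: lt_trans. Qed.

Lemma supp_lt_total (x y : {g : R | supp b g}) : [\/ supp_lt x y, x = y | supp_lt y x].
Proof.
rewrite /supp_lt; case: (ltgtP (sval x) (sval y)) => xy;
  [by constructor 1|by constructor 3|constructor 2].
by case: x y xy => [x px] [y py] /= xy; subst y; congr exist; exact: Prop_irrelevance.
Qed.

Definition supp_ordinal := OrdNum supp_lt_wf supp_lt_trans supp_lt_total.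
End SupportOrdinal.

Definition reducible (b : gps) : Prop :=
  exists c d : gps,
    [/\ c \isn't a GRing.unit, d \isn't a GRing.unit & b = c * d].

Definition Pset (A : ordnum) : set gps :=
  [set b | oiso (supp_ordinal b) (opow A) /\ sup (supp b) = 0].

Definition Rset (A : ordnum) : set gps := [set b | Pset A b /\ reducible b].

End GeneralizedPowerSeries.

Arguments Pset R K A : clear implicits.
Arguments Rset R K A : clear implicits.

Section LinearAlgebra.
Variables (K : fieldType) (V : lmodType K).

Definition linear_span (S : set V) : set V :=
  [set v | exists n (a : 'I_n -> K) (u : 'I_n -> V),
    (forall i, S (u i)) /\ v = \sum_i a i *: u i].

(** For subspaces [W] and [U] with [W] included in [U]: no finite family of
    classes spans the quotient [U / W]. *)
Definition infinite_codim (W U : set V) : Prop :=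
  ~ exists n (u : 'I_n -> V), (forall i, U (u i)) /\
      forall v, U v -> exists a : 'I_n -> K, W (v - \sum_i a i *: u i).

End LinearAlgebra.

(* Main.v *)
(** Write [deg b] for the exponent of the order type of the support of [b] near
    [0], an ordinal that is also the Cantor-Bendixson rank of [0]; ordinals add
    through their natural sum. The germ of a product at [x] is the finite sum of
    the products of germs at points [y] and [x - y] (Berarducci), so passing to
    germs is a derivation up to terms of lower degree, and in characteristic [0]
    this makes the degree additive on products. If [b] has type [omega ^ alpha]
    and supremum [0], then in a factorization [b = c * d] into non-units the
    points of maximal degree of [c] and [d] must be [0], and
    [deg c + deg d = alpha] with both degrees nonzero.

    For [alpha = omega^beta1 + omega^beta2] one factor has degree
    [omega^beta1] and the other [omega^beta2], so that the germs of a
    combination of such products at the points [x < 0] lie, modulo the ring [I]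
    of germs of degree less than [omega^beta1], in a finitely generated
    [I]-module. Series whose support is closed and has no repeated differences
    do not have this property: a relation over [I] between their germs would
    yield, after taking further germs, a relation over [K], whereas the germs at
    distinct points have disjoint supports. For [alpha + 1] the germs of a
    combination of products lie, up to a finite-dimensional space, in the span
    of products for [alpha], and the same series are excluded by induction on
    [k]. Infinitely many independent ones arise from one support by taking the
    coefficients [n ^ m], where [n] enumerates the support. *)

From HB Require Import structures.
From mathcomp Require Import all_boot all_order all_algebra.
From mathcomp Require Import finmap.
From mathcomp Require Import all_classical all_reals.
From mathcomp Require Import zify ring lra.
Require Import Defs.

Set Implicit Arguments.
Unset Strict Implicit.
Unset Printing Implicit Defensive.

Import Order.TTheory GRing.Theory Num.Theory.

Local Open Scope classical_set_scope.
Local Open Scope ring_scope.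

(** * Natural sums of ordinals *)

Definition cnf (A : ordnum) := fsupp_fun A.
HB.instance Definition _ A := gen_eqMixin (cnf A).
HB.instance Definition _ A := gen_choiceMixin (cnf A).

(* Without the casts, [0] or [_ + _] on the left makes type inference look for an
   ordered abelian group. *)
Notation "x <o y" := (@Order.lt _ _ (x : cnf _) (y : cnf _)) (at level 70, only parsing).
Notation "x <=o y" := (@Order.le _ _ (x : cnf _) (y : cnf _)) (at level 70, only parsing).

Section NaturalSum.
Variable A : ordnum.
Implicit Types (x y z w : cnf A) (a b c e : A).

Lemma cnfP x y : (forall a, sval x a = sval y a) -> x = y.
Proof.
case: x y => [f ff] [g gf] /= /funext efg; subst g.
by congr exist; exact: Prop_irrelevance.
Qed.

Definition cnf0 : cnf A.
Proof. by exists (fun=> 0%N); apply: sub_finite_set (finite_set0 A) => a /=. Defined.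

(** The Hessenberg natural sum: coefficients of Cantor normal forms are added termwise. *)
Definition cnf_add x y : cnf A.
Proof.
exists (fun a => (sval x a + sval y a)%N).
have : finite_set ([set a | sval x a <> 0%N] `|` [set a | sval y a <> 0%N]).
  by rewrite finite_setU; split; [exact: (svalP x)|exact: (svalP y)].
apply: sub_finite_set => a /=; have [->|] := pselect (sval x a = 0%N).
  by rewrite add0n; right.
by left.
Defined.

Lemma cnf_addA : associative cnf_add.
Proof. by move=> x y z; apply: cnfP => a /=; rewrite addnA. Qed.
Lemma cnf_addC : commutative cnf_add.
Proof. by move=> x y; apply: cnfP => a /=; rewrite addnC. Qed.
Lemma cnf_add0 : left_id cnf0 cnf_add.
Proof. by move=> x; apply: cnfP. Qed.

HB.instance Definition _ := GRing.isNmodule.Build (cnf A) cnf_addA cnf_addC cnf_add0.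

Definition cnf_lt x y := `[< opow_lt x y >].
Definition cnf_le x y := (x == y) || cnf_lt x y.

Lemma cnf_lt_irr : irreflexive cnf_lt.
Proof. by move=> x; apply/asboolP => -[a]; rewrite ltnn. Qed.
Lemma cnf_lt_trans : transitive cnf_lt.
Proof. by move=> y x z /asboolP xy /asboolP yz; apply/asboolP; exact: opow_lt_trans xy yz. Qed.
Lemma cnf_lt_total x y : x != y -> cnf_lt x y || cnf_lt y x.
Proof.
by move=> /eqP nxy; case: (opow_lt_total x y) => [|//|] xy; apply/orP; [left|right]; apply/asboolP.
Qed.

HB.instance Definition _ := @Order.LtOrder.Build ring_display (cnf A) cnf_le cnf_lt
  (fun x y => if cnf_lt x y then x else y) (fun x y => if cnf_lt x y then y else x)
  (fun _ _ => erefl) (fun _ _ => erefl) (fun _ _ => erefl)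
  cnf_lt_irr cnf_lt_trans cnf_lt_total.

Lemma cnf_ltP x y : (x <o y) <->
  exists2 a, (sval x a < sval y a)%N & forall b, olt a b -> sval x b = sval y b.
Proof. by split=> [/asboolP|?]; [|apply/asboolP]. Qed.

Lemma cnf_wf (P : cnf A -> Prop) :
  (forall x, (forall y, y <o x -> P y) -> P x) -> forall x, P x.
Proof.
move=> H x; elim: (@opow_lt_wf A x) => {}x _ IH; apply: H => y /asboolP; exact: IH.
Qed.

Lemma cnf_least (P : cnf A -> Prop) : (exists x, P x) ->
  exists2 x, P x & forall y, P y -> x <=o y.
Proof.
case=> x; elim/cnf_wf: x => x IH Px.
have [[y [Py yx]]|H] := pselect (exists y, P y /\ y < x); first exact: IH yx Py.
by exists x => // y Py; rewrite leNgt; apply/negP => yx; apply: H; exists y.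
Qed.

Lemma cnf0E a : sval (0 : cnf A) a = 0%N. Proof. by []. Qed.
Lemma cnfDE x y a : sval (x + y) a = (sval x a + sval y a)%N. Proof. by []. Qed.

Lemma cnfMnE x n a : sval (x *+ n) a = (sval x a * n)%N.
Proof. by elim: n => [|n IH]; rewrite ?muln0// mulrS cnfDE IH mulnS. Qed.

Lemma cnf_ge0 x : 0 <=o x.
Proof. by rewrite leNgt; apply/negP => /cnf_ltP[a]; rewrite cnf0E. Qed.

Lemma cnf_gt0 x : x <> 0 -> 0 <o x.
Proof. by move=> x0; rewrite lt_neqAle cnf_ge0 andbT; apply/eqP => e; apply: x0. Qed.

Lemma cnf_lt0 x : (x <o 0) = false.
Proof. by rewrite ltNge cnf_ge0. Qed.

Lemma cnf_ltD2r z x y : (x + z <o y + z) = (x <o y).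
Proof.
apply/idP/idP => /cnf_ltP[a]; last first.
  move=> lt eq; apply/cnf_ltP; exists a; first by rewrite !cnfDE ltn_add2r.
  by move=> b ab; rewrite !cnfDE eq.
rewrite !cnfDE ltn_add2r => lt eq; apply/cnf_ltP; exists a => // b /eq.
by rewrite !cnfDE => /addIn.
Qed.

Lemma cnf_ltD2l z x y : (z + x <o z + y) = (x <o y).
Proof. by rewrite ![z + _]addrC cnf_ltD2r. Qed.

Lemma cnf_leD2r z x y : (x + z <=o y + z) = (x <=o y).
Proof. by rewrite !leNgt cnf_ltD2r. Qed.

Lemma cnf_leD2l z x y : (z + x <=o z + y) = (x <=o y).
Proof. by rewrite !leNgt cnf_ltD2l. Qed.

Lemma cnf_addIr z x y : x + z = y + z -> x = y.
Proof.
move=> e; apply: cnfP => a; move/(congr1 (fun w => sval w a)): e.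
by rewrite !cnfDE => /addIn.
Qed.

Lemma cnf_leD x y x' y' : x <=o x' -> y <=o y' -> x + y <=o x' + y'.
Proof. by move=> xx yy; apply: (@le_trans _ (cnf A) (x' + y)); rewrite ?cnf_leD2l ?cnf_leD2r. Qed.

Lemma cnf_ltleD x y x' y' : x <o x' -> y <=o y' -> x + y <o x' + y'.
Proof. by move=> xx yy; apply: (@lt_le_trans _ (cnf A) (x' + y)); rewrite ?cnf_leD2l ?cnf_ltD2r. Qed.

Lemma cnf_ltD x y x' y' : x <o x' -> y <o y' -> x + y <o x' + y'.
Proof. by move=> xx /ltW; exact: cnf_ltleD. Qed.

Lemma cnf_leDl x y : x <=o x + y.
Proof. by rewrite -{1}[x]addr0 cnf_leD2l cnf_ge0. Qed.

(** [omega ^ e] *)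
Definition om e : cnf A.
Proof.
exists (fun a => if `[< a = e >] then 1%N else 0%N).
apply: sub_finite_set (finite_set1 e) => a /=.
by case: asboolP.
Defined.

Lemma omE e a : sval (om e) a = `[< a = e >] :> nat.
Proof. by rewrite /=; case: asboolP. Qed.

Lemma om_neq0 e : om e <> 0.
Proof.
by move/(congr1 (fun w => sval w e)); rewrite omE cnf0E; case: asboolP.
Qed.

Lemma om_gt0 e : 0 <o om e.
Proof. exact: cnf_gt0 (@om_neq0 e). Qed.

(** The multiples of [omega ^ e]. Below such an ordinal, errors smaller than [omega ^ e] can be
    absorbed. *)
Definition hi e x := forall a, olt a e -> sval x a = 0%N.

Lemma hiD e x y : hi e x -> hi e y -> hi e (x + y).
Proof. by move=> hx hy a ae; rewrite cnfDE hx// hy. Qed.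

Lemma hiMn e x n : hi e x -> hi e (x *+ n).
Proof. by move=> hx; elim: n => [//|n IH]; rewrite mulrS; exact: hiD. Qed.

Lemma hi_om e : hi e (om e).
Proof.
move=> a ae; rewrite omE; case: asboolP => // e'; subst a; by case: (olt_irr ae).
Qed.

Lemma hi_le e e' x : ~ olt e e' -> hi e x -> hi e' x.
Proof.
move=> ee' hx a ae'; apply: hx; case: (olt_total e' e) => [e'e|e'e|//].
  exact: olt_trans ae' e'e.
by subst e'.
Qed.

Lemma lt_omP e x : x < om e <-> forall a, ~ olt a e -> sval x a = 0%N.
Proof.
split=> [/cnf_ltP[a]|H].
  rewrite omE; case: asboolP => // ->; rewrite ltnS leqn0 => /eqP x0 eq b nbe.
  case: (olt_total b e) => [//|->//|eb]; rewrite eq// omE.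
  by case: asboolP => // be; subst b; case: (olt_irr eb).
apply/cnf_ltP; exists e; first by rewrite H ?omE; [case: asboolP|exact: olt_irr].
move=> b eb; rewrite H ?omE; last by move=> be; exact: olt_irr (olt_trans eb be).
by case: asboolP => // be; subst b; case: (olt_irr eb).
Qed.

Lemma om_le e e' : ~ olt e' e -> om e <=o om e'.
Proof.
move=> nlt; case: (olt_total e e') => [lt|->//|//]; apply/ltW/lt_omP => a nae'.
by rewrite omE; case: asboolP => // ae; subst a.
Qed.

Lemma om_lt e e' : olt e e' -> om e <o om e'.
Proof.
move=> lt; apply/lt_omP => a nae'.
by rewrite omE; case: asboolP => // ae; subst a.
Qed.

Lemma om_ltP e e' : om e <o om e' -> olt e e'.
Proof.
case: (olt_total e e') => [//|->|/om_lt/lt_trans h /h]; by rewrite ltxx.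
Qed.

(** The largest exponent at which [z'] and [z] differ is at least [e], and [d] has no terms there or
    above. *)
Lemma hi_absorb e z z' d : hi e z -> z' <o z -> d <o om e -> z' + d <o z.
Proof.
move=> hz /cnf_ltP[a za eq] /lt_omP dlow.
have nae : ~ olt a e by move=> ae; rewrite hz in za.
apply/cnf_ltP; exists a; first by rewrite cnfDE dlow ?addn0.
move=> b ab; rewrite cnfDE dlow ?addn0 ?eq//.
by move=> be; apply: nae; exact: olt_trans be.
Qed.

Lemma om_add e d d' : d <o om e -> d' <o om e -> d + d' <o om e.
Proof. exact: hi_absorb (@hi_om e). Qed.

Definition cnf_low e x : cnf A := opow_zeroed x e.
Lemma cnf_lowE e x a : sval (cnf_low e x) a = if `[< olt a e >] then sval x a else 0%N.
Proof. by []. Qed.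

Lemma cnf_low_lt e x : cnf_low e x <o om e.
Proof. by apply/lt_omP => a nae; rewrite cnf_lowE; case: asboolP. Qed.

Definition cnf_high e x : cnf A.
Proof.
exists (fun a => if `[< olt a e >] then 0%N else sval x a).
by apply: sub_finite_set (svalP x) => a /=; case: ifP.
Defined.

Lemma cnf_high_low e x : x = cnf_high e x + cnf_low e x.
Proof. by apply: cnfP => a; rewrite cnfDE /=; case: asboolP => _; rewrite ?addn0. Qed.

Lemma hi_high e x : hi e (cnf_high e x).
Proof. by move=> a ae /=; case: asboolP. Qed.

Lemma hi_lt_add e x y : hi e x -> hi e y -> x <o y -> x + om e <=o y.
Proof.
move=> hx hy /cnf_ltP[b xyb eqb].
have omn c : c <> e -> sval (om e) c = 0%N by move=> ce; rewrite omE; case: asboolP.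
have ome : sval (om e) e = 1%N by rewrite omE; case: asboolP.
case: (olt_total b e) => [be|be|eb]; first by rewrite hy in xyb.
  subst b; move: xyb; rewrite leq_eqVlt => /orP[/eqP xye|xye]; last first.
    apply/ltW/cnf_ltP; exists e; first by rewrite cnfDE ome addn1.
    by move=> b eb; rewrite cnfDE omn ?addn0 ?eqb// => E; subst b; exact: olt_irr eb.
  suff -> : y = x + om e by [].
  apply: cnfP => c; rewrite cnfDE; case: (olt_total c e) => [ce|->|ec].
  - by rewrite hx// hy// omn// => E; subst c; exact: olt_irr ce.
  - by rewrite ome addn1.
  - by rewrite omn ?addn0 ?eqb// => E; subst c; exact: olt_irr ec.
apply/ltW/cnf_ltP; exists b.
  by rewrite cnfDE omn ?addn0// => E; subst b; exact: olt_irr eb.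
move=> c bc; rewrite cnfDE omn ?addn0 ?eqb// => E; subst c.
exact: olt_irr (olt_trans eb bc).
Qed.

(** Multiples of [omega ^ e] are at least [omega ^ e] apart, so the part of [w] with exponents at
    least [e] can only be [z]; the rest of [w] is [d']. *)
Lemma le_hi_add e z w d : hi e z -> d <=o om e -> z <=o w -> w <o z + d ->
  exists2 d', d' <o d & w = z + d'.
Proof.
move=> hz de zw wzd; suff wd : w = z + cnf_low e w.
  by exists (cnf_low e w) => //; rewrite wd cnf_ltD2l in wzd.
rewrite {1}(cnf_high_low e w); congr (_ + _); apply/eqP/negPn/negP => /eqP/eqP.
rewrite neq_lt => /orP[lt|lt].
  have := hi_absorb hz lt (cnf_low_lt e w).
  by rewrite -cnf_high_low ltNge zw.
have := hi_lt_add hz (@hi_high e w) lt; apply/negP; rewrite -ltNge.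
apply: le_lt_trans (lt_le_trans wzd _); last by rewrite cnf_leD2l.
by rewrite {2}(cnf_high_low e w) cnf_leDl.
Qed.

Lemma lt_add_om e z w : hi e z -> w <o z + om e ->
  exists2 d, d <o om e & w <=o z + d.
Proof.
move=> hz wz; have [zw|/ltW wlt] := leP (z : cnf A) w; last first.
  by exists 0; rewrite ?om_gt0// addr0.
by have [d de ->] := le_hi_add hz (lexx _) zw wz; exists d.
Qed.

(** One copy of the term of least exponent is split off; the inductions on degrees proceed by
    removing such terms. *)
Lemma cnf_chop x : x <> 0 -> exists e x0, x = x0 + om e /\ hi e x0.
Proof.
move=> x0; have [a xa] : exists a, sval x a <> 0%N.
  by apply: contrapT => /forallNP H; apply: x0; apply: cnfP => a; have /contrapT -> := H a.
have [e [xe emin]] : exists e, sval x e <> 0%N /\ forall b, olt b e -> sval x b = 0%N.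
  elim: (olt_wf a) xa => {}a _ IH xa.
  have [[b [ba xb]]|H] := pselect (exists b, olt b a /\ sval x b <> 0%N); first exact: IH ba xb.
  by exists a; split=> // b ba; apply: contrapT => xb; apply: H; exists b.
have fin : finite_set [set a | (sval x a - `[< a = e >])%N <> 0%N].
  apply: sub_finite_set (svalP x) => b /= H xb; apply: H; by rewrite xb.
pose y : cnf A := exist (fun f : A -> nat => finite_set [set a | f a <> 0%N]) _ fin.
exists e, y; split; last by move=> b /emin /= ->.
apply: cnfP => b; rewrite cnfDE omE /= subnK//.
by case: asboolP => // ->; case: (sval x e) xe.
Qed.

Lemma lt_om_bot e x : (forall a, ~ olt a e) -> x <o om e -> x = 0.
Proof. by move=> e0 /lt_omP xe; apply: cnfP => a; apply: xe. Qed.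

Lemma hi_bot e x : (forall a, ~ olt a e) -> hi e x.
Proof. by move=> e0 a /e0. Qed.

(** For the least [e], [om e] is the ordinal [1]. *)
Lemma lt_add_bot e x y : (forall a, ~ olt a e) -> x <o y + om e -> x <=o y.
Proof.
move=> e0 /(lt_add_om (hi_bot y e0))[d /(lt_om_bot e0) -> ]; by rewrite addr0.
Qed.

(** The summand [y] uses up at least one of the two terms of [om a1 + om a2], so [x] is at most the
    other one. This bounds the degrees of both factors of a product. *)
Lemma summand_le_om a1 a2 x y : ~ olt a1 a2 -> x + y = om a1 + om a2 -> y <> 0 ->
  x <=o om a1.
Proof.
move=> a21 xy /cnf_chop[a [y' [yE _]]]; rewrite yE addrA in xy.
have: sval (om a1 + om a2) a <> 0%N.
  by rewrite -xy cnfDE omE; case: asboolP => // _; rewrite addn1.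
rewrite cnfDE !omE; case: asboolP => [aa1 _|_].
  subst a; move: xy; rewrite [RHS]addrC => /cnf_addIr xy.
  by apply: le_trans (om_le a21); rewrite -xy cnf_leDl.
case: asboolP => // aa2 _; subst a; move: xy => /cnf_addIr xy.
by rewrite -xy cnf_leDl.
Qed.

End NaturalSum.

Ltac cnf_ring := let a := fresh "a" in apply: cnfP => a; rewrite ?(cnfDE, cnfMnE); lia.

(** * Germs of series *)

Definition left_near (R : realType) (P : R -> Prop) :=
  exists2 e : R, 0 < e & forall x, - e < x -> x < 0 -> P x.

Section LeftNear.
Variable R : realType.
Implicit Types P Q : R -> Prop.

Lemma left_nearT P : (forall x, x < 0 -> P x) -> left_near P.
Proof. by move=> H; exists 1 => // x _; exact: H. Qed.

Lemma left_nearW P Q : (forall x, x < 0 -> P x -> Q x) -> left_near P -> left_near Q.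
Proof. by move=> H [e e0 He]; exists e => // x ex x0; apply: H => //; exact: He. Qed.

Lemma left_nearI P Q : left_near P -> left_near Q -> left_near (fun x => P x /\ Q x).
Proof.
move=> [e e0 He] [d d0 Hd]; exists (Num.min e d); first by rewrite lt_min e0.
move=> x; rewrite oppr_min gt_max => /andP[ex dx] x0.
by split; [exact: He|exact: Hd].
Qed.

Lemma left_near_fin (I : finType) (P : I -> R -> Prop) :
  (forall i, left_near (P i)) -> left_near (fun x => forall i, P i x).
Proof.
move=> H; suff [e e0 He] : left_near (fun x => forall i, i \in enum I -> P i x).
  by exists e => // x ex x0 i; apply: He => //; rewrite mem_enum.
elim: (enum I) => [|i s IH]; first exact: left_nearT.
apply: left_nearW (left_nearI (H i) IH) => x _ [Pi Ps] j.
by rewrite inE => /orP[/eqP->//|]; exact: Ps.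
Qed.

End LeftNear.

Section Germs.
Variables (R : realType) (K : fieldType).
Implicit Types (b c d : gps R K) (x y z : R).

Lemma coef_pos b x : 0 < x -> b x = 0.
Proof.
move=> x0; apply/eqP/negPn/negP => /(@supp_le0 _ _ b); by rewrite leNgt x0.
Qed.

Lemma gps_coefN b x : (- b) x = - b x.
Proof. by []. Qed.

Definition gm_fun b x : R -> K := fun y => if y <= 0 then b (x + y) else 0.

Lemma gm_is_gps b x : is_gps (gm_fun b x).
Proof.
apply/asboolP; split; last by move=> y; rewrite /fsupport /gm_fun /=; case: (y <= 0) => //; rewrite eqxx.
apply: wellordered_no_decrP => u Su decr.
apply: (@wellordered_no_decr _ _ (fun n => x + u n) (@supp_wellordered _ _ b)) => n.
  by move: (Su n); rewrite /supp /fsupport /gm_fun /=; case: ifP => //; rewrite eqxx.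
by rewrite ltrD2l.
Qed.

(** The germ of [b] at [x], translated to [0]; it still carries the whole of
    [b] below [x], and only its class modulo [eqz] is a germ proper. *)
Definition gm b x : gps R K := Gps (gm_is_gps b x).

Lemma gmE b x y : gm b x y = if y <= 0 then b (x + y) else 0.
Proof. by []. Qed.

Lemma gm0 b : gm b 0 = b.
Proof.
by apply: gpsP => y; rewrite gmE add0r; case: (leP y 0) => // /coef_pos ->.
Qed.

Lemma gm_gm b x y : y <= 0 -> gm (gm b x) y = gm b (x + y).
Proof.
move=> y0; apply: gpsP => z; rewrite !gmE; case: (leP z 0) => // z0.
by rewrite addrA -{1}(addr0 0) lerD.
Qed.

Lemma gmD b c x : gm (b + c) x = gm b x + gm c x.
Proof. by apply: gpsP => y; rewrite coefD !gmE coefD; case: ifP; rewrite ?addr0. Qed.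

Lemma gmZ (a : K) b x : gm (a *: b) x = a *: gm b x.
Proof. by apply: gpsP => y; rewrite coefZ !gmE coefZ; case: ifP; rewrite ?mulr0. Qed.

Lemma gm_sum (I : Type) (s : seq I) (P : pred I) (F : I -> gps R K) x :
  gm (\sum_(i <- s | P i) F i) x = \sum_(i <- s | P i) gm (F i) x.
Proof.
apply: (big_morph (gm^~ x)) => [b c|]; first exact: gmD.
by apply: gpsP => y; rewrite gmE; case: ifP.
Qed.

Definition eqz b := exists2 e : R, 0 < e & forall x, - e < x -> b x = 0.

Lemma eqz0 : eqz 0. Proof. by exists 1. Qed.

Lemma eqzD b c : eqz b -> eqz c -> eqz (b + c).
Proof.
move=> [e e0 He] [d d0 Hd]; exists (Num.min e d); first by rewrite lt_min e0.
by move=> x; rewrite oppr_min gt_max => /andP[ex dx]; rewrite coefD He// Hd// addr0.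
Qed.

Lemma eqz_sum (I : Type) (s : seq I) (P : pred I) (F : I -> gps R K) :
  (forall i, P i -> eqz (F i)) -> eqz (\sum_(i <- s | P i) F i).
Proof. by move=> H; apply: big_ind => //; [exact: eqz0|exact: eqzD]. Qed.

(** Exponents of [c] are nonpositive, so the coefficient of [b * c] at [x] involves [b] only at
    points [y >= x]. *)
Lemma eqzM b c : eqz b -> eqz (b * c).
Proof.
move=> [e e0 He]; exists e => // x ex.
have /= -> := @mul_funE R K b c x [::] isT; first by rewrite big_nil.
move=> y by0 cxy; exfalso; move: by0; rewrite /supp /fsupport /= He ?eqxx//.
have := supp_le0 cxy; rewrite subr_le0; exact: lt_le_trans.
Qed.

Lemma eqzMr b c : eqz c -> eqz (b * c).
Proof. by rewrite mulrC; exact: eqzM. Qed.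

Lemma coefC_mul (a : K) b : (a *: 1) * b = a *: b.
Proof. by rewrite -scalerAl mul1r. Qed.

Lemma eqzZ (a : K) b : eqz b -> eqz (a *: b).
Proof. by rewrite -coefC_mul; exact: eqzMr. Qed.

Lemma eqzN b : eqz b -> eqz (- b).
Proof. by rewrite -scaleN1r; exact: eqzZ. Qed.

Lemma eqz_gm b : eqz b -> left_near (fun x => eqz (gm b x)).
Proof.
move=> [e e0 He]; exists e => // x ex x0; exists (x + e); first lra.
move=> y xy; rewrite gmE He; first by case: ifP.
lra.
Qed.

(** The closure of the support: a well-ordered set of reals accumulates only from the left. *)
Definition clo b : set R := [set x | ~ eqz (gm b x)].

Lemma cloP b x : clo b x <->
  x <= 0 /\ forall e : R, 0 < e -> exists y, [/\ x - e < y, y <= x & b y != 0].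
Proof.
split=> [nz|[x0 H] [e e0 He]]; last first.
  have [y [xy yx /eqP]] := H e e0; apply; have := He (y - x).
  have E : x + (y - x) = y by lra.
  rewrite gmE subr_le0 yx E; apply.
  lra.
have H : forall e : R, 0 < e -> exists y, [/\ x - e < y, y <= x & b y != 0].
  move=> e e0; apply: contrapT => /forallNP N; apply: nz; exists e => // y ey.
  rewrite gmE; case: (leP y 0) => // y0; apply/eqP/negPn/negP => bxy.
  apply: (N (x + y)); split=> //; lra.
split=> //; rewrite leNgt; apply/negP => x0; have [y [xy _ by0]] := H _ x0.
have := @supp_le0 _ _ b _ by0; lra.
Qed.

Lemma clo_supp b x : b x != 0 -> clo b x.
Proof.
move=> bx; apply/cloP; split; first exact: (@supp_le0 _ _ b).
by move=> e e0; exists x; split=> //; lra.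
Qed.

(** A decreasing sequence in the closure is interleaved with a decreasing sequence in the
    support. *)
Lemma clo_wellordered b : wellordered (clo b).
Proof.
apply: wellordered_no_decrP => u Cu decr.
have /choice[v vP] n : exists y, [/\ u n.+1 < y, y <= u n & b y != 0].
  have /cloP[_ /(_ (u n - u n.+1))] := Cu n.
  rewrite subr_gt0 => /(_ (decr n))[y [uy yu by0]]; exists y; split=> //; lra.
apply: (@wellordered_no_decr _ _ v (@supp_wellordered _ _ b)) => n.
  by have [] := vP n.
by have [_ le _] := vP n.+1; have [lt _ _] := vP n; exact: le_lt_trans le lt.
Qed.

Lemma nondecr_sup (u : nat -> R) (m : R) :
  (forall n, u n <= u n.+1) -> (forall n, u n <= m) ->
  [/\ sup (range u) <= m, forall n, u n <= sup (range u) &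
    forall e, 0 < e -> exists N, forall n, (N <= n)%N -> sup (range u) - e < u n].
Proof.
move=> mono ub; have hs : has_sup (range u).
  by split; [exists (u 0%N), 0%N|exists m => _ [n _ <-]].
have mon i j : (i <= j)%N -> u i <= u j.
  elim: j => [|j IH]; first by rewrite leqn0 => /eqP->.
  by rewrite leq_eqVlt => /orP[/eqP->//|/IH/le_trans]; apply.
split.
- by apply: ge_sup => [|_ [n _ <-]//]; case: hs.
- by move=> n; apply: ub_le_sup; [case: hs|exists n].
- move=> e e0; have [_ [N _ <-] lt] := sup_adherent e0 hs.
  by exists N => n /mon; exact: lt_le_trans.
Qed.

(** Compactness: exponents [p + q] close to [x] split along one of finitely many
    pairs of left limits of the two supports. *)
Lemma split_points b c x (F : set R) :
  (forall p, clo b p -> clo c (x - p) -> F p) ->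
  exists2 e : R, 0 < e & forall y p, - e < y -> y <= 0 -> b p != 0 ->
    c (x + y - p) != 0 -> exists2 z, F z & p <= z <= p - y.
Proof.
move=> HF; apply: contrapT => N.
have /choice[w wP] n : exists w : R * R,
    [/\ - n.+1%:R^-1 < w.1, w.1 <= 0, b w.2 != 0, c (x + w.1 - w.2) != 0 &
      ~ exists2 z, F z & w.2 <= z <= w.2 - w.1].
  apply: contrapT => /forallNP N'; apply: N; exists n.+1%:R^-1; first by rewrite invr_gt0 ltr0n.
  by move=> y p ey y0 bp cq; apply: contrapT => nz; apply: (N' (y, p)).
(* Pass to subsequences along which both the exponents of [b] and the complementary exponents of [c]
   are nondecreasing; their suprema [p] and [q] lie in the closures and satisfy [p + q = x]. *)
have [|f [f_lt f_le]] := @wellordered_nondecr_subseq R _ (fun n => (w n).2)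
    (@supp_wellordered _ _ b); first by move=> n; case: (wP n).
have [|g [g_lt g_le]] := @wellordered_nondecr_subseq R _
    (fun n => x + (w (f n)).1 - (w (f n)).2) (@supp_wellordered _ _ c).
  by move=> n; case: (wP (f n)).
have fmon i j : (i <= j)%N -> (w (f i)).2 <= (w (f j)).2.
  elim: j => [|j IH]; first by rewrite leqn0 => /eqP->.
  by rewrite leq_eqVlt => /orP[/eqP->//|/IH/le_trans]; apply.
pose P n := (w (f (g n))).2; pose Q n := x + (w (f (g n))).1 - P n.
have P0 n : P n <= 0 by have [_ _ /(@supp_le0 _ _ b)] := wP (f (g n)).
have Q0 n : Q n <= 0 by have [_ _ _ /(@supp_le0 _ _ c)] := wP (f (g n)).
have [||sP0 leP closeP] := @nondecr_sup P 0; [|exact: P0|].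
  by move=> n; apply: fmon; exact: ltnW.
have [||sQ0 leQ closeQ] := @nondecr_sup Q 0; [exact: g_le|exact: Q0|].
set p := sup _ in sP0 leP closeP; set q := sup _ in sQ0 leQ closeQ.
have idx n : (n <= f (g n))%N.
  have fi i : (i <= f i)%N by elim: i => // i IH; apply: leq_ltn_trans IH (f_lt i).
  have gi i : (i <= g i)%N by elim: i => // i IH; apply: leq_ltn_trans IH (g_lt i).
  exact: leq_trans (gi n) (fi _).
have small e : 0 < e -> exists N, forall n, (N <= n)%N -> - e < (w (f (g n))).1.
  move=> e0; have [N' HN] : exists N : nat, e^-1 < N%:R.
    by exists (Num.bound e^-1); apply: archi_boundP; rewrite invr_ge0 ltW.
  exists N' => n Nn; have [lt _ _ _ _] := wP (f (g n)).
  apply: le_lt_trans lt; rewrite lerN2 -[leRHS]invrK lef_pV2 ?posrE ?invr_gt0 ?ltr0n//.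
  by apply/ltW/(lt_le_trans HN); rewrite ler_nat; apply: leq_trans (leq_trans Nn (idx n)) _.
have pq : p + q = x.
  have [lt|gt|//] := ltgtP (p + q) x; exfalso.
    have [N1 H1] := small (x - (p + q)) ltac:(lra).
    have := H1 N1 (leqnn _); have := leP N1; have := leQ N1; rewrite /Q /P; lra.
  have e0 : 0 < (p + q - x) / 2 by lra.
  have [N1 H1] := closeP _ e0; have [N2 H2] := closeQ _ e0.
  have [_ w0 _ _ _] := wP (f (g (maxn N1 N2))).
  have := H1 _ (leq_maxl N1 N2); have := H2 _ (leq_maxr N1 N2); rewrite /Q /P; lra.
have qE : x - p = q by lra.
(* The limit [p] lies in the interval that was supposed to avoid [F]: the lower bound is [P 0 <= p],
   the upper bound comes from [Q 0 <= q]. *)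
have [_ w0 _ _] := wP (f (g 0%N)); apply; exists p.
  apply: HF; rewrite ?qE; apply/cloP; split=> // e e0.
    have [N1 H1] := closeP e e0; exists (P N1); split; [exact: H1|exact: leP|].
    by have [] := wP (f (g N1)).
  have [N1 H1] := closeQ e e0; exists (Q N1); split; [exact: H1|exact: leQ|].
  by have [] := wP (f (g N1)).
apply/andP; split; first exact: (leP 0%N).
have := leQ 0%N; rewrite /Q /P; lra.
Qed.

Lemma seq_gap (s : seq R) :
  exists2 e : R, 0 < e & forall u v, u \in s -> v \in s -> u != v -> e <= `|u - v|.
Proof.
elim: s => [|a s [e e0 He]]; first by exists 1.
suff [d d0 Hd] : exists2 d : R, 0 < d & forall u, u \in s -> u != a -> d <= `|u - a|.
  exists (Num.min e d) => [|u v]; first by rewrite lt_min e0.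
  rewrite !inE ge_min => /orP[/eqP->|us] /orP[/eqP->|vs]; rewrite ?eqxx// => uv.
  - by rewrite distrC Hd ?orbT// eq_sym.
  - by rewrite Hd ?orbT.
  - by rewrite He.
elim: {He} s => [|u s [d d0 Hd]]; first by exists 1.
have [->|ua] := eqVneq u a.
  by exists d => // v; rewrite inE => /orP[/eqP->|]; [rewrite eqxx|exact: Hd].
exists (Num.min d `|u - a|) => [|v]; first by rewrite lt_min d0 normr_gt0 subr_eq0.
by rewrite inE ge_min => /orP[/eqP-> _|vs va]; rewrite ?lexx ?orbT// Hd.
Qed.

(** By [split_points] a pair of exponents with sum near [x] lies close to a pair of points of the
    closures, and by [seq_gap] to only one; grouping the terms accordingly gives Berarducci's
    formula. The list [G] lets a caller force chosen points into [F]. *)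
Lemma gm_mul b c x (G : seq R) : x <= 0 -> (forall p, p \in G -> x <= p <= 0) ->
  exists F : seq R, [/\ uniq F, {subset G <= F}, forall p, p \in F -> x <= p <= 0 &
    eqz (gm (b * c) x - \sum_(p <- F) gm b p * gm c (x - p))].
Proof.
move=> x0 HG; set F0 := [set p | clo b p /\ clo c (x - p)].
have finF0 : finite_set F0 by apply: finite_antidiag; exact: clo_wellordered.
pose F := undup (G ++ gps_fenum F0).
have FE p : p \in F = (p \in G) || (p \in F0) by rewrite mem_undup mem_cat gps_in_fenum.
exists F; split; first exact: undup_uniq.
- by move=> p pG; rewrite FE pG.
- move=> p; rewrite FE => /orP[/HG//|]; rewrite inE => -[/cloP[-> _] /cloP[h _]].
  by rewrite andbT; lra.
have [e1 e10 H1] := @split_points b c x F0 (fun p cb cc => conj cb cc).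
have [e2 e20 H2] := seq_gap F.
exists (Num.min e1 e2); first by rewrite lt_min e10.
move=> y; rewrite oppr_min gt_max => /andP[ey1 ey2].
rewrite coefD gps_coefN; apply/eqP; rewrite subr_eq0; apply/eqP.
have [y0|] := leP y 0; last by move=> y0; rewrite !coef_pos.
rewrite gmE y0.
have sumE (s : seq R) (f : R -> gps R K) : (\sum_(p <- s) f p) y = \sum_(p <- s) f p y.
  by elim: s => [|a s IH]; rewrite ?big_nil// !big_cons coefD IH.
rewrite sumE; set P := gps_fenum [set p | supp b p /\ supp c (x + y - p)].
have finP := mul_fin b c (x + y).
have PE p : p \in P -> b p != 0 /\ c (x + y - p) != 0.
  by rewrite gps_in_fenum// inE.
have -> : (b * c) (x + y) = \sum_(p <- P) b p * c (x + y - p).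
  by rewrite [LHS]mul_funEfin.
(* The germs at [z] and [x - z] see exactly the exponents [p] for which [p - z] and [y - (p - z)]
   are both nonpositive. *)
have term z : z \in F -> (gm b z * gm c (x - z)) y =
    \sum_(p <- P | p <= z <= p - y) b p * c (x + y - p).
  move=> zF; rewrite [LHS](@mul_funE _ _ _ _ y [seq p - z | p <- P]).
  - rewrite big_map [RHS]big_mkcond; apply: eq_bigr => p _. rewrite !gmE.
    have -> : (p - z <= 0) = (p <= z) by rewrite subr_le0.
    have -> : (y - (p - z) <= 0) = (z <= p - y) by apply/idP/idP; lra.
    have -> : z + (p - z) = p by lra.
    have -> : x - z + (y - (p - z)) = x + y - p by lra.
    by case: (p <= z) => /=; rewrite ?mul0r//; case: ifP; rewrite ?mulr0.
  - by rewrite map_inj_uniq ?gps_fenum_uniq//; exact: addIr.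
  - move=> q; rewrite /supp /fsupport /= /gm_fun.
    case: (leP q 0) => q0; rewrite ?eqxx// => bq.
    case: (leP (y - q) 0) => yq; rewrite ?eqxx// => cq.
    apply/mapP; exists (z + q); last by lra.
    rewrite gps_in_fenum// inE; split; first exact: bq.
    have -> : x + y - (z + q) = x - z + (y - q) by lra.
    exact: cq.
rewrite [RHS](eq_big_seq _ term) (exchange_big_dep xpredT)//=.
apply: eq_big_seq => p /PE[bp cp].
(* Some point of [F] accounts for [p], and only one, since two would be at distance less than
   [e2]. *)
have [z zF0 pz] := H1 _ _ ey1 y0 bp cp.
have zF : z \in F by rewrite FE; apply/orP; right; rewrite inE.
rewrite (big_rem z)//= pz big1_seq ?addr0// => z' /andP[pz' z'F]; exfalso.
have nzz : z' != z by apply: contraTneq z'F => ->; rewrite mem_rem_uniq ?undup_uniq// !inE eqxx.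
have := H2 z' z (mem_rem z'F) zF nzz; apply/negP; rewrite -ltNge ltr_norml.
by move/andP: pz => [? ?]; move/andP: pz' => [? ?]; apply/andP; split; lra.
Qed.

End Germs.

(** * The degree of a germ *)

Section Degree.
Variables (R : realType) (K : fieldType) (A : ordnum).
Implicit Types (b c d : gps R K) (x y z : R) (w : cnf A).

(** [dlt b w] says that the germ of [b] at [0] has degree less than [w], the
    degree of a series with support of type [omega ^ w] and supremum [0] being
    [w]; the zero germ has degree minus infinity. *)
Inductive dlt : gps R K -> cnf A -> Prop :=
| dlt_eqz b w : eqz b -> dlt b w
| dlt_germ b w w' : w' <o w -> left_near (fun x => dlt (gm b x) w') -> dlt b w.

Definition dle b w := left_near (fun x => dlt (gm b x) w).
Definition isdeg b w := dle b w /\ ~ dlt b w.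

Lemma dltP b w : dlt b w <-> eqz b \/ exists2 w', w' <o w & dle b w'.
Proof.
split=> [[{}b {}w|{}b {}w w' ww' nb]|[|[w' ww' nb]]].
- by left.
- by right; exists w'.
- exact: dlt_eqz.
- exact: dlt_germ nb.
Qed.

Lemma eqz_dle b w : eqz b -> dle b w.
Proof. by move=> /eqz_gm; apply: left_nearW => x _; exact: dlt_eqz. Qed.

Lemma dlt_le b w w' : w <=o w' -> dlt b w -> dlt b w'.
Proof.
move=> ww' /dltP[?|[v vw vb]]; first exact: dlt_eqz.
by apply/dltP; right; exists v => //; exact: lt_le_trans ww'.
Qed.

Lemma dle_le b w w' : w <=o w' -> dle b w -> dle b w'.
Proof. by move=> ww'; apply: left_nearW => x _; exact: dlt_le. Qed.

Lemma dltW b w : dlt b w -> dle b w.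
Proof.
by move=> /dltP[/eqz_dle//|[w' /ltW ww']]; exact: dle_le.
Qed.

Lemma dle_lt b w w' : w <o w' -> dle b w -> dlt b w'.
Proof. by move=> ww' bw; apply/dltP; right; exists w. Qed.

Lemma dlt0P b : dlt b 0 <-> eqz b.
Proof.
by split=> [/dltP[//|[w']]|]; [rewrite cnf_lt0|exact: dlt_eqz].
Qed.

Lemma dltD b c w : dlt b w -> dlt c w -> dlt (b + c) w.
Proof.
elim/cnf_wf: w b c => w IH b c hb hc.
have sum w' : w' <o w -> dle b w' -> dle c w' -> dlt (b + c) w.
  move=> lt nb nc; apply: (dle_lt lt); apply: left_nearW (left_nearI nb nc).
  by move=> x _ [bx cx]; rewrite gmD; exact: IH.
case/dltP: (hb) => [zb|[w1 w1w b1]]; case/dltP: (hc) => [zc|[w2 w2w c2]].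
- by apply: dlt_eqz; exact: eqzD.
- by apply: sum w2w _ _ => //; exact: eqz_dle.
- by apply: sum w1w _ _ => //; exact: eqz_dle.
- have [le|/ltW le] := leP w1 w2.
    by apply: sum w2w _ _ => //; exact: dle_le b1.
  by apply: sum w1w _ _ => //; exact: dle_le c2.
Qed.

Lemma dltZ (a : K) b w : dlt b w -> dlt (a *: b) w.
Proof.
elim/cnf_wf: w b => w IH b /dltP[zb|[w' ww' nb]]; first by apply: dlt_eqz; exact: eqzZ.
apply: (dle_lt ww'); apply: left_nearW nb => x _ bx; rewrite gmZ; exact: IH.
Qed.

Lemma dltN b w : dlt b w -> dlt (- b) w.
Proof. by rewrite -scaleN1r; exact: dltZ. Qed.

Lemma dltB b c w : dlt b w -> dlt c w -> dlt (b - c) w.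
Proof. by move=> hb hc; apply: dltD => //; exact: dltN. Qed.

Lemma dlt_sum (I : eqType) (s : seq I) (P : pred I) (F : I -> gps R K) w :
  (forall i, i \in s -> P i -> dlt (F i) w) -> dlt (\sum_(i <- s | P i) F i) w.
Proof.
move=> H; rewrite big_seq_cond; apply: (big_ind (dlt^~ w)).
- by apply: dlt_eqz; exact: eqz0.
- by move=> b c; exact: dltD.
- by move=> i /andP[]; exact: H.
Qed.

Lemma dlt_eqzB b c w : eqz (b - c) -> dlt c w -> dlt b w.
Proof. by move=> /(@dlt_eqz _ w) h /(dltD h); rewrite subrK. Qed.

Lemma dlt_sub b c w : dlt (b - c) w -> dlt c w -> dlt b w.
Proof. by move=> h /(dltD h); rewrite subrK. Qed.

Lemma dlt_subl b c w : dlt (b - c) w -> dlt b w -> dlt c w.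
Proof. by move=> h hb; have := dltB hb h; rewrite opprB addrC subrK. Qed.

Lemma dleZ (a : K) b w : dle b w -> dle (a *: b) w.
Proof. by apply: left_nearW => x _ bx; rewrite gmZ; exact: dltZ. Qed.

(** In the product formula at [x < 0] the points [p] and [x - p] are not both [0], so in every term
    at least one factor drops in degree and the induction applies. *)
Lemma dleM b c w w' : dle b w -> dle c w' -> dle (b * c) (w + w').
Proof.
elim/cnf_wf: w w' b c => w IHw; elim/cnf_wf => w' IHw' b c hb hc.
have [e e0 He] := left_nearI hb hc.
exists e => // x ex x0.
have [|F [_ _ FP Feq]] := @gm_mul R K b c x [::] (ltW x0); first by [].
apply: dlt_eqzB Feq _; apply: dlt_sum => p /FP/andP[xp p0] _.
have [pe|pneg] := eqVneq p 0.
  subst p; rewrite gm0 subr0; have [_ /dltP[zc|[v vw cv]]] := He x ex x0.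
    by apply: dlt_eqz; exact: eqzMr.
  by apply: dle_lt (IHw' _ vw _ _ hb cv); rewrite cnf_ltD2l.
have pe : - e < p by exact: lt_le_trans ex xp.
have pn : p < 0 by rewrite lt_neqAle pneg.
have [/dltP[zb|[v vw bv]] _] := He p pe pn.
  by apply: dlt_eqz; exact: eqzM.
have [xpe|xpn] := eqVneq (x - p) 0.
  rewrite xpe gm0; apply: dle_lt (IHw _ vw _ _ _ bv hc); by rewrite cnf_ltD2r.
have [_ /dltP[zc|[v' vw' cv]]] := He (x - p) ltac:(lra) ltac:(rewrite lt_neqAle xpn; lra).
  by apply: dlt_eqz; exact: eqzMr.
by apply: dle_lt (IHw _ vw _ _ _ bv cv); exact: cnf_ltD.
Qed.

Lemma dltMl b c w w' : dlt b w -> dle c w' -> dlt (b * c) (w + w').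
Proof.
move=> /dltP[zb|[v vw bv]] hc; first by apply: dlt_eqz; exact: eqzM.
by apply: dle_lt (dleM bv hc); rewrite cnf_ltD2r.
Qed.

Lemma dltMr b c w w' : dle b w -> dlt c w' -> dlt (b * c) (w + w').
Proof. by rewrite mulrC [w + _]addrC => hb hc; exact: dltMl. Qed.

Lemma dltM_lt b c w w' t : (forall v v', v <o w -> v' <o w' -> v + v' <o t) ->
  dlt b w -> dlt c w' -> dlt (b * c) t.
Proof.
move=> H /dltP[zb|[v vw bv]]; first by move=> _; apply: dlt_eqz; exact: eqzM.
move=> /dltP[zc|[v' vw' cv]]; first by apply: dlt_eqz; exact: eqzMr.
by apply: dle_lt (dleM bv cv); exact: H.
Qed.

(** The terms at [p = 0] and [p = x] of the product formula form the Leibniz rule; in every other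
    term both germs are taken at negative points, so both degrees drop. *)
Lemma leib b c w w' t : (forall v v', v <o w -> v' <o w' -> v + v' <o t) ->
  dle b w -> dle c w' ->
  left_near (fun x => dlt (gm (b * c) x - (gm b x * c + b * gm c x)) t).
Proof.
move=> H hb hc; have [e e0 He] := left_nearI hb hc; exists e => // x ex x0.
have [|F [uF GF FP Feq]] := @gm_mul R K b c x [:: 0; x] (ltW x0).
  by move=> p; rewrite !inE => /orP[]/eqP->; rewrite ?lexx ltW.
have F0 : 0 \in F by apply: GF; rewrite !inE eqxx.
have Fx : x \in rem 0 F by rewrite mem_rem_uniq// !inE GF ?andbT ?lt_eqF// !inE eqxx orbT.
move: Feq; rewrite (big_rem 0 F0)/= (big_rem x Fx)/= gm0 subrr gm0 subr0 => Feq.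
set S := \sum_(_ <- _) _ in Feq.
rewrite -[X in dlt X](subrK S) [X in dlt X]addrC; apply: dltD; last first.
  by apply: dlt_eqz; congr eqz: Feq; rewrite [gm b x * c + _]addrC opprD addrA !opprD !addrA.
apply: dlt_sum => p pF _.
have pF' : p \in rem 0 F by exact: mem_rem pF.
have px : p != x.
  by apply: contraTneq pF => ->; rewrite mem_rem_uniq ?rem_uniq// !inE eqxx.
have p0 : p != 0 by apply: contraTneq pF' => ->; rewrite mem_rem_uniq// !inE eqxx.
have /andP[xp pn] := FP p (mem_rem pF').
have xp' : x < p by rewrite lt_neqAle eq_sym px.
have pn' : p < 0 by rewrite lt_neqAle p0.
have [bp _] := He p ltac:(lra) pn'; have [_ cp] := He (x - p) ltac:(lra) ltac:(lra).
exact: dltM_lt H bp cp.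
Qed.

Lemma not_dlt_germ b w w' e : ~ dlt b w -> w' <o w -> 0 < e ->
  exists x, [/\ - e < x, x < 0 & ~ dlt (gm b x) w'].
Proof.
move=> nb ww' e0; apply: contrapT => /forallNP N; apply: nb.
apply: (dlt_germ ww'); exists e => // x ex x0; apply: contrapT => nd.
by apply: (N x).
Qed.

Lemma not_dle_germ b w e : ~ dle b w -> 0 < e ->
  exists x, [/\ - e < x, x < 0 & ~ dlt (gm b x) w].
Proof.
move=> nb e0; apply: contrapT => /forallNP N; apply: nb.
exists e => // x ex x0; apply: contrapT => nd; by apply: (N x).
Qed.

(** The rank of [0] is monotone in the support. The inclusion says nothing about the coefficient at
    [0], hence the condition that [w] be positive. *)
Lemma dlt_support b c w : left_near (fun x => c x = 0 -> b x = 0) -> 0 <o w ->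
  dlt c w -> dlt b w.
Proof.
elim/cnf_wf: w b c => w IH b c sub w0.
have sub' w' : w' <o w -> dle c w' -> dlt b w.
  move=> lt nc; apply: (dle_lt lt); have [e e0 He] := left_nearI sub nc.
  exists e => // x ex x0; have [_ cx] := He x ex x0.
  have [|/eqP w'0] := eqVneq (w' : cnf A) 0; last first.
    apply: (IH _ lt _ (gm c x)) (cnf_gt0 w'0) cx => //.
    exists (x + e); first lra; move=> y ey y0; rewrite !gmE (ltW y0) => cxy.
    by have [H _] := He (x + y) ltac:(lra) ltac:(lra); exact: H.
  (* For [w' = 0] the induction hypothesis does not apply, but at [x < 0] the inclusion of supports
     includes the point [x] itself. *)
  move=> w'0; rewrite w'0 in cx *; apply/dlt0P; move/dlt0P: cx => [d d0 Hd].
  exists (Num.min d (x + e)); first by rewrite lt_min d0; lra.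
  move=> y; rewrite oppr_min gt_max => /andP[dy ey]; rewrite gmE.
  case: (leP y 0) => // y0; have := Hd y dy; rewrite gmE y0.
  by have [H _] := He (x + y) ltac:(lra) ltac:(lra).
case/dltP => [zc|[w' lt nc]]; last exact: sub' nc.
by apply: sub' w0 _; exact: eqz_dle.
Qed.

End Degree.
Arguments dlt0P {R K A b}.

(** * Germs of degree zero are constants *)

Section ConstantGerms.
Variables (R : realType) (K : fieldType).
Implicit Types (b c : gps R K).

Lemma dle0P (A : ordnum) b : dle b (0 : cnf A) -> eqz (b - (b 0) *: 1).
Proof.
move=> [e e0 He]; exists e => // x ex; rewrite coefD gps_coefN coefZ.
have [x0|x0|->] := ltgtP x 0.
- have /dlt0P[d d0 /(_ 0)] := He x ex x0.
  rewrite gmE lexx addr0 oppr_lt0 => /(_ d0) ->.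
  by rewrite /= /gps_one_fun lt_eqF// mulr0 subr0.
- by rewrite coef_pos// /= /gps_one_fun gt_eqF// mulr0 subr0.
- by rewrite /= /gps_one_fun eqxx mulr1 subrr.
Qed.

Lemma eqz_const (a : K) : eqz (a *: 1 : gps R K) -> a = 0.
Proof.
move=> [e e0 /(_ 0)]; rewrite oppr_lt0 => /(_ e0).
by rewrite coefZ /= /gps_one_fun eqxx mulr1.
Qed.

Lemma isdeg0_const (A : ordnum) b : isdeg b (0 : cnf A) ->
  b 0 != 0 /\ eqz (b - (b 0) *: 1).
Proof.
move=> [/dle0P h nb]; split=> //; apply/eqP => b0; apply: nb; apply/dlt0P.
by move: h; rewrite b0 scale0r subr0.
Qed.

Lemma dle_const (A : ordnum) (a : K) (w : cnf A) : dle (a *: 1 : gps R K) w.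
Proof.
exists 1 => // x _ x0; apply: dlt_eqz; exists (- x); first by rewrite oppr_gt0.
move=> y; rewrite opprK => xy; rewrite gmE; case: (leP y 0) => // y0.
by rewrite coefZ /= /gps_one_fun; case: eqP => [E|_]; [exfalso; lra|rewrite mulr0].
Qed.

Lemma dlt_const_mul (A : ordnum) b c (w : cnf A) (a : K) : a != 0 ->
  eqz (c - a *: 1) -> dlt (b * c) w -> dlt b w.
Proof.
move=> a0 /(eqzMr b) h /(dltZ a^-1); suff /(dlt_eqzB (w := w)): eqz (b - a^-1 *: (b * c)) by [].
have -> : b - a^-1 *: (b * c) = - (a^-1 *: (b * (c - a *: 1))).
  by rewrite mulrBr -scalerAr mulr1 scalerBr scalerA mulVf// scale1r opprB.
by apply: eqzN; exact: eqzZ.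
Qed.
End ConstantGerms.

(** * The degree is a valuation *)

Section Valuation.
Variables (R : realType) (K : fieldType) (A : ordnum).
Hypothesis charK : [pchar K] =i pred0.
(** This requires [A] to have enough exponents to express all degrees; [univ_bounded] provides such
    an [A]. *)
Hypothesis bounded : forall b : gps R K, exists w : cnf A, dle b w.
Implicit Types (b c u p l : gps R K) (x y z : R) (w X Y d : cnf A).

Lemma isdeg_exists b : ~ eqz b -> exists w, isdeg b w.
Proof.
move=> nb; have [w bw wmin] := cnf_least (bounded b).
exists w; split=> // /dltP[//|[w' ww' /wmin]]; by rewrite leNgt ww'.
Qed.

(** An intermediate value property: as long as a germ has degree above [w], there is a germ with a
    smaller bound that is still not below [w], and the descent must stop at degree exactly [w]. *)
Lemma exact_germ b w e : ~ dle b w -> 0 < e ->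
  exists x, [/\ - e < x, x < 0 & isdeg (gm b x) w].
Proof.
have [w0] := bounded b; elim/cnf_wf: w0 b e => w0 IH b e bw0 nb e0.
have [x [ex x0 [nx /dltP lx]]] : exists x, [/\ - e < x, x < 0 &
    ~ dlt (gm b x) w /\ dlt (gm b x) w0].
  have [d d0 Hd] := bw0.
  have [|x [xe x0 nx]] := not_dle_germ (e := Num.min e d) nb; first by rewrite lt_min e0.
  move: xe; rewrite oppr_min gt_max => /andP[ex dx].
  by exists x; split=> //; split=> //; exact: Hd.
have [h|ndle] := pselect (dle (gm b x) w); first by exists x.
case: lx => [/eqz_dle//|[w1 w10 x1]].
have [|y [ey y0]] := IH _ w10 _ (x + e) x1 ndle; first lra.
rewrite gm_gm ?ltW// => dy; exists (x + y); split=> //; lra.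
Qed.

Lemma exact_germ0 b w e : ~ dlt b w -> 0 < e ->
  exists x, [/\ - e < x, x <= 0 & isdeg (gm b x) w].
Proof.
move=> nb e0; have [h|/exact_germ/(_ e0)[x [ex /ltW x0 hx]]] := pselect (dle b w).
  by exists 0; rewrite oppr_lt0 gm0.
by exists x.
Qed.

(** If [l] is lower than expected at the scale [d], where [p] is not, then
    passing to a suitable germ brings both down to [d = 0]. *)
Lemma descent e X Y d l p : hi e Y -> d <=o om e -> dlt l (Y + d) -> ~ dlt p (X + d) ->
  forall eps : R, 0 < eps ->
  exists y, [/\ - eps < y, y <= 0, dlt (gm l y) Y & isdeg (gm p y) X].
Proof.
move=> hY; elim/cnf_wf: d l p => d IH l p de lY pX eps eps0.
have [lY'|nlY] := pselect (dlt l Y).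
  have [e1 e10 H1] := dltW lY'.
  have npX : ~ dlt p X by move=> h; apply: pX; apply: dlt_le h; exact: cnf_leDl.
  have [|x [xe x0 hx]] := exact_germ0 (e := Num.min eps e1) npX; first by rewrite lt_min eps0.
  move: xe; rewrite oppr_min gt_max => /andP[ex dx].
  exists x; split=> //; move: x0; rewrite le_eqVlt => /orP[/eqP->|x0]; first by rewrite gm0.
  exact: H1.
case/dltP: lY => [zl|[w wY lw]]; first by case: nlY; exact: dlt_eqz.
(* Since [Y] is a multiple of [omega ^ e], the bound for nearby germs of [l] is [Y + d1] with
   [d1 < d]; some nearby germ of [p] is not below [X + d1], and the induction continues there. *)
have Yw : Y <=o w by rewrite leNgt; apply/negP => wY'; apply: nlY; exact: dle_lt lw.
have [d1 d1d wE] := le_hi_add hY de Yw wY; rewrite wE in lw.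
have [e1 e10 H1] := lw.
have [||x [xe x0 nx]] := @not_dlt_germ R K A p (X + d) (X + d1) (Num.min eps e1) pX.
- by rewrite cnf_ltD2l.
- by rewrite lt_min eps0.
move: xe; rewrite oppr_min gt_max => /andP[ex dx].
have [||y [ey y0]] := IH _ d1d _ _ _ (H1 _ dx x0) nx (x + eps).
- by apply: le_trans (ltW d1d) de.
- lra.
by rewrite !gm_gm// => ly py; exists (x + y); split=> //; lra.
Qed.

(** Terms in which two factors are differentiated lose two copies of [omega ^ e] and regain only
    remainders below [omega ^ e], so they fall under the bound; the rest is the usual induction for
    the power rule. *)
Lemma expr_leib u w0 e j : hi e w0 -> dle u (w0 + om e) ->
  left_near (fun y => dlt (gm (u ^+ j.+1) y - j.+1%:R * (u ^+ j * gm u y))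
    ((w0 + om e) *+ j + w0)).
Proof.
move=> hw0 uw; set w := w0 + om e.
have uwj j' : dle (u ^+ j') (w *+ j').
  elim: j' => [|j' IH]; first by rewrite expr0 mulr0n -[1]scale1r; exact: dle_const.
  by rewrite exprS mulrS; exact: dleM.
have hw : hi e w by apply: hiD => //; exact: hi_om.
elim: j => [|j IH].
  apply: left_nearT => x _; apply: dlt_eqz.
  by rewrite expr1 expr0 mul1r mul1r subrr; exact: eqz0.
have lb : left_near (fun y => dlt (gm (u * u ^+ j.+1) y - (gm u y * u ^+ j.+1 + u * gm (u ^+ j.+1) y))
    (w *+ j.+1 + w0)).
  apply: (leib _ uw (uwj j.+1)) => v v'.
  move=> /(lt_add_om hw0)[d1 d1e v1].
  have -> : w *+ j.+1 + w0 = (w *+ j + w0 + w0) + om e by rewrite /w; cnf_ring.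
  have -> : w *+ j.+1 = (w *+ j + w0) + om e by rewrite /w; cnf_ring.
  move=> /(lt_add_om (hiD (hiMn j hw) hw0))[d2 d2e v2].
  apply: le_lt_trans (cnf_leD v1 v2) _.
  have -> : w0 + d1 + (w *+ j + w0 + d2) = w *+ j + w0 + w0 + (d1 + d2) by cnf_ring.
  by rewrite cnf_ltD2l; exact: om_add.
apply: left_nearW (left_nearI lb IH) => y y0 [h1 h2].
have {}h2 := dltMr uw h2.
have E : w0 + om e + (w *+ j + w0) = w *+ j.+1 + w0 by rewrite /w; cnf_ring.
rewrite E in h2; have := dltD h1 h2.
rewrite -exprS; congr dlt; rewrite -(natr1 j.+1) ![u ^+ j.+1]exprS; ring.
Qed.

Lemma natr_gps n : n%:R = (n%:R : K) *: 1 :> gps R K.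
Proof. by rewrite scaler_nat. Qed.

(** Characteristic [0] enters here: the integer produced by the power rule is invertible. *)
Lemma dlt_natr n b w : dlt (n.+1%:R * b) w -> dlt b w.
Proof.
have n0 : (n.+1%:R : K) != 0 by rewrite ((pcharf0P K).1 charK).
rewrite natr_gps mulrC => h; apply: dlt_const_mul n0 _ h.
by rewrite subrr; exact: eqz0.
Qed.

Lemma dle_expr u w j : dle u w -> dle (u ^+ j) (w *+ j).
Proof.
move=> uw; elim: j => [|j' IH]; first by rewrite expr0 mulr0n -[1]scale1r; exact: dle_const.
by rewrite exprS mulrS; exact: dleM.
Qed.

(** Replaces one factor of degree [w0 + om e] by one of degree [w0], at the cost
    of squaring the remaining factors: this removes the terms of the Leibniz
    rule in which they are differentiated. *)
Lemma drop_factor e u w0 j p d : hi e w0 -> isdeg u (w0 + om e) -> hi e d -> dle p d ->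
  dlt (u ^+ j.+1 * p) ((w0 + om e) *+ j.+1 + d) ->
  exists v, isdeg v w0 /\ dlt (u ^+ j * v * p ^+ 2) ((w0 + om e) *+ j + w0 + d *+ 2).
Proof.
move=> hw0 [uw nu] hd pd low; set w := w0 + om e in uw nu low *.
have hw : hi e w by apply: hiD => //; exact: hi_om.
set Y := w *+ j + w0 + d.
have YE : w *+ j.+1 + d = Y + om e by rewrite /Y /w; cnf_ring.
have hY : hi e Y by do 2!apply: hiD => //; exact: hiMn.
have N1 := expr_leib j hw0 uw; rewrite -/w in N1.
have N2 : left_near (fun y => dlt (gm (u ^+ j.+1 * p) y -
    (gm (u ^+ j.+1) y * p + u ^+ j.+1 * gm p y)) Y).
  apply: (leib _ (dle_expr j.+1 uw) pd) => v v'.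
  have -> : w *+ j.+1 = w *+ j + w0 + om e by rewrite /w; cnf_ring.
  move=> /(lt_add_om (hiD (hiMn j hw) hw0))[d1 d1e v1] v'd.
  apply: le_lt_trans (cnf_leD v1 (lexx v')) _.
  by rewrite -addrA cnf_ltD2l addrC; exact: hi_absorb hd v'd d1e.
have [eps eps0 Heps] := left_nearI N1 (left_nearI N2 pd).
rewrite YE in low.
(* Here the germ of the product is below [Y], while that of [u], the new factor [v], has degree
   exactly [w0]. *)
have [y [ey y0 ly vy]] := descent hY (lexx _) low nu eps0.
have {}y0 : y < 0.
  rewrite lt_neqAle y0 andbT; apply/eqP => y00; apply: nu.
  have := vy.1; rewrite y00 gm0; apply: dle_lt.
  by rewrite -{1}[w0]addr0 cnf_ltD2l om_gt0.
exists (gm u y); split=> //; have [h1 [h2 h3]] := Heps y ey y0.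
(* Multiplying the Leibniz rule for [u ^+ j.+1 * p] by [p] expresses the wanted product through the
   germ of [u ^+ j.+1 * p], low by the choice of [y], and through [u ^+ j.+1 * p * gm p y], low by
   hypothesis. *)
apply: (@dlt_natr j).
have T1 : dlt (gm (u ^+ j.+1 * p) y * p) (Y + d) by exact: dltMl.
have T2 : dlt (u ^+ j.+1 * p * gm p y) (Y + d).
  apply: dltM_lt low h3 => v v' /(lt_add_om hY)[d1 d1e v1] v'd.
  apply: le_lt_trans (cnf_leD v1 (lexx v')) _.
  by rewrite -addrA cnf_ltD2l addrC; exact: hi_absorb hd v'd d1e.
have T3 := dltMl h2 pd.
have := dltMl h1 (dle_expr 2 pd).
have -> : w *+ j + w0 + d *+ 2 = Y + d by rewrite /Y; cnf_ring.
move=> T4; have := dltB (dltB (dltB T1 T2) T3) T4.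
congr dlt; ring.
Qed.

(** For [w = w0 + om e] the family consists of products of series of degree [w] with members of the
    family of [w0]. If such a product were too low, [drop_factor] would replace its factors of
    degree [w] one by one by factors of degree [w0], until a member of the family of [w0] were too
    low. *)
Lemma nonlow_family w : exists M : gps R K -> cnf A -> Prop,
  [/\ M 1 0, forall p q d d', M p d -> M q d' -> M (p * q) (d + d'),
      forall p d, M p d -> isdeg p d,
      forall p d e, M p d -> hi e w -> hi e d &
      forall u, isdeg u w -> M u w].
Proof.
elim/cnf_wf: w => w IH; have [w0|/cnf_chop[e [w0 [wE hw0]]]] := pselect (w = 0).
  rewrite w0; exists (fun p d => isdeg p (0 : cnf A) /\ d = 0); split=> //.
  - split=> //; split; first by rewrite -[1]scale1r; exact: dle_const.
    by move/dlt0P; rewrite -[1]scale1r => /eqz_const/eqP; rewrite oner_eq0.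
  - move=> p q d d' [dp ->] [dq ->]; rewrite addr0; split=> //; split.
      by rewrite -[0 : cnf A]addr0; apply: dleM; [exact: dp.1|exact: dq.1].
    have [q0 zq] := isdeg0_const dq; move/(dlt_const_mul q0 zq); exact: dp.2.
  - by move=> p d [? ->].
  - by move=> p d e [? ->].
subst w; have [|M [M1 MM Mdeg Mhi Mu]] := IH w0.
  by rewrite -{1}[w0]addr0 cnf_ltD2l om_gt0.
set w := w0 + om e.
have Mpow m d i : M m d -> M (m ^+ i) (d *+ i).
  move=> Mm; elim: i => [|i IHi]; first by rewrite expr0.
  by rewrite exprS mulrS; exact: MM.
exists (fun p d => exists (us : seq (gps R K)) m d0, [/\ forall u, u \in us -> isdeg u w,
  M m d0, p = (\prod_(u <- us) u) * m & d = w *+ size us + d0]).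
have dle_us (us : seq (gps R K)) : (forall u, u \in us -> isdeg u w) ->
    dle (\prod_(u <- us) u) (w *+ size us).
  elim: us => [|u us IHu] Hus; first by rewrite big_nil -[1]scale1r; exact: dle_const.
  rewrite big_cons /= mulrS; apply: dleM; first by have [] := Hus u (mem_head _ _).
  by apply: IHu => v vs; apply: Hus; rewrite inE vs orbT.
split.
- by exists [::], 1, 0; split=> //; rewrite ?big_nil ?mul1r// addr0.
- move=> _ _ _ _ [us [m [d [Hus Mm -> ->]]]] [us' [m' [d' [Hus' Mm' -> ->]]]].
  exists (us ++ us'), (m * m'), (d + d'); split.
  + by move=> u; rewrite mem_cat => /orP[/Hus|/Hus'].
  + exact: MM.
  + by rewrite big_cat /= mulrACA.
  + by rewrite size_cat; cnf_ring.
- move=> _ _ [us [m [d [Hus Mm -> ->]]]]; split.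
    by apply: dleM; [exact: dle_us|exact: (Mdeg _ _ Mm).1].
  (* Powers are needed because [drop_factor] squares the remaining factors: below, [j] decreases
     while [k] doubles and [v] is absorbed in [m]. *)
  suff L i : ~ dlt ((\prod_(u <- us) u) ^+ i * m) (w *+ size us *+ i + d).
    by have := L 1%N; rewrite expr1 mulr1n.
  elim: us Hus m d Mm i => [|u us IHu] Hus m d Mm i.
    by rewrite big_nil expr1n mul1r mul0rn add0r; exact: (Mdeg _ _ Mm).2.
  have uw := Hus u (mem_head _ _).
  have {}Hus v : v \in us -> isdeg v w by move=> vs; apply: Hus; rewrite inE vs orbT.
  set q := \prod_(u <- us) u.
  suff L j k : forall m d, M m d ->
      ~ dlt (u ^+ j * (q ^+ k * m)) (w *+ j + (w *+ size us *+ k + d)).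
    rewrite big_cons exprMn -mulrA mulrS mulrnDl -addrA; exact: L.
  elim: j k {m d Mm} => [|j IHj] k m d Mm; first by rewrite mul1r add0r; exact: IHu.
  move=> low; have [||v [vw0 /= ]] := drop_factor hw0 uw _ _ low.
  + apply: hiD; last exact: Mhi Mm hw0.
    do 2!apply: hiMn; by apply: hiD => //; exact: hi_om.
  + apply: dleM; last exact: (Mdeg _ _ Mm).1.
    by apply: dle_expr; exact: dle_us.
  have := @IHj (k * 2)%N (v * m ^+ 2) (w0 + d *+ 2) (MM _ _ _ _ (Mu _ vw0) (Mpow _ _ 2 Mm)).
  move=> nl low'; apply: nl; move: low'; rewrite exprMn -exprM.
  have -> : u ^+ j * v * (q ^+ (k * 2) * m ^+ 2) = u ^+ j * (q ^+ (k * 2) * (v * m ^+ 2)) by ring.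
  by congr dlt; rewrite /w; cnf_ring.
- move=> _ _ e' [us [m [d [Hus Mm _ ->]]]] he'.
  apply: hiD; first exact: hiMn.
  apply: Mhi Mm _; move=> a ae'; have := he' a ae'; rewrite cnfDE; by case: (sval w0 a).
- move=> u uw; exists [:: u], 1, 0; split=> //.
  + by move=> v; rewrite inE => /eqP->.
  + by rewrite big_seq1 mulr1.
  + by rewrite addr0.
Qed.

Lemma isdeg_sqr b w : isdeg b w -> isdeg (b * b) (w + w).
Proof.
have [M [_ MM Mdeg _ Mu]] := nonlow_family w.
by move=> /Mu Mb; apply: Mdeg; exact: MM.
Qed.

(** A germ of one factor that has lost its least term contradicts the induction hypothesis, provided
    that the other half of the Leibniz rule is low; which factor to take depends on the least
    exponents [e] and [f]. *)
Lemma not_dlt_mul_isdeg w w' b c : isdeg b w -> isdeg c w' -> ~ dlt (b * c) (w + w').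
Proof.
elim/cnf_wf: w' w b c => w' IHc; elim/cnf_wf => w IHb b c bw cw low.
have [w'0|/cnf_chop[f [w0' [wE' hw0']]]] := pselect (w' = 0).
  subst w'; have [c0 zc] := isdeg0_const cw.
  by rewrite addr0 in low; apply: bw.2; exact: dlt_const_mul c0 zc low.
have [w00|/cnf_chop[e [w0 [wE hw0]]]] := pselect (w = 0).
  subst w; have [b0 zb] := isdeg0_const bw.
  by rewrite add0r mulrC in low; apply: cw.2; exact: dlt_const_mul b0 zb low.
have hw : hi e w by rewrite wE; apply: hiD => //; exact: hi_om.
have hw' : hi f w' by rewrite wE'; apply: hiD => //; exact: hi_om.
have w0w : w0 <o w by rewrite wE -{1}[w0]addr0 cnf_ltD2l om_gt0.
have w0w' : w0' <o w' by rewrite wE' -{1}[w0']addr0 cnf_ltD2l om_gt0.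
have [bdle nb] := bw; have [cdle nc] := cw.
(* For [e < f] the term [b * gm c y] is low by itself: the loss of [omega ^ f] outweighs the
   [omega ^ e] between [w0] and [w]. *)
have [ef|fe] := pselect (olt e f).
  have hY : hi e (w' + w0) by apply: hiD => //; apply: hi_le hw' => /(olt_trans ef)/(@olt_irr _ _).
  have N1 : left_near (fun y => dlt (gm (b * c) y - (gm b y * c + b * gm c y)) (w0 + w')).
    apply: (leib _ bdle cdle) => v v'; rewrite wE wE'.
    move=> /(lt_add_om hw0)[d1 d1e v1] /(lt_add_om hw0')[d2 d2e v2].
    apply: le_lt_trans (cnf_leD v1 v2) _; rewrite addrACA [ltRHS]addrA cnf_ltD2l.
    by apply: om_add => //; exact: lt_trans d1e (om_lt ef).
  have [eps eps0 Heps] := left_nearI N1 cdle.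
  have low' : dlt (b * c) (w' + w0 + om e) by rewrite -addrA -wE addrC.
  have [|y [ey y0 ly vy]] := descent hY (lexx _) low' (p := b) (X := w0) _ eps0.
    by rewrite -wE.
  have {}y0 : y < 0.
    rewrite lt_neqAle y0 andbT; apply/eqP => y00; apply: nb.
    by apply: dle_lt w0w _; have := vy.1; rewrite y00 gm0.
  have [h1 h2] := Heps y ey y0; apply: (IHb _ w0w _ _ vy cw).
  apply: (@dlt_subl _ _ _ (gm (b * c) y - b * gm c y)).
    by move: h1; congr dlt; ring.
  apply: dltB; first by rewrite addrC.
  case/dltP: h2 => [zc|[v vw cv]]; first by apply: dlt_eqz; exact: eqzMr.
  apply: dle_lt (dleM bdle cv); rewrite wE' in vw.
  have [d2 d2e v2] := lt_add_om hw0' vw.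
  apply: le_lt_trans (cnf_leD (lexx w) v2) _; rewrite wE wE' addrACA [ltRHS]addrA cnf_ltD2l.
  by apply: om_add => //; exact: om_lt.
(* Otherwise multiplying the Leibniz rule by [b] turns the unwanted term into [gm b y * (b * c)],
   low by assumption; what remains is [b * b * gm c y], excluded by induction since [isdeg_sqr]
   gives the degree of [b * b]. *)
have omfe : om f <=o om e by exact: om_le.
have hY : hi f (w + w0') by apply: hiD => //; exact: hi_le hw.
have N1 : left_near (fun y => dlt (gm (b * c) y - (gm b y * c + b * gm c y)) (w + w0')).
  apply: (leib _ bdle cdle) => v v'; rewrite wE wE'.
  move=> /(lt_add_om hw0)[d1 d1e v1] /(lt_add_om hw0')[d2 d2e v2].
  apply: le_lt_trans (cnf_leD v1 v2) _; rewrite addrACA [ltRHS]addrAC cnf_ltD2l.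
  by apply: om_add => //; exact: lt_le_trans d2e omfe.
have [eps eps0 Heps] := left_nearI N1 bdle.
have low' : dlt (b * c) (w + w0' + om f) by rewrite -addrA -wE'.
have [|y [ey y0 ly vy]] := descent hY (lexx _) low' (p := c) (X := w0') _ eps0.
  by rewrite -wE'.
have {}y0 : y < 0.
  rewrite lt_neqAle y0 andbT; apply/eqP => y00; apply: nc.
  by apply: dle_lt w0w' _; have := vy.1; rewrite y00 gm0.
have [h1 h2] := Heps y ey y0; apply: (IHc _ w0w' _ _ _ (isdeg_sqr bw) vy).
have T1 := dltMr bdle ly; have T2 := dltMr bdle h1.
have T3 : dlt (gm b y * (b * c)) (w + (w + w0')).
  apply: dltM_lt h2 low' => v v'; rewrite {1}wE.
  move=> /(lt_add_om hw0)[d1 d1e v1] /(lt_add_om hY)[d2 d2e v2].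
  apply: le_lt_trans (cnf_leD v1 v2) _.
  have -> : w0 + d1 + (w + w0' + d2) = w0 + (w + w0') + (d1 + d2) by cnf_ring.
  have -> : w + (w + w0') = w0 + (w + w0') + om e by rewrite {1}wE; cnf_ring.
  rewrite cnf_ltD2l.
  by apply: om_add => //; exact: lt_le_trans d2e omfe.
have := dltB (dltB T1 T2) T3; rewrite addrA; congr dlt; ring.
Qed.

Lemma not_dlt_mul w w' b c : ~ dlt b w -> ~ dlt c w' -> ~ dlt (b * c) (w + w').
Proof.
have deg p (v : cnf A) : ~ dlt p v -> exists2 v', v <=o v' & isdeg p v'.
  move=> nd; have [|v' dv'] := @isdeg_exists p; first by move=> zp; apply: nd; exact: dlt_eqz.
  exists v' => //; rewrite leNgt; apply/negP => lt; apply: nd; exact: dle_lt dv'.1.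
move=> /deg[v wv bv] /deg[v' wv' cv'] low; apply: not_dlt_mul_isdeg bv cv' _.
by apply: dlt_le low; exact: cnf_leD.
Qed.

Lemma eqz_mul b c : eqz (b * c) -> eqz b \/ eqz c.
Proof.
move=> zbc; apply: contrapT => /not_orP[/isdeg_exists[w bw] /isdeg_exists[w' cw']].
apply: not_dlt_mul_isdeg bw cw' _; exact: dlt_eqz.
Qed.
End Valuation.

(** * Factorizations *)

Section Factorization.
Variables (R : realType) (K : fieldType) (A : ordnum).
Hypothesis charK : [pchar K] =i pred0.
Hypothesis bounded : forall b : gps R K, exists w : cnf A,
  forall x, x <= 0 -> dle (gm b x) w.
Implicit Types (b c : gps R K) (x y z : R) (w : cnf A).

Let bounded0 b : exists w : cnf A, dle b w.
Proof. by have [w /(_ 0 (lexx _))] := bounded b; rewrite gm0; exists w. Qed.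

Lemma isdeg_le b w w' : ~ dlt b w -> dle b w' -> w <=o w'.
Proof. by move=> nb bw'; rewrite leNgt; apply/negP => lt; apply: nb; exact: dle_lt bw'. Qed.

Lemma isdeg_uniq b w w' : isdeg b w -> isdeg b w' -> w = w'.
Proof.
move=> [l n] [l' n']; apply/eqP; rewrite eq_le.
by apply/andP; split; [exact: isdeg_le n l'|exact: isdeg_le n' l].
Qed.

Lemma support_gap b x : exists2 e : R, 0 < e & forall y, x < y -> y < x + e -> b y = 0.
Proof.
have [[y [xy by0]]|N] := pselect (exists y, x < y /\ b y != 0); last first.
  exists 1 => // y xy _; apply/eqP/negPn/negP => by0; apply: N; by exists y.
have [|m [xm bm] mmin] := @supp_wellordered _ _ b [set y | x < y /\ b y != 0] _ (ex_intro _ y (conj xy by0)).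
  by move=> z [].
exists (m - x); first by rewrite subr_gt0.
move=> z xz; rewrite addrC subrK => zm; apply/eqP/negPn/negP => bz.
by move: zm; rewrite ltNge mmin.
Qed.

(** Take [w] the least uniform bound. If it were attained nowhere, let [s] be the supremum of the
    points up to which a smaller bound holds: this bound holds up to [s], and either [s = 0]
    contradicts minimality or the bound extends past [s]. *)
Lemma max_degree b : b != 0 -> exists w z, [/\ z <= 0, ~ dlt (gm b z) w,
  forall x, x <= 0 -> dle (gm b x) w & forall x, x < z -> dlt (gm b x) w].
Proof.
move=> b0; have [w bw wmin] := cnf_least (bounded b).
suff [x [x0 nx]] : exists x, x <= 0 /\ ~ dlt (gm b x) w.
  have [||z [zc nz] zmin] := @clo_wellordered _ _ b [set y | clo b y /\ ~ dlt (gm b y) w].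
  - by move=> y [].
  - by exists x; split=> // zx; apply: nx; exact: dlt_eqz.
  exists w, z; split=> //; first by have /cloP[] := zc.
  move=> y yz; apply: contrapT => ny; have : z <= y.
    by apply: zmin; split=> // zy; apply: ny; exact: dlt_eqz.
  by rewrite leNgt yz.
apply: contrapT => /forallNP N.
have {}N x : x <= 0 -> dlt (gm b x) w.
  by move=> x0; apply: contrapT => nx; apply: (N x).
have bE x : x <= 0 -> eqz (gm b x) -> b x = 0.
  by move=> _ [e e0 /(_ 0)]; rewrite oppr_lt0 gmE lexx addr0; apply.
have w0 : 0 <o w.
  apply: cnf_gt0 => w0; move/eqP: b0; apply; apply: gpsP => x.
  have [x0|/coef_pos//] := leP x 0; apply: bE => //; apply/(@dlt0P _ _ A).
  by rewrite -w0; exact: N.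
have [x bx] : exists x, b x != 0.
  apply: contrapT => /forallNP nz; move/eqP: b0; apply; apply: gpsP => x.
  by apply/eqP/negPn/negP; exact: nz.
have [|m bm mmin] := @supp_wellordered _ _ b (supp b) _ (ex_intro _ x bx); first by [].
pose B : set R := [set x | x <= 0 /\ exists2 w', w' <o w & forall y, y <= x -> dle (gm b y) w'].
have m0 := supp_le0 bm.
have hB : has_sup B.
  split; last by exists 0 => y [].
  exists (m - 1); split; first lra; exists 0 => // y ym; apply: eqz_dle.
  exists 1 => // t _; rewrite gmE; case: (leP t 0) => // t0.
  apply/eqP/negPn/negP => bt; have := mmin _ bt; lra.
pose s := sup B; have s0 : s <= 0 by apply: ge_sup => [|y []//]; case: hB.
have [w1 [w1w [e e0 He] sw1]] : exists w1, [/\ w1 <o w,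
    exists2 e, 0 < e & forall y, s - e < y -> y < s -> dle (gm b y) w1 & dle (gm b s) w1].
  have [w1 w1w sw1] : exists2 w1, w1 <o w & dle (gm b s) w1.
    case/dltP: (N s s0) => [zs|[w1 w1w sw1]]; last by exists w1.
    by exists 0 => //; exact: eqz_dle.
  exists w1; split=> //; have [e e0 He] := sw1; exists e => // y ey ys.
  have := He (y - s) ltac:(lra) ltac:(lra); rewrite gm_gm; last lra.
  by rewrite addrC subrK; exact: dltW.
have sB : exists2 w', w' <o w & forall y, y <= s -> dle (gm b y) w'.
  have [p [p0 [w2 w2w Hp]] sp] := sup_adherent e0 hB.
  have max w3 : w1 <=o w3 -> w2 <=o w3 -> forall y, y <= s -> dle (gm b y) w3.
    move=> l1 l2 y; rewrite le_eqVlt => /orP[/eqP->|ys]; first exact: dle_le sw1.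
    have [yp|py] := leP y p; first by apply: dle_le (Hp _ yp).
    apply: dle_le (He y _ ys) => //; exact: lt_trans sp py.
  have [l12|/ltW l21] := leP w1 w2.
    by exists w2 => //; exact: max.
  by exists w1 => //; exact: max.
have [w' w'w Hs] := sB; move: s0; rewrite le_eqVlt => /orP[/eqP s0|s0].
  by move: (wmin w'); rewrite leNgt w'w -s0 => /(_ Hs).
have [d d0 Hd] := support_gap b s.
(* [b] vanishes on the right of [s] up to [q], so the smaller bound persists up to [q]. *)
pose q := Num.min (s + d / 2) 0.
have sq : s < q by rewrite /q lt_min s0 andbT; lra.
have : B q.
  split; first by rewrite /q ge_min lexx orbT.
  exists w' => // y yq; have [ys|sy] := leP y s; first exact: Hs.
  apply: eqz_dle; exists (y - s); first lra.
  move=> t; rewrite opprB => ty; rewrite gmE; case: (leP t 0) => // t0.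
  apply: Hd; first lra.
  have : q <= s + d / 2 by rewrite /q ge_min lexx.
  lra.
move=> /(ub_le_sup hB.2); rewrite -/s; lra.
Qed.

Lemma support0_unit b : b != 0 -> (forall x, x < 0 -> b x = 0) -> b \is a GRing.unit.
Proof.
move=> b0 bx; have bE : b = b 0 *: 1.
  apply: gpsP => x; rewrite coefZ /= /gps_one_fun; case: (ltgtP x 0) => [x0|x0|->].
  - by rewrite mulr0 bx.
  - by rewrite mulr0 coef_pos.
  - by rewrite mulr1.
have nz : b 0 != 0 by apply: contraNneq b0 => e; rewrite bE e scale0r.
apply/asboolP; exists ((b 0)^-1 *: 1).
by rewrite {2}bE coefC_mul scalerA mulVf// scale1r.
Qed.

Definition factor_degrees w b c := exists v v' : cnf A,
  [/\ dle b v, dle c v', v <> 0, v' <> 0 & v + v' = w].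

(** The product of the first germs of maximal degree of [b] and [c] cannot be
    cancelled; hence both occur at [0]. *)
Lemma nonunit_factor_degrees w b c : isdeg (b * c) w ->
  (forall x, x < 0 -> dlt (gm (b * c) x) w) ->
  b \isn't a GRing.unit -> c \isn't a GRing.unit -> factor_degrees w b c.
Proof.
move=> dbc germs nub nuc.
have nzbc : ~ eqz (b * c) by move=> z; apply: dbc.2; exact: dlt_eqz.
have nzb : ~ eqz b by move=> z; apply: nzbc; exact: eqzM.
have nzc : ~ eqz c by move=> z; apply: nzbc; exact: eqzMr.
have b0 : b != 0 by apply/eqP => e; apply: nzb; rewrite e; exact: eqz0.
have c0 : c != 0 by apply/eqP => e; apply: nzc; rewrite e; exact: eqz0.
have [v bv] := isdeg_exists bounded0 nzb; have [v' cv'] := isdeg_exists bounded0 nzc.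
have vw : v + v' = w.
  apply: isdeg_uniq dbc; split; first by apply: dleM; [exact: bv.1|exact: cv'.1].
  exact: (not_dlt_mul_isdeg charK bounded0).
have [wb [zb [zb0 nb maxb ltb]]] := max_degree b0.
have [wc [zc [zc0 nc maxc ltc]]] := max_degree c0.
have z0 : zb + zc <= 0 by rewrite -(addr0 0) lerD.
have [p|F [uF GF FP Feq]] := @gm_mul _ _ b c (zb + zc) [:: zb] z0.
  by rewrite inE => /eqP->; rewrite zb0 andbT; lra.
have zF : zb \in F by apply: GF; rewrite inE.
(* A point [p] other than [zb] lies left of [zb], or its partner lies left of [zc]; in both cases
   its term is low, so the term at [zb] cannot be cancelled. *)
have nlow : ~ dlt (gm (b * c) (zb + zc)) (wb + wc).
  move=> low; apply: (not_dlt_mul charK bounded0 nb nc).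
  have := dlt_subl (dlt_eqz _ Feq) low; rewrite (big_rem _ zF)/=.
  have -> : zb + zc - zb = zc by lra.
  set S := \sum_(_ <- _) _; have lowS : dlt S (wb + wc).
    apply: dlt_sum => p pF _; have [pz|zp|pz] := ltgtP p zb.
    - apply: dltMl; first exact: ltb.
      by apply: maxc; have /andP[? ?] := FP p (mem_rem pF); lra.
    - apply: dltMr; last by apply: ltc; lra.
      by apply: maxb; have /andP[? ?] := FP p (mem_rem pF); lra.
    - by move: pF; rewrite pz mem_rem_uniq// !inE eqxx.
  by move=> /dltB/(_ lowS); rewrite addrK.
have le1 : v <=o wb by apply: isdeg_le bv.2 _; have := maxb 0 (lexx _); rewrite gm0.
have le2 : v' <=o wc by apply: isdeg_le cv'.2 _; have := maxc 0 (lexx _); rewrite gm0.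
have zz : zb + zc = 0.
  apply/eqP; rewrite eq_le z0 leNgt; apply/negP => /germs low; apply: nlow.
  by apply: dlt_le low; rewrite -vw; exact: cnf_leD.
have zb00 : zb = 0 by lra.
have zc00 : zc = 0 by lra.
(* If the degree were [0], all coefficients at negative points would vanish and the series would be
   a nonzero constant, a unit. *)
have nonunit (p : gps R K) (wp vp : cnf A) : p != 0 -> p \isn't a GRing.unit -> isdeg p vp ->
    (forall x, x <= 0 -> dle (gm p x) wp) -> ~ dlt (gm p 0) wp ->
    (forall x, x < 0 -> dlt (gm p x) wp) -> vp <> 0.
  move=> p0 nup pvp mx; rewrite gm0 => np lt vp0;
  move/negP: nup; apply; apply: support0_unit => // x x0.
  have wp0 : wp = 0.
    rewrite -vp0; apply: isdeg_uniq pvp; split=> //.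
    by have := mx 0 (lexx _); rewrite gm0.
  have := lt x x0; rewrite wp0 => /dlt0P[e e0 /(_ 0)].
  by rewrite oppr_lt0 gmE lexx addr0; apply.
exists v, v'; split=> //.
- exact: bv.1.
- exact: cv'.1.
- by apply: nonunit b0 nub bv maxb _ _; rewrite -zb00.
- by apply: nonunit c0 nuc cv' maxc _ _; rewrite -zc00.
Qed.

(** What is retained of the span of [Rset]: degrees of factors instead of reducibility, scalars
    absorbed in the first factors, and everything of degree below [w] neglected. *)
Definition prodspan w b := exists (ps : seq (gps R K * gps R K)) (l : gps R K),
  [/\ b = \sum_(p <- ps) p.1 * p.2 + l, forall p, p \in ps -> factor_degrees w p.1 p.2 &
      dlt l w].

Lemma prodspan_low w b : dlt b w -> prodspan w b.
Proof. by exists [::], b; split=> //; rewrite big_nil add0r. Qed.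

Lemma prodspanD w b c : prodspan w b -> prodspan w c -> prodspan w (b + c).
Proof.
move=> [s [l [-> Hs ll]]] [s' [l' [-> Hs' ll']]]; exists (s ++ s'), (l + l'); split.
- by rewrite big_cat /= addrACA.
- by move=> p; rewrite mem_cat => /orP[/Hs|/Hs'].
- exact: dltD.
Qed.

Lemma prodspanZ w (a : K) b : prodspan w b -> prodspan w (a *: b).
Proof.
move=> [s [l [-> Hs ll]]]; exists [seq (a *: p.1, p.2) | p <- s], (a *: l); split.
- rewrite big_map scalerDr scaler_sumr; congr (_ + _).
  by apply: eq_bigr => p _; rewrite scalerAl.
- move=> _ /mapP[p /Hs[v [v' [pv pv' v0 v'0 vw]]] ->]; exists v, v'; split=> //.
  exact: dleZ.
- exact: dltZ.
Qed.

Lemma prodspanB w b c : prodspan w b -> prodspan w c -> prodspan w (b - c).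
Proof. by move=> hb hc; apply: prodspanD => //; rewrite -scaleN1r; exact: prodspanZ. Qed.

Lemma prodspan_sum w (I : Type) (s : seq I) (P : pred I) (F : I -> gps R K) :
  (forall i, P i -> prodspan w (F i)) -> prodspan w (\sum_(i <- s | P i) F i).
Proof.
move=> H; apply: big_ind => //; last exact: prodspanD.
by apply: prodspan_low; apply: dlt_eqz; exact: eqz0.
Qed.

Lemma prodspan_reducible w b : isdeg b w -> (forall x, x < 0 -> dlt (gm b x) w) ->
  reducible b -> prodspan w b.
Proof.
move=> bw germs [c [d [nc nd bE]]]; exists [:: (c, d)], 0; split.
- by rewrite big_seq1 addr0.
- by move=> p; rewrite inE => /eqP-> /=; apply: nonunit_factor_degrees; rewrite -?bE.
- by apply: dlt_eqz; exact: eqz0.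
Qed.

Section SuccessorStep.
Variable e0 : A.
Hypothesis e0_min : forall a, ~ olt a e0.

(** Here [c] stands for a germ that has dropped below [v']. Either [b * c] is below [w], or it is a
    product for [w], or [c] has degree [0] and is a constant near [0], leaving a multiple of [b]. *)
Lemma prodspan_mul_germ w v v' b c : dle b v -> dlt c v' -> v <> 0 ->
  v + v' = w + om e0 -> exists a : K, prodspan w (b * c - a *: b).
Proof.
move=> bv /dltP cv' v0 vw.
have low0 : dlt (b * c) w -> exists a : K, prodspan w (b * c - a *: b).
  by exists 0; rewrite scale0r subr0; exact: prodspan_low.
case: cv' => [zc|[u uv' cu]]; first by apply: low0; apply: dlt_eqz; exact: eqzMr.
have : v + u <=o w by apply: (lt_add_bot e0_min); rewrite -vw cnf_ltD2l.
rewrite le_eqVlt => /orP[/eqP vuw|lt]; last first.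
  by apply: low0; apply: dle_lt lt _; exact: dleM.
have [u0|u0] := pselect (u = 0); last first.
  exists 0; rewrite scale0r subr0; exists [:: (b, c)], 0; split.
  - by rewrite big_seq1 addr0.
  - by move=> p; rewrite inE => /eqP->; exists v, u.
  - by apply: dlt_eqz; exact: eqz0.
subst u; exists (c 0); apply: prodspan_low; apply: dlt_eqz.
have -> : b * c - c 0 *: b = b * (c - c 0 *: 1) by rewrite mulrBr -scalerAr mulr1.
by apply: eqzMr; exact: dle0P cu.
Qed.

(** The Leibniz rule and [prodspan_mul_germ] reduce the germ of a product to multiples of its two
    factors, so [F], the list of all factors, does not depend on [y]. *)
Lemma prodspan_germs w b : prodspan (w + om e0) b -> exists F : seq (gps R K),
  left_near (fun y => exists a : nat -> K,
    prodspan w (gm b y - \sum_(i < size F) a i *: F`_i)).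
Proof.
move=> [ps [l [-> Hps ll]]]; elim: ps Hps => [|[c d] ps IH] Hps.
  exists [::]; have : dle l w.
    case/dltP: ll => [/eqz_dle//|[u uw lu]].
    by apply: dle_le lu; exact: lt_add_bot uw.
  apply: left_nearW => y _ ly; exists (fun=> 0).
  by rewrite big_nil add0r big_ord0 subr0; exact: prodspan_low.
have [|F nF] := IH; first by move=> p pps; apply: Hps; rewrite inE pps orbT.
have [v [v' [/= cv dv' v0 v'0 vw]]] := Hps (c, d) (mem_head _ _).
exists [:: c, d & F].
have lb : left_near (fun y => dlt (gm (c * d) y - (gm c y * d + c * gm d y)) w).
  apply: (leib _ cv dv') => u u' uv uv'.
  apply: (@lt_le_trans _ (cnf A) (v + u')); first by rewrite cnf_ltD2r.
  by apply: (lt_add_bot e0_min); rewrite -vw cnf_ltD2l.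
apply: left_nearW (left_nearI nF (left_nearI lb (left_nearI cv dv'))).
move=> y _ [[a Ha] [h [cy dy]]].
have [a1 H1] := prodspan_mul_germ cv dy v0 vw.
have [|a2 H2] := prodspan_mul_germ dv' cy v'0 (w := w); first by rewrite addrC.
exists (fun i => match i with 0%N => a1 | 1%N => a2 | i.+2 => a i end).
rewrite !big_ord_recl /= big_cons -addrA gmD.
have := prodspanD (prodspanD (prodspanD Ha H1) H2) (prodspan_low h).
congr prodspan; set S := \sum_(i < _) _; ring.
Qed.
End SuccessorStep.

End Factorization.

(** * Series that are not combinations of products *)

Lemma lin_dep (K : fieldType) N (a : 'I_N.+1 -> 'I_N -> K) :
  exists2 mu : 'I_N.+1 -> K, exists i, mu i != 0 & forall j, \sum_i mu i * a i j = 0.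
Proof.
pose M := \matrix_(i, j) a i j.
have : kermx M != 0.
  rewrite -mxrank_eq0 mxrank_ker subn_eq0 -ltnNge.
  exact: leq_ltn_trans (rank_leq_col M) (ltnSn N).
case/rowV0Pn => u /sub_kermxP uM u0; exists (u 0).
  apply: contrapT => /forallNP nz; move/eqP: u0; apply; apply/rowP => i.
  by rewrite mxE; apply/eqP/negPn/negP; exact: nz.
move=> j; move/rowP/(_ j): uM; rewrite !mxE => {2}<-.
by apply: eq_bigr => i _; rewrite mxE.
Qed.

Lemma left_cofinal_seq (R : realType) (P : R -> Prop) e : 0 < e ->
  (forall d : R, 0 < d -> exists y, [/\ - d < y, y < 0 & P y]) ->
  exists2 y : nat -> R, injective y & forall n, [/\ - e < y n, y n < 0 & P (y n)].
Proof.
move=> e0 H; have /choice[f fP] (d : R) : exists y, 0 < d -> [/\ - d < y, y < 0 & P y].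
  by have [/H[y]|nd] := pselect (0 < d); [exists y|exists 0].
pose y := fix y n := if n is m.+1 then f (- y m) else f e.
have y0 n : [/\ y n < 0, P (y n) & y n < y n.+1].
  have neg : y n < 0 /\ P (y n).
    elim: n => [|n [IH _]]; first by have [] := fP e e0.
    by have [] := fP (- y n) ltac:(lra).
  split; [exact: neg.1|exact: neg.2|].
  by have [] := fP (- y n) ltac:(have := neg.1; lra); rewrite opprK.
have mono m n : (m < n)%N -> y m < y n.
  elim: n => // n IH; rewrite ltnS leq_eqVlt => /orP[/eqP->|/IH h].
    by have [] := y0 n.
  by apply: lt_trans h _; have [] := y0 n.
exists y => [m n ymn|n].
  by case: (ltngtP m n) => // /mono; rewrite ymn ltxx.
have [yn0 Pn _] := y0 n; split=> //; apply: (@lt_le_trans _ _ (y 0%N)).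
  by have [] := fP e e0.
by case: n {yn0 Pn} => // n; apply/ltW/mono.
Qed.

Section Modules.
Variables (R : realType) (K : fieldType) (A : ordnum).
Hypothesis charK : [pchar K] =i pred0.
Hypothesis bounded : forall b : gps R K, exists w : cnf A,
  forall x, x <= 0 -> dle (gm b x) w.
Implicit Types (b c p q v : gps R K) (x y z : R) (w : cnf A).

Let bounded0 b : exists w : cnf A, dle b w.
Proof. by have [w /(_ 0 (lexx _))] := bounded b; rewrite gm0; exists w. Qed.

Lemma dlt_uniform (I : finType) (b : I -> gps R K) w : 0 <o w ->
  (forall i, dlt (b i) w) -> exists2 w', w' <o w & forall i, dle (b i) w'.
Proof.
move=> w0 H; suff [w' w'w Hw'] : exists2 w', w' <o w & forall i, i \in enum I -> dle (b i) w'.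
  by exists w' => // i; apply: Hw'; rewrite mem_enum.
elim: (enum I) => [|i s [u uw IH]]; first by exists 0.
have [v vw bv] : exists2 v, v <o w & dle (b i) v.
  case/dltP: (H i) => [zi|[v vw bv]]; last by exists v.
  by exists 0 => //; exact: eqz_dle.
have [uv|/ltW vu] := leP u v.
  by exists v => // j; rewrite inE => /orP[/eqP->//|/IH]; exact: dle_le.
by exists u => // j; rewrite inE => /orP[/eqP->|/IH//]; exact: dle_le bv.
Qed.

(** * Relations over the ring of germs of degree below [om a1] *)

Section Low.
Variable a1 : A.
Notation low b := (dlt b (om a1)).

Lemma lowM b c : low b -> low c -> low (b * c).
Proof. by apply: dltM_lt => v v'; exact: om_add. Qed.

Lemma low1 : low (1 : gps R K).
Proof. by rewrite -[1]scale1r; apply: dle_lt (om_gt0 a1) _; exact: dle_const. Qed.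

(** Fraction-free Gaussian elimination: low germs form a ring, a domain by [eqz_mul]. *)
Lemma low_elimination N (r : 'I_N.+1 -> 'I_N -> gps R K) : (forall i j, low (r i j)) ->
  exists rho : 'I_N.+1 -> gps R K, [/\ forall i, low (rho i), exists i, ~ eqz (rho i) &
    forall j, eqz (\sum_i rho i * r i j)].
Proof.
elim: N r => [|N IH] r lr.
  exists (fun=> 1); split=> [_||[]//]; first exact: low1.
  by exists ord0; rewrite -[1]scale1r => /eqz_const/eqP; rewrite oner_eq0.
have big2 i0 (F : 'I_N.+2 -> gps R K) : \sum_i F i = F i0 + \sum_(i < N.+1) F (lift i0 i).
  by rewrite (bigD1_ord i0).
pose ext (i0 : 'I_N.+2) (t : gps R K) (f : 'I_N.+1 -> gps R K) (i : 'I_N.+2) := if unlift i0 i is Some j then f j else t.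
have ext0 i0 t f : ext i0 t f i0 = t by rewrite /ext unlift_none.
have extl i0 t f i : ext i0 t f (lift i0 i) = f i by rewrite /ext liftK.
have [z0|/existsNP[i0 nz]] := pselect (forall i, eqz (r i ord0)).
  have [|rho [lrho [i nzi] zrho]] := IH (fun i j => r (lift ord_max i) (lift ord0 j)).
    by move=> i j; exact: lr.
  exists (ext ord_max 0 rho); split.
  - move=> k; case: (unliftP ord_max k) => [j|] ->; rewrite ?extl ?ext0//.
    by apply: dlt_eqz; exact: eqz0.
  - by exists (lift ord_max i); rewrite extl.
  - move=> j; case: (unliftP ord0 j) => [j'|] ->; last first.
      by apply: eqz_sum => i' _; exact: eqzMr.
    rewrite (big2 ord_max) ext0 mul0r add0r; congr eqz: (zrho j').
    by apply: eq_bigr => k _; rewrite extl.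
set t := r i0 ord0 in nz.
have [|rho [lrho [i nzi] zrho]] := IH (fun i j =>
    t * r (lift i0 i) (lift ord0 j) - r (lift i0 i) ord0 * r i0 (lift ord0 j)).
  by move=> i j; apply: dltB; apply: lowM; exact: lr.
(* The multiplier of the pivot row cancels the first column; the other multipliers are scaled by the
   pivot [t]. *)
exists (ext i0 (- \sum_i rho i * r (lift i0 i) ord0) (fun i => t * rho i)); split.
- move=> k; case: (unliftP i0 k) => [j|] ->; rewrite ?extl ?ext0.
    by apply: lowM; [exact: lr|exact: lrho].
  by apply: dltN; apply: dlt_sum => j _ _; apply: lowM; [exact: lrho|exact: lr].
- exists (lift i0 i); rewrite extl => /(eqz_mul charK bounded0)[]//.
- move=> j; case: (unliftP ord0 j) => [j'|] ->; rewrite (big2 i0) ext0.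
    congr eqz: (zrho j'); rewrite mulNr mulr_suml -sumrN -big_split /=.
    by apply: eq_bigr => k _; rewrite extl; ring.
  congr eqz: (eqz0 R K); rewrite mulNr mulr_suml -sumrN -big_split /=.
  by rewrite big1// => k _; rewrite extl -/t; ring.
Qed.

(** Taking germs of the coefficients [rho i] lowers them to constants without
    affecting the relation modulo [low]. *)
Lemma scalar_relation n (rho v : 'I_n -> gps R K) :
  (forall i, low (rho i)) -> (forall i, dle (v i) (om a1)) ->
  (exists i, ~ eqz (rho i)) -> low (\sum_i rho i * v i) ->
  exists2 mu : 'I_n -> K, exists i, mu i != 0 & low (\sum_i mu i *: v i).
Proof.
move=> /(dlt_uniform (om_gt0 a1))[w wa] + hv; elim/cnf_wf: w wa rho => w IH wa rho rw [i nz] lsum.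
have [r0|/existsNP[i0 nr0]] := pselect (forall i, dle (rho i) (0 : cnf A)).
  exists (fun i => rho i 0).
    exists i; apply/eqP => e; apply: nz; have := dle0P (r0 i).
    by rewrite e scale0r subr0.
  suff e : eqz (\sum_i rho i 0 *: v i - \sum_i rho i * v i) by exact: dlt_eqzB e lsum.
  rewrite -sumrB; apply: eqz_sum => j _.
  have -> : rho j 0 *: v j - rho j * v j = - ((rho j - rho j 0 *: 1) * v j).
    by rewrite mulrBl coefC_mul opprB.
  by apply: eqzN; apply: eqzM; exact: dle0P.
have lb : left_near (fun y => forall i, dlt (gm (rho i * v i) y -
    (gm (rho i) y * v i + rho i * gm (v i) y)) (om a1)).
  apply: left_near_fin => j; apply: (leib _ (rw j) (hv j)) => u u' uw ua.
  by apply: om_add ua; exact: lt_trans uw wa.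
have [e e0 He] := left_nearI lb (left_nearI (left_near_fin rw)
  (left_nearI (left_near_fin hv) (dltW lsum))).
(* At [y] all coefficients drop below [w], yet one keeps a nonzero germ. The terms
   [rho i * gm (v i) y] are low, so the germ of the relation is a relation with coefficients
   [gm (rho i) y]. *)
have [y [ey y0 ny]] := not_dle_germ nr0 e0; have [h1 [h2 [h3 h4]]] := He y ey y0.
have w0 : 0 <o w.
  by apply: cnf_gt0 => w0; apply: nr0; rewrite -w0; exact: rw.
have [w' w'w rw'] := dlt_uniform w0 h2.
apply: (IH w' w'w (lt_trans w'w wa) (fun i => gm (rho i) y)) => //.
  by exists i0 => z; apply: ny; exact: dlt_eqz.
apply: dlt_subl _ h4; rewrite gm_sum -sumrB; apply: dlt_sum => j _ _.
apply: (@dlt_sub _ _ _ _ (rho j * gm (v j) y)).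
  by move: (h1 j); congr dlt; ring.
by apply: lowM => //; apply: dle_lt (rw j).
Qed.

Definition in_module (G : seq (gps R K)) p := exists2 r : nat -> gps R K,
  (forall i, low (r i)) & low (p - \sum_(i < size G) r i * G`_i).

(** In the Leibniz rule the germs of the factors are low and serve as coefficients; the generators
    are the factors themselves, the same for all [y]. *)
Lemma prods_in_module w (ps : seq (gps R K * gps R K)) : w = om a1 ->
  (forall t, t \in ps -> dle t.1 w /\ dle t.2 w) ->
  exists2 G, (forall g, g \in G -> dle g w) &
    left_near (fun y => in_module G (gm (\sum_(t <- ps) t.1 * t.2) y)).
Proof.
move=> wE; subst w; elim: ps => [|[c d] ps IH] H.
  exists [::] => //; apply: left_nearT => y _; exists (fun=> 0).
    by move=> _; apply: dlt_eqz; exact: eqz0.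
  rewrite big_nil big_ord0 subr0; apply: dlt_eqz.
  suff -> : gm (0 : gps R K) y = 0 by exact: eqz0.
  by apply: gpsP => z; rewrite gmE; case: ifP.
have [|G HG nG] := IH; first by move=> p pps; apply: H; rewrite inE pps orbT.
have [/= cw dw] := H (c, d) (mem_head _ _).
exists [:: d, c & G].
  by move=> g; rewrite !inE => /orP[/eqP->//|/orP[/eqP->//|/HG]].
have lb : left_near (fun y => low (gm (c * d) y - (gm c y * d + c * gm d y))).
  by apply: (leib _ cw dw) => u u'; exact: om_add.
apply: left_nearW (left_nearI nG (left_nearI lb (left_nearI cw dw))).
move=> y _ [[r lr h1] [h2 [cy dy]]].
exists (fun i => match i with 0%N => gm c y | 1%N => gm d y | i.+2 => r i end).
  by move=> [|[|i]].
rewrite !big_ord_recl big_cons gmD /=.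
have := dltD h1 h2; congr dlt; set S := \sum_(_ < _) _; ring.
Qed.
End Low.

Lemma not_dlt_clo v x w : ~ dlt (gm v x) w -> clo v x.
Proof. by move=> nv zv; apply: nv; exact: dlt_eqz. Qed.

(** Near [0], the germs of [v] at distinct points have disjoint supports. *)
Definition scattered v := forall x x' y, clo v x -> clo v x' -> y < 0 ->
  clo v (x + y) -> clo v (x' + y) -> x = x'.

(** At each [y < 0] at most one of the germs has a nonzero coefficient, so the support of the germ
    at [z i0] lies in that of the sum. *)
Lemma scattered_independent v w n (z : 'I_n -> R) (mu : 'I_n -> K) i0 :
  scattered v -> injective z -> (forall i, clo v (z i)) -> 0 <o w -> mu i0 != 0 ->
  dlt (\sum_i mu i *: gm v (z i)) w -> dlt (gm v (z i0)) w.
Proof.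
move=> sv zinj cz w0 mu0; apply: dlt_support => //; apply: left_nearT => y y0.
rewrite gmE (ltW y0) => sum0; apply/eqP/negPn/negP => vy.
have sumE (s : seq 'I_n) (f : 'I_n -> gps R K) : (\sum_(p <- s) f p) y = \sum_(p <- s) f p y.
  by elim: s => [|a s IH]; rewrite ?big_nil// !big_cons coefD IH.
move: sum0; rewrite sumE (bigD1 i0)// big1 ?addr0.
  rewrite coefZ gmE (ltW y0) => /eqP.
  by rewrite [X in X == _](addr0 (mu i0 * v (z i0 + y))) mulf_eq0 (negPf mu0) (negPf vy).
move=> i ii0; rewrite coefZ gmE (ltW y0).
have [->|vi] := eqVneq (v (z i + y)) 0; first by rewrite mulr0.
exfalso; move/eqP: ii0; apply; apply: zinj.
by apply: sv y0 _ _; rewrite //; exact: clo_supp.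
Qed.

(** * Combinations of scattered germs outside the span of products *)

Section NonMembership.
Variables (a1 a2 e0 : A).
Hypotheses (a12 : ~ olt a1 a2) (e0_min : forall a, ~ olt a e0).
Let deg k : cnf A := om a1 + om a2 + om e0 *+ k.

(** At most one of the points [x i + y] lies in the closure of the support, so a further germ of the
    combination isolates a single germ of [v]. *)
Lemma scattered_germ v n (x : 'I_n -> R) (la : 'I_n -> K) i0 w y :
  scattered v -> injective x -> (forall i, clo v (x i)) -> y < 0 ->
  ~ dlt (gm (gm v (x i0)) y) w ->
  eqz (gm (\sum_i la i *: gm v (x i)) y - la i0 *: gm v (x i0 + y)).
Proof.
move=> sv xinj cx y0; rewrite gm_gm ?ltW// => /not_dlt_clo cy.
rewrite gm_sum (bigD1 i0)//= gmZ gm_gm ?ltW// addrAC subrr add0r.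
apply: eqz_sum => i ii0; rewrite gmZ gm_gm ?ltW//; apply: eqzZ.
apply: contrapT => ci; move/eqP: ii0; apply; apply: xinj; exact: sv y0 _ _.
Qed.

Lemma not_prodspan_base v n (x : 'I_n -> R) (la : 'I_n -> K) i0 :
  scattered v -> injective x -> (forall i, x i <= 0) ->
  (forall i, clo v (x i)) -> ~ dlt (gm v (x i0)) (om a1 + om a2) -> la i0 != 0 ->
  ~ prodspan (om a1 + om a2) (\sum_i la i *: gm v (x i)).
Proof.
move=> sv xinj x0 cx nx la0 [ps [l [sE Hps ll]]].
have [|G HG nG] := @prods_in_module a1 _ ps erefl.
  move=> p /Hps[u [u' [pu pu' u0 u'0 uE]]]; split.
    by apply: dle_le pu; exact: summand_le_om a12 uE u'0.
  by apply: dle_le pu'; apply: (summand_le_om a12 _ u0); rewrite addrC.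
have [e e0' He] := nG.
(* The remainder [l] is to be low at these points while the germ of [v] has degree exactly [om a1];
   [descent] provides both. *)
have [y yinj yP] : exists2 y : nat -> R, injective y & forall n, [/\ - e < y n, y n < 0 &
    dlt (gm l (y n)) (om a1) /\ isdeg (gm (gm v (x i0)) (y n)) (om a1)].
  apply: (@left_cofinal_seq R (fun y => dlt (gm l y) (om a1) /\
    isdeg (gm (gm v (x i0)) y) (om a1)) e e0') => d d0.
  have [y [dy y0 ly vy]] := descent bounded0 (hi_le a12 (@hi_om _ a1)) (lexx _) ll nx d0.
  exists y; split=> //; rewrite lt_neqAle y0 andbT; apply/eqP => y00; apply: nx.
  apply: (@dle_lt _ _ _ _ (om a1)); first by rewrite -{1}[om a1]addr0 cnf_ltD2l om_gt0.
  by have := vy.1; rewrite y00 gm0.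
pose z (j : 'I_(size G).+1) := x i0 + y j.
have zinj : injective z by move=> i j /addrI/yinj/val_inj.
have nz j : isdeg (gm v (z j)) (om a1).
  by have [_ yj0 [_]] := yP j; rewrite gm_gm ?ltW.
have /choice[r rP] (j : 'I_(size G).+1) : exists r : nat -> gps R K,
    (forall i, dlt (r i) (om a1)) /\
    dlt (gm v (z j) - \sum_(i < size G) r i * G`_i) (om a1).
  have [ey y0 [ly vy]] := yP j; have [r lr h] := He _ ey y0.
  exists (fun i => (la i0)^-1 *: r i); split; first by move=> i; exact: dltZ.
  have E := @scattered_germ v n x la i0 (om a1) (y j) sv xinj cx y0 vy.2.
  have {}h := dltD h ly; have := dltZ (la i0)^-1 (dltB h (dlt_eqz _ E)).
  rewrite sE gmD -/(z j); congr dlt.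
  set S := gm (\sum_(_ <- _) _) _; set T := gm l _; set U := \sum_(_ < _) _.
  have -> : S - U + T - (S + T - la i0 *: gm v (z j)) = la i0 *: gm v (z j) - U by ring.
  rewrite scalerBr scalerA mulVf// scale1r; congr (_ - _).
  by rewrite /U scaler_sumr; apply: eq_bigr => i _; rewrite scalerAl.
(* There is one germ more than generators, so a relation over the low germs eliminates [G];
   [scalar_relation] makes its coefficients scalars, against [scattered_independent]. *)
have [rho [lrho nzrho zrho]] := @low_elimination a1 (size G) (fun j i => r j i)
  (fun j i => (rP j).1 i).
have [|mu [j0 mu0] lmu] := @scalar_relation a1 _ rho (fun j => gm v (z j)) lrho
  (fun j => (nz j).1) nzrho.
  have -> : \sum_j rho j * gm v (z j) =
      \sum_j rho j * (gm v (z j) - \sum_(i < size G) r j i * G`_i) +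
      \sum_(i < size G) (\sum_j rho j * r j i) * G`_i.
    rewrite (eq_bigr (fun i : 'I_(size G) => \sum_j rho j * (r j i * G`_i))); last first.
      by move=> i _; rewrite mulr_suml; apply: eq_bigr => j _; rewrite mulrA.
    rewrite exchange_big -big_split /=; apply: eq_bigr => j _.
    by rewrite -mulr_sumr -mulrDr subrK.
  apply: dltD; first by apply: dlt_sum => j _ _; apply: lowM => //; exact: (rP j).2.
  by apply: dlt_eqz; apply: eqz_sum => i _; exact: eqzM.
apply: (nz j0).2; apply: scattered_independent sv zinj _ (om_gt0 _) mu0 lmu.
by move=> j; exact: not_dlt_clo (nz j).2.
Qed.

(** Combinations at several points make the induction close: at [size F + 1] points a linear
    dependence removes [F] and leaves a combination of germs of [v] for [k]. *)
Lemma not_prodspan k v n (x : 'I_n -> R) (la : 'I_n -> K) i0 :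
  scattered v -> injective x -> (forall i, x i <= 0) ->
  (forall i, clo v (x i)) -> ~ dlt (gm v (x i0)) (deg k) -> la i0 != 0 ->
  ~ prodspan (deg k) (\sum_i la i *: gm v (x i)).
Proof.
elim: k n x la i0 => [|k IH] n x la i0 sv xinj x0 cx nx la0.
  by rewrite /deg mulr0n addr0 in nx *; exact: not_prodspan_base nx la0.
have degE : deg k.+1 = deg k + om e0 by rewrite /deg mulrSr addrA.
rewrite degE => /(prodspan_germs e0_min)[F [e ep He]].
have [y yinj yP] : exists2 y : nat -> R, injective y & forall n, [/\ - e < y n, y n < 0 &
    ~ dlt (gm (gm v (x i0)) (y n)) (deg k)].
  apply: (@left_cofinal_seq R (fun y => ~ dlt (gm (gm v (x i0)) y) (deg k)) e ep) => d d0.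
  apply: not_dlt_germ nx _ d0.
  by rewrite degE -{1}[deg k]addr0 cnf_ltD2l om_gt0.
pose z (j : 'I_(size F).+1) := x i0 + y j.
have zinj : injective z by move=> i j /addrI/yinj/val_inj.
have nz j : ~ dlt (gm v (z j)) (deg k).
  by have [_ yj0] := yP j; rewrite gm_gm ?ltW.
have /choice[a aP] (j : 'I_(size F).+1) : exists a : nat -> K,
    prodspan (deg k) (la i0 *: gm v (z j) - \sum_(i < size F) a i *: F`_i).
  have [ey y0 ny] := yP j; have [a Ha] := He _ ey y0; exists a.
  have E := @scattered_germ v n x la i0 (deg k) (y j) sv xinj cx y0 ny.
  have := prodspanB Ha (prodspan_low (dlt_eqz (deg k) E)); congr prodspan.
  set S := gm (\sum_(_ < _) _) _; set U := \sum_(_ < _) _; rewrite -/(z j); ring.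
have [mu [j0 mu0] mua] := lin_dep (fun j (i : 'I_(size F)) => a j i).
apply: (IH _ z (fun j => mu j * la i0) j0 sv zinj) => //.
- by move=> j; have [_ yj0 _] := yP j; rewrite -(addr0 0) lerD// ltW.
- by move=> j; exact: not_dlt_clo (nz j).
- by rewrite mulf_neq0.
have := prodspan_sum (P := xpredT) (index_enum _) (fun j _ => prodspanZ (mu j) (aP j)).
congr prodspan; rewrite (eq_bigr (fun j => (mu j * la i0) *: gm v (z j) -
    \sum_(i < size F) (mu j * a j i) *: F`_i)); last first.
  move=> j _; rewrite scalerBr scalerA; congr (_ - _).
  by rewrite scaler_sumr; apply: eq_bigr => i _; rewrite scalerA.
rewrite sumrB exchange_big /= [X in _ - X]big1 ?subr0// => i _.
by rewrite -scaler_suml mua scale0r.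
Qed.
End NonMembership.

End Modules.

(** * Ordinals as degrees *)

(** The ordered sum, along a well-ordering of [set R], of all well-ordered
    subsets of [R]: its Cantor normal forms exceed every degree of a germ. *)
Section Universal.
Variable R : realType.

Let wo := sval (@wochoice.well_ordering_principle (set R)).
Let wo_min (S : set (set R)) : S !=set0 -> exists2 X, S X & forall Y, S Y -> wo X Y.
Proof.
move=> [X SX]; have [|Z [[SZ minZ] _]] := svalP (@wochoice.well_ordering_principle (set R)) (fun X => `[< S X >]).
  by exists X; apply/asboolP.
exists Z; first exact/asboolP.
by move=> Y SY; apply: minZ; apply/asboolP.
Qed.

Let wo_total X Y : wo X Y \/ wo Y X.
Proof.
have [|Z [] -> H] := @wo_min [set Z | Z = X \/ Z = Y]; first by exists X; left.
  by left; apply: H; right.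
by right; apply: H; left.
Qed.

Let wo_anti X Y : wo X Y -> wo Y X -> X = Y.
Proof.
move=> XY YX; have refl Z : wo Z Z by case: (wo_total Z Z).
have [|Z [_ uZ]] := svalP (@wochoice.well_ordering_principle (set R)) (fun Z => `[< Z = X \/ Z = Y >]).
  by exists X; apply/asboolP; left.
have minP W : W = X \/ W = Y -> Z = W.
  move=> H; apply: uZ; split; first exact/asboolP.
  by move=> V /asboolP[->|->]; case: H => ->.
by rewrite -(minP X (or_introl erefl)) (minP Y (or_intror erefl)).
Qed.

Definition univ_car := {p : set R * R | wellordered p.1 /\ p.1 p.2}.
Definition univ_lt (p q : univ_car) := let: (X, x) := sval p in let: (Y, y) := sval q in
  (X <> Y /\ wo X Y) \/ (X = Y /\ x < y).

Lemma univ_lt_wf : well_founded univ_lt.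
Proof.
move=> p0; apply: contrapT => np0.
have [|X [p [np pX]] Xmin] := @wo_min [set X | exists p : univ_car, ~ Acc univ_lt p /\ (sval p).1 = X].
  by exists (sval p0).1, p0.
have [woX _] := svalP p; rewrite pX in woX.
have [||x [q [nq qX qx]] xmin] := woX [set x | exists q : univ_car,
    [/\ ~ Acc univ_lt q, (sval q).1 = X & (sval q).2 = x]].
- by move=> _ [q [_ qX <-]]; rewrite -qX; case: (svalP q).
- by exists (sval p).2, p.
apply: nq; constructor => r rq; apply: contrapT => nr; move: rq; rewrite /univ_lt.
case er : (sval r) => [Y y]; case eq : (sval q) => [Z z].
rewrite eq /= in qX qx; subst Z z => -[[YX wYX]|[YX yx]].
  by apply: YX; apply: wo_anti => //; apply: Xmin; exists r; rewrite er.
have : x <= y by apply: xmin; exists r; rewrite er.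
by rewrite leNgt yx.
Qed.

Lemma univ_lt_trans p q r : univ_lt p q -> univ_lt q r -> univ_lt p r.
Proof.
rewrite /univ_lt; case: (sval p) (sval q) (sval r) => [X x] [Y y] [Z z].
move=> [[nXY XY]|[<- xy]] [[nYZ YZ]|[<- yz]].
- left; have nXZ : X <> Z by move=> XZ; subst Z; apply: nXY; exact: wo_anti.
  split=> //; have [|M [[]|] -> H] := @wo_min [set M | (M = X \/ M = Y) \/ M = Z].
  + by exists X; left; left.
  + by apply: H; right.
  + by case: nXY; apply: wo_anti => //; apply: H; left; left.
  + by case: nYZ; apply: wo_anti => //; apply: H; left; right.
- by left.
- by left.
- by right; split=> //; exact: lt_trans yz.
Qed.

Lemma univ_lt_total p q : [\/ univ_lt p q, p = q | univ_lt q p].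
Proof.
rewrite /univ_lt; have [e|ne] := pselect (sval p = sval q).
  constructor 2; case: p q e => [p hp] [q hq] /= e; subst q.
  by congr exist; exact: Prop_irrelevance.
case: (sval p) (sval q) ne => [X x] [Y y] ne.
have [e|nXY] := pselect (X = Y).
  subst Y; case: (ltgtP x y) => xy.
  - by constructor 1; right.
  - by constructor 3; right.
  - by case: ne; rewrite xy.
case: (wo_total X Y) => XY; [constructor 1|constructor 3]; left; split=> // E.
by apply: nXY.
Qed.

Definition univ := OrdNum univ_lt_wf univ_lt_trans univ_lt_total.
End Universal.

(** The closure of the support together with [0] is one of the summands of [univ R]; the degree at
    one of its points is at most [omega] to the power of its image in [A], as a least counterexample
    shows. *)
Lemma univ_bounded (R : realType) (K : fieldType) (A : ordnum) (j : univ R -> A) :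
  (forall p q, olt p q -> olt (j p) (j q)) ->
  forall b : gps R K, exists w : cnf A, forall x, x <= 0 -> dle (gm b x) w.
Proof.
move=> jmono b; pose X := clo b `|` [set 0].
have woX : wellordered X.
  by apply: wellordered_setU; [exact: clo_wellordered|exact: wellordered_set1].
pose f x : cnf A := if pselect (X x) is left h then
  om (j (exist (fun p : set R * R => wellordered p.1 /\ p.1 p.2) (X, x) (conj woX h))) else 0.
have fmono x y : X x -> X y -> x < y -> f x <o f y.
  move=> Xx Xy xy; rewrite /f; case: pselect => // hx; case: pselect => // hy.
  by apply: om_lt; apply: jmono; right.
have fP x : X x -> dle (gm b x) (f x).
  move=> Xx; apply: contrapT => nx.
  have [||z [Xz nz] zmin] := woX [set z | X z /\ ~ dle (gm b z) (f z)].
  - by move=> z [].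
  - by exists x.
  apply: nz; apply: left_nearT => y y0; rewrite gm_gm ?ltW//.
  have zy : z + y < z by lra.
  have [|cy] := pselect (eqz (gm b (z + y))); first exact: dlt_eqz.
  have Xzy : X (z + y) by left.
  apply: dle_lt (fmono _ _ Xzy Xz zy) _; apply: contrapT => n.
  have : z <= z + y by apply: zmin.
  by rewrite leNgt zy.
exists (f 0) => x x0; have [|cx] := pselect (eqz (gm b x)); first exact: eqz_dle.
have Xx : X x by left.
have X0 : X 0 by right.
move: x0; rewrite le_eqVlt => /orP[/eqP->|x0]; first exact: fP.
by apply: dle_le (fP _ Xx); apply/ltW/fmono.
Qed.

(** This says that [w] is the ordinal [alpha], written as a Cantor normal form with exponents in
    [A]. *)
Definition degrees_below (alpha A : ordnum) (w : cnf A) (iota : alpha -> cnf A) :=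
  (forall x y, olt x y -> iota x <o iota y) /\
  forall v, v <o w <-> exists x, iota x = v.

(** * The degree of a series of order type [omega ^ alpha] *)

Section Rank.
Variables (R : realType) (K : fieldType) (A alpha : ordnum).
Variables (w : cnf A) (iota : alpha -> cnf A).
Hypotheses (w_gt0 : 0 <o w) (iotaP : degrees_below w iota).
Variables (b : gps R K) (phi : cnf alpha -> R).
Hypotheses (phi_mono : forall f g, f <o g -> phi f < phi g)
  (phi_supp : forall x, b x != 0 <-> exists f, phi f = x)
  (phi_lt0 : forall f, phi f < 0)
  (phi_sup : forall e : R, 0 < e -> exists f, - e < phi f).
Implicit Types (f g h : cnf alpha) (a : alpha) (x y : R).

Let phi_lt f g : phi f < phi g -> f <o g.
Proof.
move=> lt; rewrite ltNge le_eqVlt; apply/negP => /orP[/eqP e|/phi_mono/(lt_trans lt)].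
  by rewrite e ltxx in lt.
by rewrite ltxx.
Qed.

Let phi_le f g : f <=o g -> phi f <= phi g.
Proof. by rewrite le_eqVlt => /orP[/eqP->//|/phi_mono/ltW]. Qed.

Let iota_lt a a' : iota a <o iota a' -> olt a a'.
Proof.
move=> lt; case: (olt_total a a') => [//|e|/iotaP.1/(lt_trans lt)].
  by rewrite e ltxx in lt.
by rewrite ltxx.
Qed.

Let iota_top a : iota a <o w.
Proof. by apply/iotaP.2; exists a. Qed.

Let phi_first x f : x <= phi f -> exists2 h, h <=o f & forall g, phi g < x <-> g <o h.
Proof.
move=> xf; have [h xh hmin] := @cnf_least _ (fun g => x <= phi g) (ex_intro _ f xf).
exists h; first exact: hmin.
move=> g; split=> [gx|gh]; first by apply: phi_lt; exact: lt_le_trans gx xh.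
by rewrite ltNge; apply/negP => /hmin; rewrite leNgt gh.
Qed.

(** The support below [x] has order type [f], whose least exponent is [a]. For points between
    [phi f0] and [x] the type is [f0 + d] with [0 < d < omega ^ a], so its least exponent is below
    [a]. *)
Lemma rank_le a x f f0 : (forall g, phi g < x <-> g <o f) -> f = f0 + om a -> hi a f0 ->
  dle (gm b x) (iota a).
Proof.
elim: (olt_wf a) x f f0 => {}a _ IH x f f0 xf fE hf0.
have f0f : f0 <o f by rewrite fE -{1}[f0]addr0 cnf_ltD2l om_gt0.
have f0x : phi f0 < x by apply/xf.
(* If the support has a gap just below [x], the germs at nearby points vanish. *)
have [[y0 [y00 Hy0]]|N] := pselect (exists y0, y0 < 0 /\ forall g, phi g < x + y0 <-> g <o f).
  exists (- y0); first lra; move=> y; rewrite opprK => y0y yn; apply: dlt_eqz.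
  exists (y - y0); first lra; move=> z zy; rewrite gm_gm; last exact: ltW.
  rewrite gmE; case: (leP z 0) => // z0; apply/eqP/negPn/negP => /phi_supp[g gE].
  have : phi g < x by rewrite gE; lra.
  by move/xf/Hy0; rewrite gE; lra.
exists (x - phi f0); first lra; move=> y yf y0; rewrite gm_gm ?ltW//.
have [|h hf hP] := @phi_first (x + y) f.
  have : ~ phi f < x by move/xf; rewrite ltxx.
  by move/negP; rewrite -leNgt; lra.
have f0h : f0 <o h by apply/hP; lra.
have {}hf : h <o f.
  rewrite lt_neqAle hf andbT; apply/eqP => e; apply: N; exists y; split=> //.
  by rewrite -e.
rewrite fE in hf; have [d da hE] := le_hi_add hf0 (lexx _) (ltW f0h) hf.
have d0 : d <> 0 by move=> d0; rewrite hE d0 addr0 ltxx in f0h.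
have [a' [d' [dE hd']]] := cnf_chop d0.
have a'a : olt a' a.
  apply: om_ltP; apply: le_lt_trans da; by rewrite dE addrC cnf_leDl.
apply: dle_lt (iotaP.1 _ _ a'a) _; apply: (IH a' a'a (x + y) h (f0 + d')) => //.
  by rewrite -addrA -dE.
apply: hiD hd'; apply: hi_le hf0 => aa'; exact: olt_irr (olt_trans aa' a'a).
Qed.

Lemma rank_lt x : x < 0 -> dlt (gm b x) w.
Proof.
move=> x0; have [f xf] := phi_sup (e := - x) ltac:(lra); rewrite opprK in xf.
have [h _ hP] := phi_first (ltW xf).
have [h0|/cnf_chop[a [h' [hE hh']]]] := pselect (h = 0).
  apply: dle_lt w_gt0 _; apply: left_nearT => y y0; apply: dlt_eqz.
  exists (- y); first lra; move=> z; rewrite opprK => yz; rewrite gm_gm ?ltW// gmE.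
  case: (leP z 0) => // z0; apply/eqP/negPn/negP => /phi_supp[g gE].
  have /hP : phi g < x by rewrite gE; lra.
  by rewrite h0 cnf_lt0.
by apply: dle_lt (iota_top a) _; exact: rank_le hP hE hh'.
Qed.

(** The least multiple of [omega ^ a] above [g]. *)
Let nxt g a : cnf alpha := cnf_high a g + om a.

Let nxt_gt g a : g <o nxt g a.
Proof. by rewrite {1}(cnf_high_low a g) cnf_ltD2l cnf_low_lt. Qed.

Let nxt_lt g a a' h : olt a a' -> hi a' h -> g <o h -> nxt g a <o h.
Proof.
move=> aa' hh gh; apply: hi_absorb hh _ (om_lt aa').
by apply: le_lt_trans gh; rewrite {2}(cnf_high_low a g) cnf_leDl.
Qed.

(** If [iota a] is [0], [x] is [phi g]; otherwise it is the supremum of the points with index below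
    [nxt g a]. Multiples of [omega ^ a'] with [a' < a] are cofinal there, so germs not below
    [iota a'] occur arbitrarily close to [x]. *)
Lemma rank_ge a g : exists x, [/\ phi g <= x, x <= phi (nxt g a) & ~ dlt (gm b x) (iota a)].
Proof.
elim: (olt_wf a) g => {}a _ IH g.
have [i0|/cnf_gt0 i0] := pselect (iota a = 0).
  exists (phi g); rewrite lexx; split=> //; first exact/phi_le/ltW/nxt_gt.
  rewrite i0 => /dlt0P[e e0 /(_ 0)]; rewrite oppr_lt0 gmE lexx addr0 => /(_ e0)/eqP.
  by apply/negP/phi_supp; exists g.
have [a0 a0i] : exists a0, iota a0 = 0 by apply/iotaP.2.
have a0a : olt a0 a by apply: iota_lt; rewrite a0i.
set h := nxt g a; have hh : hi a h by apply: hiD; [exact: hi_high|exact: hi_om].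
pose S : set R := [set phi f | f in [set f | f <o h]].
have hS : has_sup S.
  split; first by exists (phi g), g => //; exact: nxt_gt.
  by exists (phi h) => _ [f fh <-]; apply/ltW/phi_mono.
pose x := sup S.
have ubx f : f <o h -> phi f <= x by move=> fh; apply: ub_le_sup; [case: hS|exists f].
have adh e : 0 < e -> exists2 f, f <o h & x - e < phi f.
  by move=> e0; have [_ [f fh <-] xf] := sup_adherent e0 hS; exists f.
exists x; split.
- by apply: ubx; exact: nxt_gt.
- by apply: ge_sup => [|_ [f fh <-]]; [case: hS|apply/ltW/phi_mono].
case/dltP => [[e e0 He]|[v va [e e0 He]]].
  have [f fh xf] := adh e e0; have fx := ubx f fh.
  have := He (phi f - x) ltac:(lra); rewrite gmE subr_le0 fx addrC subrK => /eqP.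
  by apply/negP/phi_supp; exists f.
have [a' a'v] : exists a', iota a' = v by apply/iotaP.2; exact: lt_trans va (iota_top a).
have a'a : olt a' a by apply: iota_lt; rewrite a'v.
have [f fh xf] := adh e e0; have [z [fz zn nz]] := IH a' a'a f.
(* Applying [nxt] twice stays below [h], which makes [z] strictly smaller than [x]. *)
have n1 := nxt_lt a'a hh fh; have n2 := nxt_lt a'a hh n1.
have zx : z < x.
  by apply: le_lt_trans zn _; apply: lt_le_trans (ubx _ n2); apply/phi_mono/nxt_gt.
apply: nz; rewrite a'v; have := He (z - x) ltac:(lra) ltac:(lra).
by rewrite gm_gm ?subr_le0 1?ltW// addrC subrK.
Qed.

Lemma rank_isdeg : isdeg b w.
Proof.
split; first by apply: left_nearT; exact: rank_lt.
case/dltP => [[e e0 He]|[v vw [e e0 He]]]; have [f ef] := phi_sup e0.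
  by have /eqP := He _ ef; apply/negP/phi_supp; exists f.
have [a av] : exists a, iota a = v by apply/iotaP.2.
have [z [fz zn nz]] := rank_ge a f; apply: nz; rewrite av.
by apply: He; [exact: lt_le_trans ef fz|exact: le_lt_trans zn (phi_lt0 _)].
Qed.
End Rank.

Lemma oiso_inv (A B : ordnum) : oiso A B -> exists g : B -> A,
  (forall x y, olt x y -> olt (g x) (g y)) /\ forall a, exists x, g x = a.
Proof.
move=> [f [g gf fg] fmono]; exists g; split=> [x y xy|a]; last by exists (f a).
by apply/fmono; rewrite !fg.
Qed.

Section PsetDegree.
Variables (R : realType) (K : fieldType) (A alpha : ordnum).
Variables (w : cnf A) (iota : alpha -> cnf A).
Hypotheses (w_gt0 : 0 <o w) (iotaP : degrees_below w iota).

Lemma Pset_degree (b : gps R K) : Pset R K alpha b ->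
  isdeg b w /\ forall x, x < 0 -> dlt (gm b x) w.
Proof.
move=> [/oiso_inv[g [gmono gsurj]] supb].
pose phi (f : cnf alpha) : R := sval (g f).
have mono f f' : f <o f' -> phi f < phi f'.
  by move=> /asboolP; exact: gmono.
have psupp x : b x != 0 <-> exists f, phi f = x.
  split=> [bx|[f <-]]; last exact: (svalP (g f : {x : R | supp b x})).
  by have [f fE] := gsurj (exist _ x bx); exists f; rewrite /phi fE.
have [a0 _] : exists a, iota a = 0 by apply/iotaP.2.
have hs : has_sup (supp b).
  split; first by exists (phi 0); apply/psupp; exists 0.
  by exists 0 => x /supp_le0.
(* The order type has no last element, so the supremum [0] is not attained. *)
have lt0 f : phi f < 0.
  apply: lt_le_trans (mono f (f + om a0) _) _.
    by rewrite -{1}[f]addr0 cnf_ltD2l om_gt0.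
  by apply: (@supp_le0 _ _ b); apply/psupp; eexists.
have cof e : 0 < e -> exists f, - e < phi f.
  move=> e0; have [x bx xe] := sup_adherent e0 hs; have /psupp[f fE] := bx.
  by exists f; rewrite fE; move: xe; rewrite supb sub0r.
split; first exact: (@rank_isdeg R K A alpha w iota w_gt0 iotaP b phi).
exact: (@rank_lt R K A alpha w iota w_gt0 iotaP b phi).
Qed.
End PsetDegree.

Section OrdinalEmbedding.
Variables A B : ordnum.
Variables (i : B -> A) (a : A).
Hypotheses (imono : forall x y, olt x y -> olt (i x) (i y))
  (irange : forall c, olt c a <-> exists x, i x = c).

(** Coefficients are transported along [i] and extended by [0]; a normal form is below [omega ^ a]
    exactly when its exponents are below [a]. *)
Lemma opow_degrees : exists p : opow B -> cnf A, degrees_below (om a) p.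
Proof.
have iinj x y : i x = i y -> x = y.
  move=> e; case: (olt_total x y) => // /imono; rewrite e => /(@olt_irr _ _) [].
have ilt x y : olt (i x) (i y) -> olt x y.
  case: (olt_total x y) => // [->/(@olt_irr _ _) []|/imono yx xy].
  by case: (olt_irr (olt_trans yx xy)).
pose pf (f : cnf B) c := if pselect (exists x, i x = c) is left h then sval f (projT1 (cid h)) else 0%N.
have pfi f x : pf f (i x) = sval f x.
  rewrite /pf; case: pselect => [h|[]]; last by exists x.
  by rewrite (iinj _ _ (projT2 (cid h))).
have pfin f : finite_set [set c | pf f c <> 0%N].
  apply: sub_finite_set (finite_image i (svalP f)) => c /= nz.
  have [[x xc]|N] := pselect (exists x, i x = c); last by case: nz; rewrite /pf; case: pselect.
  by exists x => //=; rewrite -pfi xc.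
pose p f : cnf A := exist (fun f : A -> nat => finite_set [set a | f a <> 0%N]) _ (pfin f).
exists p; split=> [f g /= fg|v].
  have /cnf_ltP[x fgx eq] : (f : cnf B) <o g by apply/asboolP.
  apply/cnf_ltP; exists (i x); first by rewrite /= !pfi.
  move=> c xc /=; have [[y yc]|N] := pselect (exists x, i x = c).
    by subst c; rewrite !pfi eq//; exact: ilt.
  by rewrite /pf; case: pselect.
split=> [/lt_omP va|[f <-]]; last first.
  apply/lt_omP => c /irange nc; rewrite /= /pf; by case: pselect.
have vfin : finite_set [set x | sval v (i x) <> 0%N].
  apply: (@finite_preimage _ _ [set c | sval v c <> 0%N] i) => //; last exact: svalP v.
  by move=> x y _ _; exact: iinj.
pose f : cnf B := exist (fun f : B -> nat => finite_set [set a | f a <> 0%N]) _ vfin.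
exists f; apply: cnfP => c /=.
have [[x xc]|N] := pselect (exists x, i x = c); first by subst c; rewrite pfi.
rewrite va; last by move/irange.
by rewrite /pf; case: pselect.
Qed.
End OrdinalEmbedding.

(** The natural sum agrees with the ordinal sum here, because [u] is a multiple of [omega ^ e] and
    [v] is at most [omega ^ e]. *)
Lemma oadd_degrees (A B C : ordnum) (u v : cnf A) (p : B -> cnf A) (q : C -> cnf A) e :
  hi e u -> v <=o om e -> degrees_below u p -> degrees_below v q ->
  exists r : oadd B C -> cnf A, degrees_below (u + v) r.
Proof.
move=> hu ve [pm pr] [qm qr].
exists (fun s => match s with inl x => p x | inr y => u + q y end); split.
  move=> [x|x] [y|y] //= xy; [exact: pm| |by rewrite cnf_ltD2l; exact: qm].
  apply: (@lt_le_trans _ (cnf A) u); last exact: cnf_leDl.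
  by apply/pr; exists x.
move=> z; split=> [zuv|[[x|y] <-]]; last 2 first.
- apply: (@lt_le_trans _ (cnf A) u); last exact: cnf_leDl.
  by apply/pr; exists x.
- by rewrite cnf_ltD2l; apply/qr; exists y.
have [uz|zu] := leP (u : cnf A) z.
  have [d /qr[y yd] zE] := le_hi_add hu ve uz zuv.
  by exists (inr y); rewrite zE yd.
by have [x xz] := (pr z).1 zu; exists (inl x).
Qed.

Lemma omMn_lt (A : ordnum) (e : A) m n : (m < n)%N -> om e *+ m <o om e *+ n.
Proof.
move=> mn; rewrite -(subnKC mn) mulrnDr mulrSr -addrA -{1}[om e *+ m]addr0 cnf_ltD2l.
exact: lt_le_trans (om_gt0 e) (cnf_leDl _ _).
Qed.

Lemma onat_degrees (A B : ordnum) (u : cnf A) (p : B -> cnf A) e k :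
  (forall a, ~ olt a e) -> degrees_below u p ->
  exists r : oadd B (onat k) -> cnf A, degrees_below (u + om e *+ k) r.
Proof.
move=> e0 [pm pr].
exists (fun s => match s with inl x => p x | inr j => u + om e *+ nat_of_ord j end); split.
  move=> [x|x] [y|y] //= xy; [exact: pm| |].
    apply: (@lt_le_trans _ (cnf A) u); last exact: cnf_leDl.
    by apply/pr; exists x.
  by rewrite cnf_ltD2l; exact: omMn_lt.
move=> z; split=> [|[[x|j] <-]]; last 2 first.
- apply: (@lt_le_trans _ (cnf A) u); last exact: cnf_leDl.
  by apply/pr; exists x.
- by rewrite cnf_ltD2l; apply: omMn_lt; exact: ltn_ord.
have [uz|zu] := leP (u : cnf A) z; last first.
  by have [x xz] := (pr z).1 zu; exists (inl x).
suff : z <o u + om e *+ k -> exists2 j, (j < k)%N & z = u + om e *+ j.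
  by move=> H /H[j jk ->]; exists (inr (Ordinal jk)).
elim: k => [|k IH]; first by rewrite addr0 ltNge uz.
rewrite mulrSr addrA => /(lt_add_bot e0); rewrite le_eqVlt => /orP[/eqP->|/IH[j jk ->]].
  by exists k.
by exists j => //; exact: ltnW.
Qed.

(** * A generic copy of [omega ^ alpha] in the reals *)

Section Base4.
Variable R : realType.
Implicit Types (T : set nat) (n N : nat).

Definition digit T n : nat := `[< T n >].

Lemma digit_le1 T n : (digit T n <= 1)%N. Proof. by rewrite /digit; case: asboolP. Qed.

Definition psum T N : R := \sum_(n < N) (digit T n)%:R / 4 ^+ n.
Definition base4 T : R := sup (range (psum T)).

Lemma psumS T N : psum T N.+1 = psum T N + (digit T N)%:R / 4 ^+ N.
Proof. by rewrite /psum big_ord_recr. Qed.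

Lemma inv4_gt0 N : 0 < (4 ^+ N)^-1 :> R.
Proof. by rewrite invr_gt0 exprn_gt0. Qed.

Lemma inv4S N : (4 ^+ N.+1)^-1 = (4 ^+ N)^-1 / 4 :> R.
Proof. by rewrite exprSr invfM. Qed.

Lemma psum_step T N : psum T N <= psum T N.+1 <= psum T N + (4 ^+ N)^-1.
Proof.
have := inv4_gt0 N; rewrite psumS /digit; case: asboolP => _ /=; lra.
Qed.

Lemma psum_mono T M N : (M <= N)%N -> psum T M <= psum T N.
Proof.
elim: N => [|N IH]; first by rewrite leqn0 => /eqP->.
rewrite leq_eqVlt => /orP[/eqP->//|/IH/le_trans]; apply.
by have /andP[] := psum_step T N.
Qed.

Lemma psum_tail T M N : psum T M <= psum T N + 4 / 3 / 4 ^+ N.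
Proof.
have [MN|/ltnW NM] := leqP M N.
  by have := psum_mono T MN; have := inv4_gt0 N; lra.
suff : psum T M + 4 / 3 / 4 ^+ M <= psum T N + 4 / 3 / 4 ^+ N.
  by have := inv4_gt0 M; lra.
elim: M NM => [|M IH]; first by rewrite leqn0 => /eqP->.
rewrite leq_eqVlt => /orP[/eqP->//|/IH]; have := psum_step T M; rewrite inv4S; lra.
Qed.

Lemma base4_bound T N : psum T N <= base4 T <= psum T N + 4 / 3 / 4 ^+ N.
Proof.
have ub : ubound (range (psum T)) (psum T N + 4 / 3 / 4 ^+ N).
  by move=> _ [M _ <-]; exact: psum_tail.
apply/andP; split.
  by apply: ub_le_sup; [exists (psum T N + 4 / 3 / 4 ^+ N)|exists N].
by apply: ge_sup => //; exists (psum T N), N.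
Qed.

Lemma base4_ge0 T : 0 <= base4 T.
Proof. by have := base4_bound T 0; rewrite /psum big_ord0; lra. Qed.

(** Digits [0] and [1] in base [4] add up without carries. *)
Lemma base4_digits T1 T2 T3 T4 : base4 T1 + base4 T2 = base4 T3 + base4 T4 ->
  forall n, (digit T1 n + digit T2 n)%N = (digit T3 n + digit T4 n)%N.
Proof.
suff H T T' U U' n : base4 T + base4 T' = base4 U + base4 U' ->
    (forall m, (m < n)%N -> (digit T m + digit T' m)%N = (digit U m + digit U' m)%N) ->
    (digit U n + digit U' n <= digit T n + digit T' n)%N.
  move=> e n; elim/ltn_ind: n => n IH; apply/eqP; rewrite eqn_leq.
  by rewrite (H _ _ _ _ n e)// andbT (H _ _ _ _ n (esym e))// => m /IH.
move=> e eqd; rewrite leqNgt; apply/negP => lt.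
have ps : psum T n + psum T' n = psum U n + psum U' n.
  rewrite /psum -!big_split /=; apply: eq_bigr => m _.
  by rewrite -!mulrDl -!natrD eqd.
have := base4_bound T n.+1; have := base4_bound T' n.+1.
have := base4_bound U n.+1; have := base4_bound U' n.+1.
(* Each tail after digit [n] is at most a third of [(4 ^+ n)^-1], so two tails cannot make up for a
   missing unit. *)
rewrite !psumS inv4S.
have lt' : (digit T n)%:R + (digit T' n)%:R + 1 <= (digit U n)%:R + (digit U' n)%:R :> R.
  by rewrite -!natrD -[1]/(1%:R) -natrD ler_nat addn1.
have p := inv4_gt0 n; have := ler_wpM2r (ltW p) lt'; rewrite !mulrDl mul1r.
set t := (4 ^+ n)^-1 in p *; set d1 := _%:R / _; set d2 := (digit T' n)%:R * _.
set d3 := (digit U n)%:R * _; set d4 := (digit U' n)%:R * _.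
lra.
Qed.

Lemma digit_eq T U : (forall n, digit T n = digit U n) -> T = U.
Proof.
move=> H; apply/seteqP; split=> n Tn; have := H n; rewrite /digit.
  by case: (asboolP (U n)) => //; case: asboolP.
by case: (asboolP (T n)) => //; case: asboolP.
Qed.

Lemma base4_inj T U : base4 T = base4 U -> T = U.
Proof.
move=> e; apply: digit_eq => n.
have := @base4_digits T T U U _ n; rewrite e => /(_ erefl).
by rewrite !addnn => /double_inj.
Qed.

Lemma base4_le T U : T `<=` U -> base4 T <= base4 U.
Proof.
move=> TU; apply: ge_sup; first by exists (psum T 0), 0%N.
move=> _ [N _ <-]; apply: (@le_trans _ _ (psum U N)); last by have /andP[] := base4_bound U N.
apply: ler_sum => n _; apply: ler_wpM2r; first exact: ltW (inv4_gt0 _).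
rewrite ler_nat /digit; case: asboolP => // /TU Un; by case: asboolP.
Qed.

Lemma base4_lt T U : T `<=` U -> T <> U -> base4 T < base4 U.
Proof.
by move=> TU nTU; rewrite lt_neqAle base4_le// andbT; apply/eqP => /base4_inj.
Qed.

Lemma small_tail (e : R) : 0 < e -> exists N, 4 / 3 / 4 ^+ N < e.
Proof.
move=> e0; have [N HN] : exists N : nat, e^-1 < N%:R.
  by exists (Num.bound e^-1); apply: archi_boundP; rewrite invr_ge0 ltW.
exists N.+1; rewrite inv4S.
have N0 : 0 < N%:R :> R by apply: lt_trans HN; rewrite invr_gt0.
have N4 : N%:R <= 4 ^+ N :> R by rewrite -natrX ler_nat ltnW// ltn_expl.
have : (4 ^+ N)^-1 < e.
  rewrite -[e]invrK ltf_pV2 ?posrE ?invr_gt0 ?exprn_gt0//; exact: lt_le_trans HN N4.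
lra.
Qed.

(** For nested sets the digit sum determines both: the smaller set is where it is [2], the larger
    where it is positive. *)
Lemma chain_digits T1 T2 T3 T4 : T1 `<=` T2 \/ T2 `<=` T1 -> T3 `<=` T4 \/ T4 `<=` T3 ->
  (forall n, (digit T1 n + digit T2 n)%N = (digit T3 n + digit T4 n)%N) ->
  T1 = T3 \/ T1 = T4.
Proof.
move=> c12 c34 H.
have sub T U n : T `<=` U -> (digit T n <= digit U n)%N.
  by move=> TU; rewrite /digit; case: asboolP => // /TU Un; case: asboolP.
case: c12 c34 => [s12|s21] [s34|s43].
- left; apply: digit_eq => n; have := H n; have := sub _ _ n s12; have := sub _ _ n s34.
  have := digit_le1 T2 n; have := digit_le1 T4 n; lia.
- right; apply: digit_eq => n; have := H n; have := sub _ _ n s12; have := sub _ _ n s43.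
  have := digit_le1 T2 n; have := digit_le1 T3 n; lia.
- right; apply: digit_eq => n; have := H n; have := sub _ _ n s21; have := sub _ _ n s34.
  have := digit_le1 T1 n; have := digit_le1 T4 n; lia.
- left; apply: digit_eq => n; have := H n; have := sub _ _ n s21; have := sub _ _ n s43.
  have := digit_le1 T1 n; have := digit_le1 T3 n; lia.
Qed.
End Base4.

Lemma cnf_countable (A : ordnum) : ocountable A ->
  exists nu : cnf A -> nat, injective nu.
Proof.
move=> /countable_injP[e einj].
have einj' : injective e by move=> x y; apply: einj; rewrite inE.
pose gr (f : cnf A) : set (nat * nat) := [set p | exists a, p = (e a, sval f a) /\ sval f a <> 0%N].
have grfin f : finite_set (gr f).
  apply: sub_finite_set (finite_image (fun a => (e a, sval f a)) (svalP f)).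
  by move=> p [a [-> nz]]; exists a.
pose en f : seq (nat * nat) := enum_fset (fset_set (gr f)).
have enE f p : p \in en f <-> gr f p.
  by rewrite (_ : (p \in en f) = (p \in fset_set (gr f)))// in_fset_set// inE.
exists (fun f => @choice.pickle (seq (nat * nat))%type (en f)) => f g /(pcan_inj (@choice.pickleK _)) enfg.
have fg : gr f = gr g by apply/seteqP; split=> p /enE; [rewrite enfg|rewrite -enfg] => /enE.
have half (h k : cnf A) a : gr h = gr k -> sval h a <> 0%N -> sval h a = sval k a.
  move=> hk nz; have : gr h (e a, sval h a) by exists a.
  by rewrite hk => -[b [[/einj' <-] <-]].
apply: cnfP => a; have [fa|nfa] := pselect (sval f a = 0%N); last exact: half.
have [ga|nga] := pselect (sval g a = 0%N); first by rewrite fa ga.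
by apply/esym/half.
Qed.

Section Generic.
Variables (R : realType) (K : fieldType) (alpha : ordnum) (a0 : alpha).
Variables (nu : cnf alpha -> nat) (nu_inj : injective nu).
Implicit Types (f g h : cnf alpha) (x y : R) (N : nat).

(** Each index is coded by the labels of the indices at or above it. These sets shrink as [f] grows,
    so [gen_point] is increasing, and they form a chain, as [chain_digits] requires. *)
Definition upper_nu f : set nat := [set n | exists g, f <=o g /\ nu g = n].
Definition gen_point f : R := - base4 R (upper_nu f).

Lemma upper_nu_sub f g : f <=o g -> upper_nu g `<=` upper_nu f.
Proof. by move=> fg n [h [gh hn]]; exists h; split=> //; exact: le_trans gh. Qed.

Lemma upper_nu_lt f g : f <o g -> ~ upper_nu g (nu f).
Proof. by move=> fg [h [gh /nu_inj hf]]; rewrite hf leNgt fg in gh. Qed.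

Lemma gen_point_mono f g : f <o g -> gen_point f < gen_point g.
Proof.
move=> fg; rewrite ltrN2; apply: base4_lt; first exact: upper_nu_sub (ltW fg).
by move=> e; apply: (upper_nu_lt fg); rewrite e; exists f.
Qed.

Lemma gen_point_lt f g : gen_point f < gen_point g -> f <o g.
Proof.
move=> lt; rewrite ltNge le_eqVlt; apply/negP => /orP[/eqP e|/gen_point_mono/(lt_trans lt)].
  by rewrite e ltxx in lt.
by rewrite ltxx.
Qed.

Lemma gen_point_inj : injective gen_point.
Proof.
move=> f g e; apply/eqP; rewrite -[_ == _]negbK neq_lt; apply/negP => /orP[] /gen_point_mono;
  by rewrite e ltxx.
Qed.

Lemma gen_point_lt0 f : gen_point f < 0.
Proof.
rewrite oppr_lt0; apply: (@le_lt_trans _ _ (base4 R set0)); first exact: base4_ge0.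
apply: base4_lt => // e; have : upper_nu f (nu f) by exists f.
by rewrite -e.
Qed.

Lemma above_finite N : exists f, forall g, (nu g < N)%N -> g <o f.
Proof.
elim: N => [|N [f Hf]]; first by exists 0.
have [[g gN]|no] := pselect (exists g, nu g = N).
  exists (f + g + om a0) => h; rewrite ltnS leq_eqVlt => /orP[/eqP hN|/Hf hf].
    rewrite (nu_inj (etrans hN (esym gN))) -addrA addrC -addrA -{1}[g]addr0 cnf_ltD2l.
    exact: lt_le_trans (om_gt0 a0) (cnf_leDl _ _).
  by apply: lt_le_trans hf _; rewrite -addrA cnf_leDl.
exists f => h; rewrite ltnS leq_eqVlt => /orP[/eqP hN|/Hf//].
by case: no; exists h.
Qed.

Lemma gen_point_cofinal (e : R) : 0 < e -> exists f, - e < gen_point f.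
Proof.
move=> /small_tail[N HN]; have [f Hf] := above_finite N; exists f.
rewrite ltrN2; apply: le_lt_trans HN; have /andP[_] := base4_bound R (upper_nu f) N.
rewrite /psum big1 ?add0r// => n _; rewrite /digit; case: asboolP => [[g [fg gn]]|]; last by rewrite mul0r.
by have := Hf g; rewrite gn ltn_ord ltNge fg => /(_ erefl).
Qed.

Lemma below_finite f N : (forall g, g <o f -> (N <= nu g)%N) \/
  exists2 h, h <o f & forall g, g <o f -> (nu g < N)%N -> g <=o h.
Proof.
elim: N => [|N IH]; first by left.
have [[k [kf kN]]|no] := pselect (exists k, k <o f /\ nu k = N); last first.
  case: IH => [H|[h hf Hh]]; [left|right; exists h => //] => g gf.
    by rewrite ltn_neqAle H// andbT; apply/eqP => E; apply: no; exists g.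
  rewrite ltnS leq_eqVlt => /orP[/eqP gN|]; last exact: Hh.
  by case: no; exists g.
right; case: IH => [H|[h hf Hh]].
  exists k => // g gf; rewrite ltnS leq_eqVlt => /orP[/eqP gN|].
    by rewrite (nu_inj (etrans gN (esym kN))).
  by rewrite ltnNge H.
have [hk|/ltW kh] := leP (h : cnf alpha) k.
  exists k => // g gf; rewrite ltnS leq_eqVlt => /orP[/eqP gN|/(Hh _ gf) gh].
    by rewrite (nu_inj (etrans gN (esym kN))).
  exact: le_trans gh hk.
exists h => // g gf; rewrite ltnS leq_eqVlt => /orP[/eqP gN|/(Hh _ gf)//].
by rewrite (nu_inj (etrans gN (esym kN))).
Qed.

(** Otherwise let [f] be the first index with point above [x]. Indices [g < f] with points close to
    [x] exceed the finitely many [h < f] labelled below [N], so the codes of [g] and [f] agree in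
    the first [N] digits and the point of [g] is above [x] as well. *)
Lemma clo_gen_point (b : gps R K) x : (forall y, b y != 0 -> exists f, gen_point f = y) ->
  clo b x -> x = 0 \/ exists f, gen_point f = x.
Proof.
move=> Hb /cloP[x0 Hx]; have [->|nx0] := eqVneq x 0; first by left.
right; apply: contrapT => nr; have {}x0 : x < 0 by rewrite lt_neqAle nx0.
have [f' xf'] := gen_point_cofinal (e := - x) ltac:(lra); rewrite opprK in xf'.
have [f xf fmin] := @cnf_least _ (fun g => x <= gen_point g) (ex_intro _ f' (ltW xf')).
have {}xf : x < gen_point f by rewrite lt_neqAle xf andbT; apply/eqP => e; apply: nr; exists f.
have [N HN] := @small_tail R (gen_point f - x) ltac:(lra).
have key g : g <o f -> (forall h, h <o f -> (nu h < N)%N -> h <o g) -> x < gen_point g.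
  move=> gf Hg; suff : base4 R (upper_nu g) <= base4 R (upper_nu f) + 4 / 3 / 4 ^+ N.
    by move: HN; rewrite /gen_point; lra.
  have /andP[_ h1] := base4_bound R (upper_nu g) N.
  have /andP[h2 _] := base4_bound R (upper_nu f) N.
  suff : psum R (upper_nu g) N = psum R (upper_nu f) N by lra.
  apply: eq_bigr => n _; congr (_%:R / _); rewrite /digit; congr nat_of_bool.
  apply: asbool_equiv_eq; split; last exact: upper_nu_sub (ltW gf) n.
  move=> [h [gh hn]]; exists h; split=> //; rewrite leNgt; apply/negP => hf.
  by have := Hg h hf; rewrite hn ltn_ord ltNge gh => /(_ erefl).
have [d d0 Hd] : exists2 d : R, 0 < d & forall g, x - d < gen_point g -> g <o f ->
    forall h, h <o f -> (nu h < N)%N -> h <o g.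
  case: (below_finite f N) => [H|[h hf Hh]].
    by exists 1 => // g _ _ h hf; rewrite ltnNge H.
  have hx : gen_point h < x.
    by rewrite ltNge; apply/negP => /fmin; rewrite leNgt hf.
  exists (x - gen_point h); first lra.
  move=> g xg gf k kf kN; apply: le_lt_trans (Hh k kf kN) _; apply: gen_point_lt; lra.
have [y [xy yx /Hb[g gy]]] := Hx d d0.
have gf : g <o f by apply: gen_point_lt; lra.
have := key g gf (Hd g ltac:(lra) gf); lra.
Qed.

(** The identity [x + (x' + y) = x' + (x + y)] becomes an equality of digit sums for two pairs from
    one chain of sets, the empty set coding [0]. Hence [x] equals [x'] or [x + y], and the latter
    contradicts [y < 0]. *)
Lemma scattered_gen_point (b : gps R K) :
  (forall y, b y != 0 -> exists f, gen_point f = y) -> scattered b.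
Proof.
move=> Hb; pose ch T := T = set0 \/ exists f, T = upper_nu f.
have comp T U : ch T -> ch U -> T `<=` U \/ U `<=` T.
  move=> [->|[f ->]]; first by left.
  move=> [->|[g ->]]; first by right.
  by have [fg|/ltW gf] := leP (f : cnf alpha) g; [right|left]; exact: upper_nu_sub.
have base0 : base4 R set0 = 0.
  apply/eqP; rewrite eq_le base4_ge0 andbT; apply: ge_sup; first by exists (psum R set0 0), 0%N.
  move=> _ [N _ <-]; rewrite /psum big1// => n _.
  by rewrite /digit; case: asboolP => //; rewrite mul0r.
have cP z : clo b z -> exists T, ch T /\ z = - base4 R T.
  move=> /(clo_gen_point Hb)[->|[f <-]].
    by exists set0; split; [left|rewrite base0 oppr0].
  by exists (upper_nu f); split=> //; right; exists f.
move=> x x' y /cP[T1 [c1 e1]] /cP[T3 [c3 e3]] y0 /cP[T4 [c4 e4]] /cP[T2 [c2 e2]].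
have /base4_digits/(chain_digits (comp _ _ c1 c2) (comp _ _ c3 c4))[] :
    base4 R T1 + base4 R T2 = base4 R T3 + base4 R T4 by lra.
  by move=> e; rewrite e1 e3 e.
by move=> e; rewrite -e in e4; lra.
Qed.

Definition gen_fun (chi : cnf alpha -> K) x : K :=
  if pselect (exists f, gen_point f = x) is left h then chi (projT1 (cid h)) else 0.

Lemma gen_funE chi f : gen_fun chi (gen_point f) = chi f.
Proof.
rewrite /gen_fun; case: pselect => [h|[]]; last by exists f.
by rewrite (gen_point_inj (projT2 (cid h))).
Qed.

Lemma gen_fun0 chi x : gen_fun chi x != 0 -> exists f, gen_point f = x.
Proof. by rewrite /gen_fun; case: pselect => // _; rewrite eqxx. Qed.

Lemma gen_is_gps chi : is_gps (gen_fun chi).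
Proof.
apply/asboolP; split; last by move=> x /gen_fun0[f <-]; exact: ltW (gen_point_lt0 f).
move=> D sD [x Dx]; have [f fx] := gen_fun0 (sD _ Dx).
have [g Dg gmin] := @cnf_least _ (fun f => D (gen_point f)) (ex_intro _ f (eq_ind_r D Dx fx)).
exists (gen_point g) => // y Dy; have [h hy] := gen_fun0 (sD _ Dy); subst y.
by rewrite leNgt; apply/negP => /gen_point_lt; rewrite ltNge gmin.
Qed.

Definition gen chi : gps R K := Gps (gen_is_gps chi).

Lemma genE chi f : gen chi (gen_point f) = chi f. Proof. exact: gen_funE. Qed.

Lemma gen_support chi x : gen chi x != 0 -> exists f, gen_point f = x.
Proof. exact: gen_fun0. Qed.

Lemma gen_sum n (la : 'I_n -> K) (chi : 'I_n -> cnf alpha -> K) :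
  \sum_i la i *: gen (chi i) = gen (fun f => \sum_i la i * chi i f).
Proof.
have sumE (s : seq 'I_n) (F : 'I_n -> gps R K) x : (\sum_(p <- s) F p) x = \sum_(p <- s) F p x.
  by elim: s => [|a s IH]; rewrite ?big_nil// !big_cons coefD IH.
apply: gpsP => x; rewrite sumE; have [[f <-]|N] := pselect (exists f, gen_point f = x).
  by rewrite genE; apply: eq_bigr => i _; rewrite coefZ genE.
have z chi' : gen chi' x = 0 by apply/eqP/negPn/negP => /gen_support.
by rewrite z big1// => i _; rewrite coefZ z mulr0.
Qed.

Lemma Pset_gen chi : (forall f, chi f != 0) -> Pset R K alpha (gen chi).
Proof.
move=> chi0; have suppE f : supp (gen chi) (gen_point f).
  by rewrite /supp /fsupport /= gen_funE.
split.
  pose to (x : supp_ordinal (gen chi)) : opow alpha := projT1 (cid (gen_support (svalP (x : {x | supp (gen chi) x})))).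
  have toE (z : supp_ordinal (gen chi)) : gen_point (to z) = sval (z : {x | supp (gen chi) x}).
    exact: (projT2 (cid (gen_support (svalP (z : {x | supp (gen chi) x}))))).
  pose from (f : opow alpha) : supp_ordinal (gen chi) := exist _ (gen_point f) (suppE f).
  exists to.
    exists from => [x|f]; last by apply: gen_point_inj; rewrite toE.
    move: (toE x); rewrite /from; case: x => x px /= e.
    by move: (suppE _); rewrite e => px'; congr exist; exact: Prop_irrelevance.
  move=> x y; rewrite /= /supp_lt -!toE; split.
    by move=> xy; apply: gen_point_mono; apply/asboolP.
  by move=> /gen_point_lt/asboolP.
have hs : has_sup (supp (gen chi)).
  by split; [exists (gen_point 0)|exists 0 => x /supp_le0].
apply/eqP; rewrite eq_le; apply/andP; split.
  by apply: ge_sup => [|x /supp_le0//]; case: hs.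
rewrite leNgt; apply/negP => s0; have [f sf] := gen_point_cofinal (e := - sup (supp (gen chi))) ltac:(lra).
have := ub_le_sup hs.2 (suppE f); rewrite opprK in sf; lra.
Qed.

(** Points with label below [N] stay away from [0], so near [0] the support of [gen chi] consists of
    all the points and contains that of [gen chi']. *)
Lemma not_dlt_gen (A : ordnum) (w : cnf A) chi chi' N : 0 <o w ->
  (forall f, (N <= nu f)%N -> chi f != 0) -> ~ dlt (gen chi') w -> ~ dlt (gen chi) w.
Proof.
move=> w0 chi0 nlt low; apply: nlt; apply: dlt_support low => //.
have [f Hf] := above_finite N; exists (- gen_point f); first by rewrite oppr_gt0 gen_point_lt0.
move=> x; rewrite opprK => fx x0 cx; apply/eqP/negPn/negP => /gen_support[g gx].
subst x; move: cx; rewrite genE; apply/eqP; apply: chi0; rewrite leqNgt.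
by apply/negP => /Hf/gen_point_mono/(lt_trans fx); rewrite ltxx.
Qed.
End Generic.

(** * Independence of the series with coefficients given by powers of labels *)

Lemma poly_no_large_root (K : fieldType) (p : {poly K}) :
  [pchar K] =i pred0 -> p != 0 -> exists N, forall n, (N <= n)%N -> p.[n.+1%:R] != 0.
Proof.
move=> charK; have natinj (m n : nat) : m%:R = n%:R :> K -> m = n.
  wlog mn : m n / (m <= n)%N => [H e|].
    by case/orP: (leq_total m n) => [/H|/H/(_ (esym e))]; [exact|].
  move=> e; have : (n - m)%:R == 0 :> K by rewrite natrB// e subrr.
  by rewrite ((pcharf0P K).1 charK) subn_eq0 => nm; apply/eqP; rewrite eqn_leq mn.
have [m] := ubnP (size p); elim: m p => // m IH p; rewrite ltnS => sp p0.
have [[n0 /eqP/factor_theorem[q pq]]|N] := pselect (exists n : nat, p.[n.+1%:R] = 0); last first.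
  by exists 0%N => n _; apply/eqP => e; apply: N; exists n.
have q0 : q != 0 by apply: contraNneq p0 => e; rewrite pq e mul0r.
have [|N HN] := IH q _ q0.
  by move: sp; rewrite pq size_Mmonic ?monicXsubC// size_XsubC addn2.
exists (maxn N n0.+1) => n; rewrite geq_max => /andP[Nn n0n].
rewrite pq hornerM mulf_neq0 ?HN// hornerXsubC subr_eq0; apply/eqP => /natinj[e].
by rewrite e ltnn in n0n.
Qed.

Theorem corollary1p6 (R : realType) (K : fieldType)
    (charK : [pchar K] =i pred0)
    (alpha beta1 beta2 : ordnum) (k : nat)
    (alpha_lt_omega1 : ocountable alpha)
    (beta2_le_beta1 : ole beta2 beta1)
    (alphaE : oiso alpha (oadd (oadd (opow beta1) (opow beta2)) (onat k))) :
  infinite_codim (linear_span (Rset R K alpha)) (linear_span (Pset R K alpha)).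
Proof.
(* The point [a1] has exactly [beta1] below it; the summand [univ R] makes all degrees
   expressible. *)
pose A := oadd (oadd beta1 (onat 1)) (univ R).
have bounded := @univ_bounded R K A inr (fun p q h => h).
pose i1 (x : beta1) : A := inl (inl x).
pose a1 : A := inl (inr ord0).
have range1 c : olt c a1 <-> exists x, i1 x = c.
  split=> [|[x <-]//]; case: c => [[x _|]|]//; by exists x.
have [j jmono jinit] := beta2_le_beta1.
pose i2 (x : beta2) : A := i1 (j x).
(* [a2] is the first point outside the image of [beta2], so that exactly a copy of [beta2] lies
   below it. *)
have [a2 [na2 a2min]] : exists a2 : A, (~ exists x, i2 x = a2) /\
    forall c, olt c a2 -> exists x, i2 x = c.
  have : ~ exists x, i2 x = a1 by case.
  elim: (olt_wf a1) => {}c _ IH nc.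
  have [[d [dc nd]]|H] := pselect (exists d, olt d c /\ ~ exists x, i2 x = d); first exact: IH nd.
  by exists c; split=> // d dc; apply: contrapT => nd; apply: H; exists d.
have range2 c : olt c a2 <-> exists x, i2 x = c.
  split=> [/a2min//|[x <-]]; case: (olt_total (i2 x) a2) => // [e|lt].
    by case: na2; exists x.
  have [y yE] : exists y, i1 y = a2.
    by apply/range1; apply: olt_trans lt _; apply/range1; exists (j x).
  case: na2; have [z zy] := jinit x y ltac:(by move: lt; rewrite -yE).
  by exists z; rewrite /i2 zy.
have a12 : ~ olt a1 a2 by move=> /range2[].
have [e0 e0_min] : exists e0 : A, forall a, ~ olt a e0.
  elim: (olt_wf a1) => {}c _ IH.
  have [[d dc]|H] := pselect (exists d, olt d c); first exact: IH dc.
  by exists c => d dc; apply: H; exists d.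
pose w : cnf A := om a1 + om a2 + om e0 *+ k.
have w0 : 0 <o w by apply: lt_le_trans (om_gt0 a1) _; rewrite /w -addrA cnf_leDl.
have [iota iotaP] : exists iota : alpha -> cnf A, degrees_below w iota.
  have [p1 P1] := @opow_degrees A beta1 i1 a1 (fun _ _ h => h) range1.
  have [p2 P2] := @opow_degrees A beta2 i2 a2 (fun x y h => (jmono x y).2 h) range2.
  have [p12 P12] := oadd_degrees (hi_le a12 (@hi_om _ a1)) (lexx _) P1 P2.
  have [p [pm pr]] := onat_degrees k e0_min P12.
  case: alphaE => f [g fg gf] fmono; exists (fun x => p (f x)); split.
    by move=> x y /fmono/pm.
  move=> v; rewrite pr; split=> [[x <-]|[x <-]]; last by exists (f x).
  by exists (g x); rewrite gf.
have [a0 _] : exists a, iota a = 0 by apply/iotaP.2.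
have [nu nu_inj] := cnf_countable alpha_lt_omega1.
(* Combinations of these functions are polynomials in the label; the successor keeps the
   coefficients nonzero. *)
pose chi (m : nat) f : K := (nu f).+1%:R ^+ m.
have chi0 m f : chi m f != 0 by rewrite expf_neq0// ((pcharf0P K).1 charK).
pose v m := gen R nu_inj (chi m).
have vP m : Pset R K alpha (v m) by exact: Pset_gen.
have Rspan b : linear_span (Rset R K alpha) b -> prodspan w b.
  move=> [n [a [u [Ru ->]]]]; apply: prodspan_sum => i _; apply: prodspanZ.
  have [Pu red] := Ru i; have [du gu] := Pset_degree w0 iotaP Pu.
  exact: (prodspan_reducible charK bounded).
move=> [n [u [_ Hu]]].
(* If [n] classes spanned the quotient, a nontrivial combination [s] of the [n + 1] series [v m]
   would satisfy [prodspan w]. *)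
have /choice[a aP] (m : 'I_n.+1) : exists a : 'I_n -> K,
    linear_span (Rset R K alpha) (v m - \sum_i a i *: u i).
  apply: Hu; exists 1%N, (fun=> 1), (fun=> v m); split=> // .
  by rewrite big_ord1 scale1r.
have [mu [m0 mu0] mua] := lin_dep a.
pose s := \sum_m mu m *: v m.
have ps : prodspan w s.
  have := prodspan_sum (P := xpredT) (index_enum _) (fun m _ => prodspanZ (mu m) (Rspan _ (aP m))).
  congr prodspan; rewrite (eq_bigr (fun m : 'I_n.+1 => mu m *: v m -
      \sum_i (mu m * a m i) *: u i)); last first.
    move=> m _; rewrite scalerBr; congr (_ - _).
    by rewrite scaler_sumr; apply: eq_bigr => i _; rewrite scalerA.
  rewrite sumrB exchange_big /= [X in _ - X]big1 ?subr0// => i _.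
  by rewrite -scaler_suml mua scale0r.
have sE : s = gen R nu_inj (fun f => \sum_m mu m * chi m f) by exact: gen_sum.
(* The coefficients of [s] are values of [p], nonzero at all large labels, so [s] is not below
   [w]. *)
pose p : {poly K} := \poly_(m < n.+1) mu (inord m).
have p0 : p != 0.
  apply: contraNneq mu0 => /(congr1 (fun q : {poly K} => q`_m0)).
  by rewrite coef0 coef_poly ltn_ord inord_val => ->.
have [N HN] := poly_no_large_root charK p0.
have ns : ~ dlt s w.
  have [[_ nv] _] := Pset_degree w0 iotaP (vP 0%N).
  rewrite sE; apply: (@not_dlt_gen R K alpha a0 nu nu_inj A w _ (chi 0%N) N w0 _ nv) => f /HN.
  rewrite horner_poly; apply: contra_neq => e; rewrite -[RHS]e.
  by apply: eq_bigr => m _; rewrite inord_val.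
(* The excluded combination is [s] itself, regarded as its single germ at [0]. *)
apply: (@not_prodspan R K A charK bounded a1 a2 e0 a12 e0_min k s 1 (fun=> 0) (fun=> 1) ord0).
- by rewrite sE; apply: (scattered_gen_point a0 nu_inj) => y /gen_support.
- by move=> x y _; rewrite !ord1.
- by [].
- by move=> _ ; apply: (@not_dlt_clo R K A s 0 w); rewrite gm0.
- by rewrite gm0.
- exact: oner_neq0.
- by rewrite big_ord1 scale1r gm0.
Qed.
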